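(* Let ${}_{\mathbb{S}}D\subset\mathbb{S}^{n-1}$ be a control set with nonvoid interior for the system induced on the unit sphere $\mathbb{S}^{n-1}$ by the homogeneous bilinear control system $\dot x(t)=A(u(t))x(t)$, and suppose that (i) every point in $\mathrm{int}({}_{\mathbb{S}}D)$ is locally accessible (for the induced system on $\mathbb{S}^{n-1}$); (ii) there are $\alpha_0^+>1$, $\delta_0>0$, and $\alpha^-\in(0,1)$ such that for all $\alpha^+\in(\alpha_0^+,\alpha_0^++\delta_0)$ there are points $s^+,s^-\in\mathrm{int}({}_{\mathbb{S}}D)$, controls $u^+,u^-\in\mathcal{U}$, and times $\sigma^+,\sigma^->0$ with $$\varphi(\sigma^+,s^+,u^+)=\alpha^+s^+,\qquad \varphi(\sigma^-,s^-,u^-)=\alpha^-s^-.$$ Then the cone $\{\alpha s\in\mathbb{R}^n \mid \alpha>0,\ s\in{}_{\mathbb{S}}D\}$ is a control set in $\mathbb{R}^n$ (for the homogeneous bilinear system) with nonvoid interior.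
   Context: Setting. Let $A,B_1,\dots,B_m\in\mathbb{R}^{n\times n}$, $\Omega\subset\mathbb{R}^m$, $\mathcal{U}=\{u\in L^\infty(\mathbb{R},\mathbb{R}^m)\mid u(t)\in\Omega \text{ for almost all } t\}$, and $A(u)=A+\sum_{i=1}^m u_iB_i$. The homogeneous bilinear control system is $\dot x(t)=A(u(t))x(t)$, $u\in\mathcal{U}$; its solution with $\varphi(0,x,u)=x$ is denoted $\varphi(t,x,u)$, $t\in\mathbb{R}$. Induced system on the sphere. The projected trajectories $s(t,s_0,u)=\varphi(t,s_0,u)/\|\varphi(t,s_0,u)\|$, $s_0\in\mathbb{S}^{n-1}$ (Euclidean unit sphere), are the trajectories of the control-affine system on $\mathbb{S}^{n-1}$ given by $\dot s=h(u(t),s)=h_0(s)+\sum_i u_i(t)h_i(s)$ with $h_0(s)=As-(s^\top As)s$, $h_i(s)=B_is-(s^\top B_is)s$. For any of these control systems on a state space $M$ (with solutions generically written $\varphi(t,x,u)$) let $\mathcal{O}^+_{\le T}(x)=\{\varphi(t,x,u)\mid 0\le t\le T,\ u\in\mathcal{U}\}$, $\mathcal{O}^-_{\le T}(x)=\{y\in M\mid x=\varphi(t,y,u)\text{ for some }0\le t\le T,\ u\in\mathcal{U}\}$, and $\mathcal{O}^\pm(x)=\bigcup_{T>0}\mathcal{O}^\pm_{\le T}(x)$. A point $x$ is locally accessible if $\mathcal{O}^+_{\le T}(x)$ and $\mathcal{O}^-_{\le T}(x)$ have nonvoid interior for all $T>0$. Control set. A nonvoid set $D\subset M$ is a control set if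 (i) for all $x\in D$ there is $u\in\mathcal{U}$ with $\varphi(t,x,u)\in D$ for all $t\ge0$; (ii) for all $x\in D$ one has $D\subset\overline{\mathcal{O}^+(x)}$; (iii) $D$ is maximal with these properties, i.e. if $D'\supset D$ satisfies (i) and (ii) then $D'=D$. *)

(* Defs.v *)
From HB Require Import structures.
From mathcomp Require Import all_boot all_order all_algebra.
From mathcomp Require Import all_classical all_reals all_analysis.

Set Implicit Arguments.
Unset Strict Implicit.
Unset Printing Implicit Defensive.

Import Order.TTheory GRing.Theory Num.Theory.
Import numFieldNormedType.Exports.

Local Open Scope classical_set_scope.
Local Open Scope ring_scope.

(* [sol u x p] is to be read: [p] is the trajectory t |-> phi(t, x, u), t in R,
   on the state space [M].  [C] is the type of control functions and [U] the set
   of admissible ones. *)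

Definition reach_le (R : realType) (C : Type) (M : topologicalType)
    (U : set C) (sol : C -> M -> (R -> M) -> Prop) (T : R) (x : M) : set M :=
  [set y | exists t u p, [/\ 0 <= t <= T, U u, sol u x p & p t = y]].

Definition coreach_le (R : realType) (C : Type) (M : topologicalType)
    (U : set C) (sol : C -> M -> (R -> M) -> Prop) (T : R) (x : M) : set M :=
  [set y | exists t u p, [/\ 0 <= t <= T, U u, sol u y p & p t = x]].

Definition reach (R : realType) (C : Type) (M : topologicalType)
    (U : set C) (sol : C -> M -> (R -> M) -> Prop) (x : M) : set M :=
  \bigcup_(T in [set T : R | 0 < T]) reach_le U sol T x.

Definition locally_accessible (R : realType) (C : Type) (M : topologicalType)
    (U : set C) (sol : C -> M -> (R -> M) -> Prop) (x : M) : Prop :=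
  forall T : R, 0 < T ->
    (reach_le U sol T x)° !=set0 /\ (coreach_le U sol T x)° !=set0.

Definition viable (R : realType) (C : Type) (M : topologicalType)
    (U : set C) (sol : C -> M -> (R -> M) -> Prop) (D : set M) : Prop :=
  forall x, D x ->
    exists u p, [/\ U u, sol u x p & forall t : R, 0 <= t -> D (p t)].

Definition approx_controllable (R : realType) (C : Type) (M : topologicalType)
    (U : set C) (sol : C -> M -> (R -> M) -> Prop) (D : set M) : Prop :=
  forall x, D x -> D `<=` closure (reach U sol x).

Definition control_set (R : realType) (C : Type) (M : topologicalType)
    (U : set C) (sol : C -> M -> (R -> M) -> Prop) (D : set M) : Prop :=
  [/\ D !=set0, viable U sol D, approx_controllable U sol D &
      forall D' : set M, D `<=` D' ->
        viable U sol D' -> approx_controllable U sol D' -> D' = D].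

(* An element of L^oo(R, R^m) is represented by a Borel function with
   essentially bounded components; every class has such a representative, and
   neither membership in [admissible] nor the trajectories depend on it. *)
Definition admissible (R : realType) (m : nat) (Omega : set 'cV[R]_m) :
    set (R -> 'cV[R]_m) :=
  [set u : R -> 'cV[R]_m |
     (forall i : 'I_m,
        (fun t : R => u t i 0) \in Lfun (@lebesgue_measure R) +oo%E) /\
     {ae @lebesgue_measure R, forall t, Omega (u t)}].

Definition bilinear_mx (R : realType) (n m : nat)
    (A : 'M[R]_n) (B : 'I_m -> 'M[R]_n) (u : 'cV[R]_m) : 'M[R]_n :=
  A + \sum_(i < m) u i 0 *: B i.

(* Caratheodory solutions of x' = A(u(t)) x on the whole of R, in integral form;
   quantifying over a <= b covers negative times without oriented integrals. *)
Definition bilinear_sol (R : realType) (n m : nat)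
    (A : 'M[R]_n) (B : 'I_m -> 'M[R]_n)
    (u : R -> 'cV[R]_m) (x : 'cV[R]_n) (p : R -> 'cV[R]_n) : Prop :=
  [/\ continuous p, p 0 = x &
      forall (a b : R) (i : 'I_n), a <= b ->
        p b i 0 - p a i 0 =
          Rintegral (@lebesgue_measure R) `[a, b]
            (fun t => (bilinear_mx A B (u t) *m p t) i 0)].

(* The library norm on matrices is the sup norm. *)
Definition enorm (R : realType) (n : nat) (x : 'cV[R]_n) : R :=
  Num.sqrt (\sum_(i < n) x i 0 ^+ 2).

Definition unit_sphere (R : realType) (n : nat) : set 'cV[R]_n :=
  [set x | enorm x = 1].

(* Trajectories s(t, s0, u) = phi(t, s0, u) / ||phi(t, s0, u)||.  The state space
   is the subtype of unit vectors with the subspace topology. *)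
Definition sphere_sol (R : realType) (n m : nat)
    (A : 'M[R]_n) (B : 'I_m -> 'M[R]_n)
    (u : R -> 'cV[R]_m) (s0 : @unit_sphere R n) (s : R -> @unit_sphere R n) : Prop :=
  exists2 p : R -> 'cV[R]_n, bilinear_sol A B u (\val s0) p &
    forall t, \val (s t) = (enorm (p t))^-1 *: p t.

Definition cone (R : realType) (n : nat) (D : set (@unit_sphere R n)) :
    set 'cV[R]_n :=
  [set x | exists a s, [/\ 0 < a, D s & x = a *: \val s]].

(* Main.v *)
Require Import Defs.
From HB Require Import structures.
From mathcomp Require Import all_boot all_order all_algebra.
From mathcomp Require Import all_classical all_reals all_analysis.
From mathcomp Require Import measurable_realfun ess_sup_inf.
From mathcomp Require Import ring lra.

Set Implicit Arguments.
Unset Strict Implicit.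
Unset Printing Implicit Defensive.
Import Order.TTheory GRing.Theory Num.Theory.
Import numFieldNormedType.Exports.
Local Open Scope classical_set_scope.
Local Open Scope ring_scope.

(** Points reached from [x] are the products [P *m x] with [P] in the semigroup
    [trans] of transition matrices ([sol_trans], [trans_sol]).  When
    [P *m \val s = g *: \val s'], written [gain s g s'], the projected system goes
    from [s] to [s'] while the radius is multiplied by [g].

    Approximate controllability of the cone ([cone_approx]).  From the ray of [s]
    to a prescribed point on the ray of [s'], steer from [s] exactly to [s+], loop
    [k] times there, steer exactly to [s-], loop [l] times there, and finally go
    near [s'] by the approximate controllability of [D].  The legs contribute a
    fixed factor, the loops contribute [alpha+ ^+ k * alpha- ^+ l].  As [alpha+] may
    be chosen in an interval, [k * ln alpha+ + l * ln alpha-] can be made positive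
    and as small as desired ([small_combination]), and then its values for varying
    [k] and [l] are dense up to that precision ([combination_dense]).  The loops
    close up at [s+] and [s-] only, so reaching these points approximately would
    not do: this is where [exact_control] is needed.

    Maximality ([cone_maximal]).  A larger set with the same two properties avoids
    the origin, which reaches nothing else; its directions form a set with the two
    properties on the sphere, hence are in [D].

    Exact control ([exact_control]).  A point of [D] comes as close to [y] as
    desired; to hit the ray of [y] one needs an open set of points near [y] that
    are all steered to it.  Local accessibility does not give this at once: when
    [Omega] is unbounded, short times allow long trips, and the points steered to
    [y] in short time may lie far away.  What is needed is a form of Krener's
    theorem ([krener]), for transition matrices close to the identity instead of
    short times.  The classical proof uses Lie brackets and Frobenius; here is the
    replacement.  The spans of the conjugates [P *m X *m invmx P] of the generators
    [X] by elements [P] of the semigroup that are [c]-close to the identity shrink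
    with [c], hence are eventually constant, and then they are invariant under the
    whole semigroup ([conj_span_invariant]).  Among the parametrized families of
    points steered to [y] by matrices close to the identity, one with the largest
    number of parameters is tangent to this span ([maximal_chart]), for otherwise
    a conjugated generator would supply one more parameter.  If it has full
    dimension, it covers an open set, by the inverse function theorem
    ([c11_open]).  If not, any trajectory starting on it is followed by Euler's
    method inside transported copies of it ([euler]); countably many copies suffice
    for all trajectories, each is nowhere dense, and by Baire's theorem the orbit
    has empty interior ([orbit_thin]), against local accessibility. *)

(** Identities that hold in every abelian group, with the matrix products as atoms. *)
Ltac zmx := repeat match goal with |- context [?A *m ?B] =>
    let x := fresh "x" in set x := (A *m B); clearbody x end;
  apply/matrixP => ? ?; rewrite !mxE; ring.

(** * Norms of matrices *)

Section MatrixNorm.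
Variable R : realType.

(** With the norm, this makes matrices a complete normed module. *)
HB.instance Definition _ (m n : nat) := Complete.on 'M[R]_(m, n).

Lemma mx_norm_le (m n : nat) (A : 'M[R]_(m, n)) (e : R) :
  0 <= e -> (forall i j, `|A i j| <= e) -> `|A| <= e.
Proof.
move=> e0 Ae; rewrite /Num.norm /= mx_normrE.
by apply/bigmax_leP; split => // -[i j] _; exact: Ae.
Qed.

Lemma entry_le_norm (m n : nat) (A : 'M[R]_(m, n)) i j : `|A i j| <= `|A|.
Proof.
rewrite [leRHS]/Num.norm /= mx_normrE.
by apply: (@le_bigmax _ _ _ 0 (fun ij : 'I_m * 'I_n => `|A ij.1 ij.2|) (i, j)).
Qed.

Lemma norm_mulmx (m n p : nat) (A : 'M[R]_(m, n)) (B : 'M[R]_(n, p)) :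
  `|A *m B| <= n%:R * `|A| * `|B|.
Proof.
apply: mx_norm_le => [|i j]; first by rewrite !mulr_ge0.
rewrite mxE (le_trans (ler_norm_sum _ _ _)) //.
have -> : n%:R * `|A| * `|B| = \sum_(k < n) `|A| * `|B| :> R.
  by rewrite sumr_const card_ord -mulrA mulr_natl.
by apply: ler_sum => k _; rewrite normrM ler_pM // entry_le_norm.
Qed.

Lemma norm_mulmx_le (m n p : nat) (A : 'M[R]_(m, n)) (B : 'M[R]_(n, p)) a b :
  `|A| <= a -> `|B| <= b -> `|A *m B| <= n%:R * a * b.
Proof.
move=> Aa Bb; apply: le_trans (norm_mulmx _ _) _.
by rewrite -!mulrA ler_wpM2l // ler_pM.
Qed.

Lemma norm1_mx_le (n : nat) : `|1%:M : 'M[R]_n| <= 1.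
Proof.
by apply: mx_norm_le => // i j; rewrite mxE; case: (_ == _); rewrite ?normr1 ?normr0.
Qed.

(** The entrywise maximum, rescaled so that it is submultiplicative. *)
Definition opn (n : nat) (A : 'M[R]_n) : R := n%:R * `|A|.

Lemma opn_ge0 n (A : 'M[R]_n) : 0 <= opn A.
Proof. by rewrite /opn mulr_ge0. Qed.

Lemma opnD n (A B : 'M[R]_n) : opn (A + B) <= opn A + opn B.
Proof. by rewrite /opn -mulrDr ler_wpM2l // ler_normD. Qed.

Lemma opnM n (A B : 'M[R]_n) : opn (A *m B) <= opn A * opn B.
Proof.
rewrite /opn; apply: le_trans (ler_wpM2l _ (norm_mulmx A B)) _ => //.
by rewrite le_eqVlt; apply/orP; left; apply/eqP; ring.
Qed.

Lemma opn_mulv n p (A : 'M[R]_n) (v : 'M[R]_(n, p)) : `|A *m v| <= opn A * `|v|.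
Proof. exact: norm_mulmx. Qed.

End MatrixNorm.

(** * Charts of class C11 *)

Section Charts.
Variable R : realType.

(** [J] is the derivative of [F], and is Lipschitz.  The Taylor estimate between
    any two points of the ball replaces the mean value inequality. *)
Definition c11 (k n : nat) (rho C : R) (F : 'cV[R]_k -> 'cV[R]_n)
    (J : 'cV[R]_k -> 'M[R]_(n, k)) : Prop :=
  forall a b : 'cV[R]_k, `|a| <= rho -> `|b| <= rho ->
    `|F b - F a - J a *m (b - a)| <= C * `|b - a| ^+ 2 /\
    `|J b - J a| <= C * `|b - a|.

(** On a smaller ball [P *m J a] stays within 1/2 of the identity, so that the
    composite of [F] with [P] is a perturbation of the identity. *)
Lemma c11_regular (k n : nat) (rho C : R) F J (P : 'M[R]_(k, n)) :
  0 < rho -> @c11 k n rho C F J -> P *m J 0 = 1%:M ->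
  exists r, [/\ 0 < r, r <= rho,
    (forall a b : 'cV[R]_k, `|a| <= r -> `|b| <= r ->
       `|(b - a) - P *m (F b - F a)| <= 2^-1 * `|b - a|) &
    (forall a v : 'cV[R]_k, `|a| <= r -> `|v - P *m (J a *m v)| <= 2^-1 * `|v|)].
Proof.
move=> rho0 FJ PJ.
have C0 : 0 <= `|C| by [].
pose D := 2 * (1 + k%:R) * n%:R * `|P| * `|C|.
have D0 : 0 <= D by rewrite /D !mulr_ge0.
pose r := Num.min rho (4 * (D + 1))^-1.
have r0 : 0 < r by rewrite lt_min rho0 invr_gt0; lra.
have rrho : r <= rho by rewrite ge_min lexx.
have rD : r * D <= 4^-1.
  have : r * (4 * (D + 1)) <= 1.
    have D4 : 0 < 4 * (D + 1) by lra.
    by rewrite -ler_pdivlMr // div1r ge_min lexx orbT.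
  by have := mulr_ge0 (ltW r0) D0; nra.
have le0 : `|0 : 'cV[R]_k| <= rho by rewrite normr0 ltW.
have key (a v : 'cV[R]_k) : `|a| <= r -> `|v - P *m (J a *m v)| <= 4^-1 * `|v|.
  move=> ar; have arho := le_trans ar rrho.
  have -> : v - P *m (J a *m v) = - (P *m (J a - J 0) *m v).
    by rewrite mulmxBr PJ mulmxBl mul1mx opprB mulmxA.
  rewrite normrN; apply: le_trans (norm_mulmx _ _) _; rewrite ler_wpM2r //.
  have [_ /=] := FJ 0 a le0 arho; rewrite subr0 => h.
  have h2 : `|J a - J 0| <= `|C| * r.
    by apply: le_trans h _; apply: le_trans (ler_norm _) _; rewrite normrM normr_id ler_wpM2l.
  apply: le_trans rD.
  apply: (@le_trans _ _ (k%:R * (n%:R * `|P| * (`|C| * r)))).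
    by rewrite ler_wpM2l // norm_mulmx_le.
  have h3 : 0 <= n%:R * `|P| * `|C| by rewrite !mulr_ge0.
  have h4 : 0 <= k%:R * (n%:R * `|P| * `|C| * r) by rewrite !mulr_ge0 // ltW.
  by rewrite /D; have := mulr_ge0 h3 (ltW r0); nra.
exists r; split => // [a b ar br|a v ar]; last first.
  by apply: le_trans (key a v ar) _; rewrite ler_wpM2r //; lra.
have arho := le_trans ar rrho; have brho := le_trans br rrho.
have -> : (b - a) - P *m (F b - F a) = ((b - a) - P *m (J a *m (b - a)))
    - P *m (F b - F a - J a *m (b - a)).
  by rewrite [in X in _ = _ - X]mulmxBr opprB addrA subrK.
apply: le_trans (ler_normB _ _) _.
have -> : 2^-1 * `|b - a| = 4^-1 * `|b - a| + 4^-1 * `|b - a| :> R by lra.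
apply: lerD; first exact: key.
have [h _] := FJ a b arho brho.
have h' : `|F b - F a - J a *m (b - a)| <= `|C| * (2 * r) * `|b - a|.
  apply: le_trans h _; apply: le_trans (ler_norm _) _.
  rewrite normrM normrX normr_id expr2 mulrA ler_wpM2r // ler_wpM2l //.
  by apply: le_trans (ler_normB _ _) _; lra.
apply: le_trans (norm_mulmx_le (lexx _) h') _.
rewrite mulrA ler_wpM2r //; apply: le_trans rD.
have h3 : 0 <= n%:R * `|P| * `|C| by rewrite !mulr_ge0.
have h4 : 0 <= k%:R * (n%:R * `|P| * `|C| * r) by rewrite !mulr_ge0 // ltW.
by rewrite /D; have := mulr_ge0 h3 (ltW r0); nra.
Qed.

Lemma half_lower (k : nat) (v w : 'cV[R]_k) :
  `|v - w| <= 2^-1 * `|v| -> `|v| <= 2 * `|w|.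
Proof.
move=> h; have := ler_normD (v - w) w; rewrite subrK; lra.
Qed.

(** Newton's iteration with a frozen derivative is a contraction. *)
Lemma c11_open (n : nat) (rho C : R) F J (P : 'M[R]_n) :
  0 < rho -> @c11 n n rho C F J -> P *m J 0 = 1%:M ->
  exists2 Q : set 'cV[R]_n, open Q /\ Q !=set0 &
    forall w, Q w -> exists2 a, `|a| <= rho & F a = w.
Proof.
move=> rho0 FJ PJ.
have [r [r0 rrho Fr _]] := c11_regular rho0 FJ PJ.
have [e e0 eP] : exists2 e : R, 0 < e & n%:R * `|P| * e <= 2^-1 * r.
  have h : 0 <= n%:R * `|P| by rewrite mulr_ge0.
  have h1 : 0 < n%:R * `|P| + 1 by lra.
  exists (2^-1 * r / (n%:R * `|P| + 1)); first by rewrite divr_gt0 // mulr_gt0 // invr_gt0.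
  rewrite mulrA ler_pdivrMr //; nra.
exists (ball (F 0) e); first by split; [exact: ball_open|exists (F 0); exact: ballxx].
move=> w; rewrite -ball_normE /= => Fw.
pose T (a : 'cV[R]_n) := a - P *m (F a - w).
pose U := [set a : 'cV[R]_n | `|a| <= r].
have TU a : U a -> U (T a).
  rewrite /U /= => ar; have h0 : `|0 : 'cV[R]_n| <= r by rewrite normr0 ltW.
  have := Fr 0 a h0 ar; rewrite subr0 => h.
  have -> : T a = (a - P *m (F a - F 0)) - P *m (F 0 - w).
    by rewrite /T -addrA -opprD -mulmxDr addrA subrK.
  apply: le_trans (ler_normB _ _) _.
  have h2 : `|P *m (F 0 - w)| <= 2^-1 * r.
    by apply: le_trans (norm_mulmx_le (lexx _) (ltW Fw)) _.
  by apply: le_trans (lerD h h2) _; nra.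
have mT : set_fun U U T by move=> a; exact: TU.
pose TF : {fun U >-> U} := HB.pack_for {fun U >-> U} T (isFun.Build _ _ U U T mT).
have ctr : is_contraction TF.
  exists (2^-1)%:nng; split => /=; first by rewrite invf_lt1 ?ltr1n.
  move=> [a b] [/= ar br].
  have -> : T a - T b = (a - b) - P *m (F a - F b).
    by rewrite /T !mulmxBr; zmx.
  exact: Fr.
have clU : closed U.
  rewrite (_ : U = closed_ball (0 : 'cV[R]_n) r).
    exact: closed_ball_closed.
  by rewrite closed_ballE //; apply/seteqP; split => x; rewrite /U /closed_ball_ /= sub0r normrN.
have U0 : U 0 by rewrite /U /= normr0 ltW.
have [p Up pT] := banach_fixed_point ctr clU (ex_intro _ 0 U0).
exists p; first exact: le_trans Up rrho.
have P0 : P *m (F p - w) = 0 by apply/eqP; rewrite -(inj_eq (addrI (p - P *m (F p - w)))) addr0 subrK -[X in X == _]/p [X in X == _]pT.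
apply/eqP; rewrite -subr_eq0 -[F p - w]mul1mx -(mulmx1C PJ) -mulmxA P0 mulmx0.
exact: eqxx.
Qed.

(** Along [E] the coordinate [Q] determines the point, and this survives
    closure; but [Q] has a kernel. *)
Lemma graph_nowhere_dense (k n : nat) (Q : 'M[R]_(k, n)) (L : R)
    (E : set 'cV[R]_n) : (k < n)%N ->
  (forall x y, E x -> E y -> `|x - y| <= L * `|Q *m (x - y)|) ->
  (closure E)° = set0.
Proof.
move=> kn EQ; rewrite -subset0 => x0 /= /nbhs_ballP[e /= e0 xE].
have [d d0 Qd] : exists2 d : 'cV[R]_n, d != 0 & Q *m d = 0.
  have : kermx Q^T != 0.
    by rewrite -mxrank_eq0 mxrank_ker mxrank_tr -lt0n subn_gt0 (leq_ltn_trans (rank_leq_row _)).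
  case/rowV0Pn => v /sub_kermxP vQ v0; exists v^T; first by rewrite -trmx0 (inj_eq trmx_inj).
  by apply: trmx_inj; rewrite trmx_mul trmxK vQ trmx0.
have dn : 0 < `|d| by rewrite normr_gt0.
pose c := e / 2 / `|d|; have c0 : 0 < c by rewrite !divr_gt0.
pose x1 := x0 + c *: d.
have x10 : `|x1 - x0| = e / 2.
  by rewrite /x1 addrC addKr normrZ gtr0_norm // /c divfK // gt_eqF.
have Ex0 : closure E x0 by apply: xE; exact: ballxx.
have Ex1 : closure E x1.
  by apply: xE; rewrite -ball_normE /= distrC x10 ltr_pdivrMr // mulr_natr mulr2n ltrDr.
pose K := n%:R * `|Q|; have K0 : 0 <= K by rewrite mulr_ge0.
have L0 : 0 <= `|L| by [].
pose M := 2 + 2 * (`|L| * K); have M0 : 0 < M by rewrite /M; have := mulr_ge0 L0 K0; lra.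
pose h := e / 4 / M; have h0 : 0 < h by rewrite !divr_gt0.
have [y0 [Ey0 By0]] := Ex0 _ (nbhsx_ballx x0 h h0).
have [y1 [Ey1 By1]] := Ex1 _ (nbhsx_ballx x1 h h0).
move: By0 By1; rewrite -!ball_normE /= => By0 By1.
have := EQ y1 y0 Ey1 Ey0.
have -> : Q *m (y1 - y0) = Q *m ((x0 - y0) - (x1 - y1)).
  have -> : y1 - y0 = ((x0 - y0) - (x1 - y1)) + c *: d.
    by rewrite /x1; zmx.
  by rewrite mulmxDr -scalemxAr Qd scaler0 addr0.
move=> h1.
have h2 : `|(x0 - y0) - (x1 - y1)| <= 2 * h.
  by apply: le_trans (ler_normB _ _) _; lra.
have h3 : `|x1 - x0| <= `|y1 - y0| + 2 * h.
  have -> : x1 - x0 = (y1 - y0) - ((x0 - y0) - (x1 - y1)) by zmx.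
  by apply: le_trans (ler_normB _ _) _; rewrite lerD2l.
have h4 : `|y1 - y0| <= `|L| * (K * (2 * h)).
  apply: le_trans h1 _; apply: le_trans (ler_norm _) _; rewrite normrM normr_id ler_wpM2l //.
  by rewrite /K; apply: norm_mulmx_le.
have h5 : h * M = e / 4 by rewrite /h divfK // gt_eqF.
by rewrite x10 in h3; rewrite /M in h5; nra.
Qed.
End Charts.

(** * Spans of sets *)

Section SetSpan.
Variables (K : fieldType) (V : vectType K).

(** The span of an arbitrary set of vectors, as the least subspace that
    contains it. *)
Lemma set_span_ex (A : set V) : exists W : {vspace V},
  (forall v, A v -> v \in W) /\
  (forall U : {vspace V}, (forall v, A v -> v \in U) -> (W <= U)%VS).
Proof.
pose p d := `[< exists2 W : {vspace V}, (forall v, A v -> v \in W) & \dim W = d >].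
have ex : exists d, p d.
  by exists (\dim {:V}); apply/asboolP; exists fullv => // v _; rewrite memvf.
case: (ex_minnP ex) => d /asboolP[W AW dW] mind; exists W; split=> // U AU.
have : p (\dim (W :&: U)).
  by apply/asboolP; exists (W :&: U)%VS => // v Av; rewrite memv_cap AW //= AU.
move/mind; rewrite -dW => le.
have /eqP <- : (W :&: U)%VS == W by rewrite eqEdim capvSl.
exact: capvSr.
Qed.

Definition set_span (A : set V) : {vspace V} := projT1 (cid (set_span_ex A)).

Lemma mem_set_span (A : set V) v : A v -> v \in set_span A.
Proof. by rewrite /set_span; case: cid => W /= [AW _]; exact: AW. Qed.

Lemma set_span_min (A : set V) (U : {vspace V}) :
  (forall v, A v -> v \in U) -> (set_span A <= U)%VS.
Proof. by rewrite /set_span; case: cid => W /= [_]; apply. Qed.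

End SetSpan.

(** * Semigroups of matrices and conjugated generators *)

Section Semigroups.
Variables (R : realType) (n : nat).
Implicit Types (S : set 'M[R]_n) (g : R -> 'M[R]_n).

Definition small S (c : R) : set 'M[R]_n :=
  [set Psi | S Psi /\ opn (Psi - 1%:M) <= c - 1].

(** An absolutely continuous path in a matrix semigroup, with velocities in the
    right-invariant field of subspaces [aa *m g], seen through its increments:
    this is all that the argument retains of the differential equation. *)
Definition semigroup_path S (aa : {vspace 'M[R]_n}) g (C : R) : Prop :=
  g 0 = 1%:M /\
  forall s t, 0 <= s -> s <= t -> t <= 1 ->
    [/\ S (g t *m invmx (g s)), g s \in unitmx, `|invmx (g s)| <= C &
      exists2 X, X \in aa &
        `|X| <= C * (t - s) /\ `|g t - g s - X *m g s| <= C * (t - s) ^+ 2].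

(** The one-parameter case of [c11], with values in matrices. *)
Definition curve11 (r C : R) (q dq : R -> 'M[R]_n) : Prop :=
  forall s t, `|s| <= r -> `|t| <= r ->
    `|q t - q s - (t - s) *: dq s| <= C * (t - s) ^+ 2 /\
    `|dq t - dq s| <= C * `|t - s|.

Definition conj_by (P X : 'M[R]_n) : 'M[R]_n := P *m X *m invmx P.

Definition conj_lin (P : 'M[R]_n) : 'End('M[R]_n) :=
  linfun (mulmxr (invmx P) \o mulmx P).

Lemma conj_linE P X : conj_lin P X = conj_by P X.
Proof. by rewrite lfunE. Qed.

Lemma conj_byM (P Q X : 'M[R]_n) : P \in unitmx -> Q \in unitmx ->
  conj_by (P *m Q) X = conj_by P (conj_by Q X).
Proof.
move=> uP uQ; rewrite /conj_by.
suff -> : invmx (P *m Q) = invmx Q *m invmx P by rewrite !mulmxA.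
have uPQ : P *m Q \in unitmx by rewrite unitmx_mul uP.
apply: (can_inj (mulKmx uPQ)).
by rewrite mulmxV // mulmxA -(mulmxA P) mulmxV // mulmx1 mulmxV.
Qed.

Lemma conj_byK (P X : 'M[R]_n) : P \in unitmx -> invmx P *m conj_by P X *m P = X.
Proof. by move=> uP; rewrite /conj_by !mulmxA mulVmx // mul1mx -mulmxA mulVmx // mulmx1. Qed.

Lemma smallM S c c' P Q : (forall A B, S A -> S B -> S (A *m B)) ->
  small S c P -> small S c' Q -> small S (c * c') (P *m Q).
Proof.
move=> SM [SP Pc] [SQ Qc]; split; first exact: SM.
have -> : P *m Q - 1%:M = (P - 1%:M) *m (Q - 1%:M) + ((P - 1%:M) + (Q - 1%:M)).
  by rewrite mulmxBl !mulmxBr mulmx1 !mul1mx; zmx.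
apply: le_trans (opnD _ _) _; apply: le_trans (lerD (opnM _ _) (opnD _ _)) _.
have := opn_ge0 (P - 1%:M); have := opn_ge0 (Q - 1%:M); nra.
Qed.

Lemma small_le S c c' : c <= c' -> small S c `<=` small S c'.
Proof. by move=> cc' P [SP Pc]; split => //; apply: le_trans Pc _; rewrite lerB. Qed.

Lemma unitmx_inj (A : 'M[R]_n) : (forall v : 'cV[R]_n, A *m v = 0 -> v = 0) ->
  A \in unitmx.
Proof.
move=> inj; rewrite -unitmx_tr -row_free_unit -kermx_eq0; apply/eqP/row_matrixP => i.
rewrite row0; apply: trmx_inj; rewrite trmx0; apply: inj.
by apply: trmx_inj; rewrite trmx_mul trmxK -row_mul mulmx_ker row0 trmx0.
Qed.

Lemma exp_below (c : R) (N : nat) : 1 < c -> exists2 d, 1 < d & d ^+ N <= c.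
Proof.
move=> c1; case: N => [|N]; first by exists 2; rewrite ?expr0 ?ltr1n // ltW.
have c0 : 0 < c by lra.
pose d := expR (ln c / N.+1%:R).
have lc : 0 < ln c by rewrite ln_gt0.
exists d; first by rewrite expR_gt1 divr_gt0.
by rewrite -expRM_natl -mulr_natl mulrC divfK ?lnK // pnatr_eq0.
Qed.

End Semigroups.

Lemma unitmx_near1 (R : realType) k (M : 'M[R]_k) : opn (M - 1%:M) < 1 -> M \in unitmx.
Proof.
move=> M1; apply: unitmx_inj => v Mv.
have : `|v| <= opn (M - 1%:M) * `|v|.
  rewrite -[X in X <= _]normrN; apply: le_trans (opn_mulv _ _).
  by rewrite mulmxBl Mv mul1mx sub0r.
have v0 : 0 <= `|v| by [].
by move=> h; apply/eqP; rewrite -normr_le0; nra.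
Qed.

Section ConjugationInvariance.
Variables (R : realType) (n : nat) (S MM : set 'M[R]_n) (aa : {vspace 'M[R]_n}).
Hypothesis SM : forall P Q, S P -> S Q -> S (P *m Q).
Hypothesis SU : forall P, S P -> P \in unitmx.
Hypothesis Spath : forall P, S P ->
  exists g C, semigroup_path S aa g C /\ g 1 = P.

Definition conj_span (c : R) : {vspace 'M[R]_n} :=
  set_span [set Y | exists P X, [/\ small S c P, MM X & Y = conj_by P X]].

Lemma conj_span_le c c' : c <= c' -> (conj_span c <= conj_span c')%VS.
Proof.
move=> cc'; apply: set_span_min => _ [P [X [Pc MX ->]]].
apply: mem_set_span; exists P, X; split => //; exact: small_le Pc.
Qed.

(** The dimensions decrease with [c], hence are eventually constant. *)
Lemma conj_span_stable c : 1 < c ->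
  exists2 c0, 1 < c0 <= c & forall c', 1 < c' <= c0 -> conj_span c' = conj_span c0.
Proof.
move=> c1.
pose p d := `[< exists2 c0, 1 < c0 <= c & \dim (conj_span c0) = d >].
have ex : exists d, p d by exists (\dim (conj_span c)); apply/asboolP; exists c => //; rewrite c1 lexx.
case: (ex_minnP ex) => d /asboolP[c0 /andP[c01 c0c] dd] mind.
exists c0; first by rewrite c01.
move=> c' /andP[c'1 c'c0]; apply/eqP; rewrite eqEdim conj_span_le //= dd.
by apply: mind; apply/asboolP; exists c' => //; rewrite c'1 (le_trans c'c0).
Qed.

(** A path is a product of increments as close to the identity as desired. *)
Lemma path_small g C c : semigroup_path S aa g C -> 1 < c ->
  exists2 N : nat, (0 < N)%N & forall i, (i < N)%N ->
    small S c (g (i.+1%:R / N%:R) *m invmx (g (i%:R / N%:R))).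
Proof.
move=> [g0 gP] c1.
have C0 : 0 <= C.
  by have [_ _ + _] := gP 0 0 (lexx _) (lexx _) ler01; exact: le_trans.
pose K := n%:R * (C + n%:R * C * C); have K0 : 0 <= K.
  by rewrite /K mulr_ge0 // addr_ge0 // !mulr_ge0.
have c10 : 0 < c - 1 by lra.
have Kc : 0 <= K / (c - 1) by rewrite divr_ge0 // ltW.
pose N := (Num.truncn (K / (c - 1))).+1.
have N0 : 0 < N%:R :> R by rewrite ltr0n.
have KN : K / N%:R <= c - 1.
  rewrite ler_pdivrMr // mulrC -ler_pdivrMr //.
  by apply/ltW; rewrite /N truncnS_gt.
exists N => // i iN.
have s0 : 0 <= i%:R / N%:R :> R by rewrite divr_ge0.
have st : i%:R / N%:R <= i.+1%:R / N%:R :> R by rewrite ler_pM2r ?invr_gt0 // ler_nat.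
have t1 : i.+1%:R / N%:R <= 1 :> R by rewrite ler_pdivrMr // mul1r ler_nat.
have [Sts us Cs [X _ [XC gX]]] := gP _ _ s0 st t1.
split => //.
have dts : i.+1%:R / N%:R - i%:R / N%:R = N%:R^-1 :> R.
  by rewrite -mulrBl -natrB // subSnn mul1r.
rewrite dts in XC gX.
set s := i%:R / N%:R in us Cs gX *; set t := i.+1%:R / N%:R in gX *.
have -> : g t *m invmx (g s) - 1%:M = X + (g t - g s - X *m g s) *m invmx (g s).
  by rewrite !mulmxBl -(mulmxA X) mulmxV // mulmx1; zmx.
apply: le_trans (opnD _ _) _; rewrite /opn -mulrDr; apply: le_trans KN.
rewrite /K -mulrA ler_wpM2l //.
have N1 : N%:R^-1 <= 1 :> R by rewrite invf_le1 // ler1n.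
have Ni : 0 <= N%:R^-1 :> R by rewrite invr_ge0 ltW.
rewrite mulrDl lerD //.
apply: le_trans (norm_mulmx_le gX Cs) _.
have h : 0 <= n%:R * C * C by rewrite !mulr_ge0.
have : n%:R * (C * N%:R^-1 ^+ 2) * C = (n%:R * C * C) * N%:R^-1 * N%:R^-1 by ring.
move=> ->; have := mulr_ge0 h Ni; nra.
Qed.

(** Near the identity the conjugates of [conj_span] by small elements lie in a
    [conj_span] with a slightly larger bound, which is the same space; every
    element of [S] is a product of small ones, so the space is invariant under
    all of [S], although its definition only saw small elements. *)
Lemma conj_span_invariant c : 1 < c -> exists2 c0, 1 < c0 <= c &
  (forall c', 1 < c' <= c0 -> conj_span c' = conj_span c0) /\
  (forall P Y, S P -> Y \in conj_span c0 -> invmx P *m Y *m P \in conj_span c0).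
Proof.
move=> c1; have [c0 c0c stab] := conj_span_stable c1.
exists c0 => //; split => //; have /andP[c01 _] := c0c.
have [d d1] := exp_below 2 c01; rewrite expr2 => dd.
have dc0 : 1 < d <= c0 by rewrite d1 /=; nra.
have step P Y : small S d P -> Y \in conj_span c0 -> conj_lin P Y \in conj_span c0.
  move=> Pd; rewrite -(stab d dc0) => YG.
  suff : (conj_span d <= conj_lin P @^-1: conj_span c0)%VS.
    by move/subvP/(_ Y YG); rewrite -memv_preim stab.
  apply: set_span_min => _ [Q [X [Qd MX ->]]].
  rewrite -memv_preim conj_linE.
  have [SP _] := Pd; have [SQ _] := Qd.
  apply: (subvP (conj_span_le dd)); apply: mem_set_span.
  by exists (P *m Q), X; split => //; [exact: smallM|rewrite conj_byM ?SU].
have inv P Y : S P -> Y \in conj_span c0 -> conj_lin P Y \in conj_span c0.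
  move=> SP YG; have [g [C [gC <-]]] := Spath SP.
  have [N N0 gN] := path_small gC d1.
  have Nn0 : N%:R != 0 :> R by rewrite pnatr_eq0 -lt0n.
  rewrite -(divff Nn0).
  have [g0 gP] := gC.
  have ug i : (i <= N)%N -> g (i%:R / N%:R) \in unitmx.
    move=> iN; have s0 : 0 <= i%:R / N%:R :> R by rewrite divr_ge0.
    have s1 : i%:R / N%:R <= 1 :> R by rewrite ler_pdivrMr ?ltr0n // mul1r ler_nat.
    by have [] := gP _ _ s0 s1 (lexx _).
  suff H i : (i <= N)%N -> conj_lin (g (i%:R / N%:R)) Y \in conj_span c0 by exact: H.
  elim: i => [_|i IH iN].
    by rewrite mul0r g0 conj_linE /conj_by mul1mx invmx1 mulmx1.
  have := step _ _ (gN i iN) (IH (ltnW iN)).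
  rewrite !conj_linE -conj_byM ?ug //; last 2 first.
  - by rewrite unitmx_mul unitmx_inv !ug // ltnW.
  - exact: ltnW.
  by rewrite -mulmxA mulVmx ?mulmx1 // ug // ltnW.
move=> P Y SP YG; have uP := SU SP.
have inj : lker (conj_lin P) == 0%VS.
  apply/lker0P => A B; rewrite !conj_linE => AB.
  by rewrite -(conj_byK A uP) AB conj_byK.
have : (conj_lin P @: conj_span c0 == conj_span c0)%VS.
  rewrite eqEdim (limg_dim_eq (eqP _)) ?leqnn ?andbT; last first.
    by rewrite (eqP inj) capv0.
  by apply/subvP => _ /memv_imgP[Z ZG ->]; exact: inv.
move=> /eqP E; move: YG; rewrite -{1}E => /memv_imgP[Z ZG ->].
by rewrite conj_linE conj_byK.
Qed.

End ConjugationInvariance.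

(** * Operations on charts *)

Section ChartGrowth.
Variable R : realType.

Lemma c11_bounded (k n : nat) (rho C : R) F J : 0 <= rho ->
  @c11 R k n rho C F J -> exists2 K, 0 <= K &
  (forall a : 'cV[R]_k, `|a| <= rho -> `|F a| <= K /\ `|J a| <= K) /\
  (forall a b : 'cV[R]_k, `|a| <= rho -> `|b| <= rho -> `|F b - F a| <= K * `|b - a|).
Proof.
move=> rho0 FJ.
have z0 : `|0 : 'cV[R]_k| <= rho by rewrite normr0.
have C0 : 0 <= `|C| by [].
pose K1 := `|J 0| + `|C| * rho; pose K2 := k%:R * K1 + `|C| * (2 * rho).
have K10 : 0 <= K1 by rewrite addr_ge0 // mulr_ge0.
have K20 : 0 <= K2 by rewrite addr_ge0 // !mulr_ge0.
have J1 a : `|a| <= rho -> `|J a| <= K1.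
  move=> ar; have [_] := FJ 0 a z0 ar; rewrite subr0 => h.
  rewrite -(subrK (J 0) (J a)) addrC; apply: le_trans (ler_normD _ _) _.
  rewrite lerD2l; apply: le_trans h _; apply: le_trans (ler_norm _) _.
  by rewrite normrM normr_id ler_wpM2l.
have F2 a b : `|a| <= rho -> `|b| <= rho -> `|F b - F a| <= K2 * `|b - a|.
  move=> ar br; have [h _] := FJ a b ar br.
  rewrite -(subrK (J a *m (b - a)) (F b - F a)) addrC mulrDl.
  apply: le_trans (ler_normD _ _) _; apply: lerD.
    exact: norm_mulmx_le (J1 a ar) (lexx _).
  apply: le_trans h _; apply: le_trans (ler_norm _) _.
  rewrite normrM normrX normr_id expr2 mulrA ler_wpM2r // ler_wpM2l //.
  by apply: le_trans (ler_normB _ _) _; lra.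
have K2r : 0 <= K2 * rho by rewrite mulr_ge0.
clearbody K2; clearbody K1.
exists (K1 + K2 + `|F 0| + K2 * rho); first by rewrite !addr_ge0.
split => [a ar|a b ar br]; last first.
  apply: le_trans (F2 a b ar br) _; rewrite ler_wpM2r //.
  have : 0 <= `|F 0| by []; lra.
have f0 : 0 <= `|F 0| by [].
split; last by apply: le_trans (J1 a ar) _; lra.
have := F2 0 a z0 ar; rewrite subr0 => h.
have h2 := ler_normD (F a - F 0) (F 0); rewrite subrK in h2.
have : K2 * `|a| <= K2 * rho by rewrite ler_wpM2l.
lra.
Qed.

Lemma c11_affine (k m n : nat) (rho rho' C : R) F J a1 (W : 'M[R]_(m, n)) :
  `|a1| + rho' <= rho -> @c11 R k n rho C F J ->
  @c11 R k m rho' (n%:R * `|W| * C)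
    (fun a => W *m F (a1 + a)) (fun a => W *m J (a1 + a)).
Proof.
move=> a1r FJ a b ar br.
have h c : `|c| <= rho' -> `|a1 + c| <= rho.
  by move=> cr; apply: le_trans (ler_normD _ _) _; apply: le_trans a1r; rewrite lerD2l.
have [h1 h2] := FJ _ _ (h a ar) (h b br).
have E : a1 + b - (a1 + a) = b - a by zmx.
rewrite E in h1 h2; split.
  have -> : W *m F (a1 + b) - W *m F (a1 + a) - W *m J (a1 + a) *m (b - a)
      = W *m (F (a1 + b) - F (a1 + a) - J (a1 + a) *m (b - a)).
    by move: (b - a) => d; rewrite !mulmxBr mulmxA.
  by apply: le_trans (norm_mulmx_le (lexx _) h1) _; rewrite !mulrA.
by rewrite -!mulmxBr -[_ * _ * C * _]mulrA; exact: norm_mulmx_le.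
Qed.

Section Curves.
Variable n : nat.

Lemma curve11_bounded (r C : R) (q dq : R -> 'M[R]_n) : 0 <= r ->
  curve11 r C q dq -> exists2 K, 0 <= K &
  (forall s, `|s| <= r -> `|q s| <= K /\ `|dq s| <= K) /\
  (forall s t, `|s| <= r -> `|t| <= r -> `|q t - q s| <= K * `|t - s|).
Proof.
move=> r0 qd.
have z0 : `|0 : R| <= r by rewrite normr0.
have C0 : 0 <= `|C| by [].
pose K1 := `|dq 0| + `|C| * r; pose K2 := K1 + `|C| * (2 * r).
have K10 : 0 <= K1 by rewrite addr_ge0 // mulr_ge0.
have K20 : 0 <= K2 by rewrite addr_ge0 // !mulr_ge0.
have J1 a : `|a| <= r -> `|dq a| <= K1.
  move=> ar; have [_] := qd 0 a z0 ar; rewrite subr0 => h.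
  rewrite -(subrK (dq 0) (dq a)) addrC; apply: le_trans (ler_normD _ _) _.
  rewrite lerD2l; apply: le_trans h _; apply: le_trans (ler_norm _) _.
  by rewrite normrM normr_id ler_wpM2l.
have F2 a b : `|a| <= r -> `|b| <= r -> `|q b - q a| <= K2 * `|b - a|.
  move=> ar br; have [h _] := qd a b ar br.
  rewrite -(subrK ((b - a) *: dq a) (q b - q a)) addrC mulrDl.
  apply: le_trans (ler_normD _ _) _; apply: lerD.
    by rewrite normrZ mulrC ler_wpM2r // J1.
  apply: le_trans h _; apply: le_trans (ler_norm _) _.
  rewrite normrM normrX expr2 mulrA ler_wpM2r // ler_wpM2l //.
  by apply: le_trans (ler_normB _ _) _; lra.
have K2r : 0 <= K2 * r by rewrite mulr_ge0.
clearbody K2; clearbody K1.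
exists (K1 + K2 + `|q 0| + K2 * r); first by rewrite !addr_ge0.
split => [a ar|a b ar br]; last first.
  apply: le_trans (F2 a b ar br) _; rewrite ler_wpM2r //.
  have : 0 <= `|q 0| by []; lra.
have f0 : 0 <= `|q 0| by [].
split; last by apply: le_trans (J1 a ar) _; lra.
have := F2 0 a z0 ar; rewrite subr0 => h.
have h2 := ler_normD (q a - q 0) (q 0); rewrite subrK in h2.
have : K2 * `|a| <= K2 * r by rewrite ler_wpM2l.
lra.
Qed.

Lemma curve11_shift (r r' C : R) (q dq : R -> 'M[R]_n) s0 :
  `|s0| + r' <= r -> curve11 r C q dq ->
  curve11 r' C (fun s => q (s0 + s)) (fun s => dq (s0 + s)).
Proof.
move=> s0r qd a b ar br.
have h c : `|c| <= r' -> `|s0 + c| <= r.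
  by move=> cr; apply: le_trans (ler_normD _ _) _; apply: le_trans s0r; rewrite lerD2l.
have := qd _ _ (h a ar) (h b br).
by have -> : s0 + b - (s0 + a) = b - a by ring.
Qed.

Definition extend_chart (k : nat) (q : R -> 'M[R]_n) (F : 'cV[R]_k -> 'cV[R]_n)
  (b : 'cV[R]_(1 + k)) : 'cV[R]_n := q (usubmx b 0 0) *m F (dsubmx b).

Definition extend_deriv (k : nat) (q dq : R -> 'M[R]_n) (F : 'cV[R]_k -> 'cV[R]_n)
  (J : 'cV[R]_k -> 'M[R]_(n, k)) (b : 'cV[R]_(1 + k)) : 'M[R]_(n, 1 + k) :=
  row_mx (dq (usubmx b 0 0) *m F (dsubmx b)) (q (usubmx b 0 0) *m J (dsubmx b)).

Lemma norm_usubmx (k : nat) (b : 'cV[R]_(1 + k)) : `|usubmx b 0 0| <= `|b|.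
Proof. by rewrite mxE entry_le_norm. Qed.

Lemma norm_dsubmx (k : nat) (b : 'cV[R]_(1 + k)) : `|dsubmx b| <= `|b|.
Proof. by apply: mx_norm_le => // i j; rewrite mxE entry_le_norm. Qed.

Lemma norm_row_mx (m p : nat) (A : 'M[R]_(n, m)) (B : 'M[R]_(n, p)) e :
  `|A| <= e -> `|B| <= e -> `|row_mx A B| <= e.
Proof.
move=> Ae Be; apply: mx_norm_le => [|i j]; first exact: le_trans Ae.
rewrite mxE; case: (fintype.split j) => l; [apply: le_trans Ae|apply: le_trans Be]; exact: entry_le_norm.
Qed.

Lemma c11_extend (k : nat) (C : R) F J r D q dq : 0 <= r ->
  @c11 R k n r C F J -> curve11 r D q dq ->
  exists C', @c11 R (1 + k) n r C' (extend_chart q F) (extend_deriv q dq F J).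
Proof.
move=> r0 FJ qd.
have [K K0 [FK FL]] := c11_bounded r0 FJ.
have [L L0 [qL qLip]] := curve11_bounded r0 qd.
pose N : R := n%:R; have N0 : 0 <= N by [].
have C0 : 0 <= `|C| by []. have D0 : 0 <= `|D| by [].
pose C1 := N * L * `|C| + N * `|D| * K + N * L * K.
pose C2 := N * `|D| * K + N * L * K + (N * L * K + N * L * `|C|).
have C20 : 0 <= C2 by rewrite !addr_ge0 // !mulr_ge0.
have C10 : 0 <= C1 by rewrite !addr_ge0 // !mulr_ge0.
exists (C1 + C2) => b c br cr.
set d := `|c - b|.
have d0 : 0 <= d by rewrite /d.
rewrite /extend_chart /extend_deriv.
have hs : `|usubmx c 0 0 - usubmx b 0 0| <= d.
  have -> : usubmx c 0 0 - usubmx b 0 0 = usubmx (c - b) 0 0 by rewrite linearB /= !mxE.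
  exact: norm_usubmx.
have ha : `|dsubmx c - dsubmx b| <= d by rewrite -linearB; exact: norm_dsubmx.
have sb := le_trans (norm_usubmx b) br; have sc := le_trans (norm_usubmx c) cr.
have ab := le_trans (norm_dsubmx b) br; have ac := le_trans (norm_dsubmx c) cr.
have Jd : row_mx (dq (usubmx b 0 0) *m F (dsubmx b)) (q (usubmx b 0 0) *m J (dsubmx b))
   *m (c - b) = (usubmx c 0 0 - usubmx b 0 0) *: (dq (usubmx b 0 0) *m F (dsubmx b))
     + q (usubmx b 0 0) *m (J (dsubmx b) *m (dsubmx c - dsubmx b)).
  rewrite -{1}[c - b]vsubmxK mul_row_col.
  have -> : usubmx (c - b) = (usubmx c 0 0 - usubmx b 0 0)%:M.
    by rewrite [LHS]mx11_scalar; congr _%:M; rewrite !mxE.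
  have -> : dsubmx (c - b) = dsubmx c - dsubmx b by apply/matrixP => ? ?; rewrite !mxE.
  by rewrite mul_mx_scalar -mulmxA.
rewrite Jd {Jd}.
move: (usubmx c 0 0) (usubmx b 0 0) (dsubmx c) (dsubmx b) hs ha sb sc ab ac => t s c1 b1 hs ha sb sc ab ac.
have [h1 h2] := qd s t sb sc; have [h3 h4] := FJ b1 c1 ab ac.
have [q1 q2] := qL s sb; have [_ q2'] := qL t sc; have [q1' _] := qL t sc.
have [F1 F2] := FK b1 ab; have [F1' F2'] := FK c1 ac.
have q3 := qLip s t sb sc; have F3 := FL b1 c1 ab ac.
have d2 : 0 <= d ^+ 2 by rewrite sqr_ge0.
have sq x : `|x| <= d -> x ^+ 2 <= d ^+ 2 :> R.
  by move=> xd; rewrite -(real_normK (num_real x)) ler_pXn2r // nnegrE.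
have h1' : `|q t - q s - (t - s) *: dq s| <= `|D| * d ^+ 2.
  apply: le_trans h1 _; apply: le_trans (ler_norm _) _.
  by rewrite normrM normrX ler_wpM2l // sq // normr_id.
have h2' : `|dq t - dq s| <= `|D| * d.
  apply: le_trans h2 _; apply: le_trans (ler_norm _) _.
  by rewrite normrM normr_id ler_wpM2l.
have h3' : `|F c1 - F b1 - J b1 *m (c1 - b1)| <= `|C| * d ^+ 2.
  apply: le_trans h3 _; apply: le_trans (ler_norm _) _.
  by rewrite normrM normrX normr_id ler_wpM2l // sq // normr_id.
have h4' : `|J c1 - J b1| <= `|C| * d.
  apply: le_trans h4 _; apply: le_trans (ler_norm _) _.
  by rewrite normrM normr_id ler_wpM2l.
have q3' : `|q t - q s| <= L * d by apply: le_trans q3 _; rewrite ler_wpM2l.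
have F3' : `|F c1 - F b1| <= K * d by apply: le_trans F3 _; rewrite ler_wpM2l.
split.
  have -> : q t *m F c1 - q s *m F b1 -
    ((t - s) *: (dq s *m F b1) + q s *m (J b1 *m (c1 - b1))) =
    q s *m (F c1 - F b1 - J b1 *m (c1 - b1)) +
    ((q t - q s - (t - s) *: dq s) *m F b1 + (q t - q s) *m (F c1 - F b1)).
    rewrite !mulmxBr !mulmxBl -scalemxAl; zmx.
  apply: le_trans (ler_normD _ _) _.
  apply: le_trans (lerD (norm_mulmx_le q1 h3') (ler_normD _ _)) _.
  apply: le_trans (lerD (lexx _) (lerD (norm_mulmx_le h1' F1) (norm_mulmx_le q3' F3'))) _.
  have -> : N * L * (`|C| * d ^+ 2) + (N * (`|D| * d ^+ 2) * K + N * (L * d) * (K * d))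
    = C1 * d ^+ 2 by rewrite /C1; ring.
  by rewrite ler_wpM2r // lerDl.
apply: (@le_trans _ _ (C2 * d)); last by rewrite ler_wpM2r // lerDr.
rewrite opp_row_mx add_row_mx; apply: norm_row_mx.
  have -> : dq t *m F c1 - dq s *m F b1 = (dq t - dq s) *m F c1 + dq s *m (F c1 - F b1).
    by rewrite mulmxBl mulmxBr; zmx.
  apply: le_trans (ler_normD _ _) _.
  apply: le_trans (lerD (norm_mulmx_le h2' F1') (norm_mulmx_le q2 F3')) _.
  have -> : N * (`|D| * d) * K + N * L * (K * d) = (N * `|D| * K + N * L * K) * d by ring.
  by rewrite ler_wpM2r // /C2 lerDl !addr_ge0 // !mulr_ge0.
have -> : q t *m J c1 - q s *m J b1 = (q t - q s) *m J c1 + q s *m (J c1 - J b1).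
  by rewrite mulmxBl mulmxBr; zmx.
apply: le_trans (ler_normD _ _) _.
apply: le_trans (lerD (norm_mulmx_le q3' F2') (norm_mulmx_le q1 h4')) _.
have -> : N * (L * d) * K + N * L * (`|C| * d) = (N * L * K + N * L * `|C|) * d by ring.
by rewrite ler_wpM2r // /C2 lerDr !addr_ge0 // !mulr_ge0.
Qed.

End Curves.
End ChartGrowth.

(** * Maximal charts *)

Section MaximalCharts.
Variables (R : realType) (n : nat) (S MM : set 'M[R]_n).
Hypothesis S1 : S 1%:M.
Hypothesis SM : forall P Q, S P -> S Q -> S (P *m Q).
Hypothesis SU : forall P, S P -> P \in unitmx.
Hypothesis Scurve : forall X, MM X -> exists q dq r C,
  [/\ 0 < r, curve11 r C q dq, q 0 = 1%:M, dq 0 = - X &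
      forall s, 0 <= s <= r ->
        exists2 P, S P & P *m q s = 1%:M /\ opn (P - 1%:M) <= C * s].

Record chart_data (k : nat) := ChartData {
  ch_map : 'cV[R]_k -> 'cV[R]_n; ch_deriv : 'cV[R]_k -> 'M[R]_(n, k);
  ch_linv : 'M[R]_(k, n); ch_rad : R; ch_const : R }.

(** A parametrized set of points steered to [y] by elements of [S] close to the
    identity, with parameters that are independent to first order. *)
Definition is_chart (y : 'cV[R]_n) (c : R) k (d : chart_data k) : Prop :=
  [/\ 0 < ch_rad d, c11 (ch_rad d) (ch_const d) (ch_map d) (ch_deriv d),
      ch_linv d *m ch_deriv d 0 = 1%:M &
      forall a, `|a| <= ch_rad d ->
        exists2 P, small S c P & P *m ch_map d a = y].

Lemma is_chart_le y c c' k (d : chart_data k) : c <= c' ->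
  is_chart y c d -> is_chart y c' d.
Proof.
move=> cc' [? ? ? h]; split => // a ar; have [P Pc Py] := h a ar.
by exists P => //; exact: small_le Pc.
Qed.

Lemma linv_perturb (k m : nat) (A B : 'M[R]_(m, k)) (P : 'M[R]_(k, m)) :
  P *m A = 1%:M -> k%:R * (m%:R * `|P| * `|B - A|) < 1 ->
  exists P', P' *m B = 1%:M.
Proof.
move=> PA h; exists (invmx (P *m B) *m P); rewrite -mulmxA mulVmx //.
apply: unitmx_near1; rewrite -PA -mulmxBr; apply: le_lt_trans h.
by rewrite /opn ler_wpM2l // norm_mulmx.
Qed.

(** A generator moving the chart out of the image of its derivative gives a
    further parameter. The new parameter is centred at a time [s0 > 0], so that
    a whole neighbourhood of it consists of admissible, positive times. *)
Lemma chart_extend y c c' k (d : chart_data k) a1 P1 P X :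
  is_chart y c d -> 1 < c' -> `|a1| < ch_rad d -> P1 *m ch_deriv d a1 = 1%:M ->
  small S c' P -> MM X ->
  ~ (exists v, conj_by P X *m ch_map d a1 = ch_deriv d a1 *m v) ->
  exists d' : chart_data (1 + k), is_chart y (c * (c' * c')) d'.
Proof.
case: d => F J P0 rho C [/= rho0 FJ _ Fy] c'1 a1r P1J [SP Pc] MX noX.
have [q [dq [r [D [r0 qd q0 dq0 qS]]]]] := Scurve MX.
have uP := SU SP.
pose W := invmx P.
(* The derivative of the extended chart, at the limit value 0 of the new parameter. *)
pose A0 := row_mx (- X *m (W *m F a1)) (W *m J a1).
have [Q QA] : exists Q : 'M[R]_(1 + k, n), Q *m A0 = 1%:M.
  suff /row_freeP[B BA] : row_free A0^T.
    by exists B^T; apply: trmx_inj; rewrite trmx_mul trmxK trmx1.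
  rewrite -kermx_eq0; apply/eqP/row_matrixP => i; rewrite row0.
  have : row i (kermx A0^T) *m A0^T = 0 by rewrite -row_mul mulmx_ker row0.
  move: (row i _) => u uA.
  have {uA} : A0 *m u^T = 0 by apply: trmx_inj; rewrite trmx_mul trmxK trmx0.
  move: (u^T) (trmxK u) => v uv; rewrite -uv => {uv u}.
  rewrite -[v]vsubmxK mul_row_col (mx11_scalar (usubmx v)) mul_mx_scalar.
  move: (usubmx v 0 0 : R) (dsubmx v) => z w vA.
  have z0 : z = 0.
    apply/eqP/negP => /negP zn0; apply: noX; exists (z^-1 *: w).
    have : P *m (z *: (- X *m (W *m F a1)) + W *m J a1 *m w) = 0 by rewrite vA mulmx0.
    have PW : P *m W = 1%:M by rewrite mulmxV.
    have -> : P *m (z *: (- X *m (W *m F a1)) + W *m J a1 *m w)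
        = J a1 *m w - z *: (conj_by P X *m F a1).
      rewrite mulmxDr -scalemxAr mulNmx mulmxN scalerN !mulmxA PW mul1mx addrC.
      by [].
    move=> /eqP; rewrite subr_eq0 => /eqP h.
    by rewrite -scalemxAr h scalerA mulVf // scale1r.
  move: vA; rewrite z0 scale0r add0r => /(congr1 (mulmx (P1 *m P))).
  rewrite mulmx0 -!mulmxA (mulmxA P) mulmxV // mul1mx mulmxA P1J mul1mx => ->.
  by rewrite raddf0 col_mx0 trmx0.
have [K K0 [qK qLip]] := curve11_bounded (ltW r0) qd.
pose H a := W *m F (a1 + a); pose JH a := W *m J (a1 + a).
pose rho1 := rho - `|a1|.
have rho10 : 0 < rho1 by rewrite subr_gt0.
have HJ : c11 rho1 (n%:R * `|W| * C) H JH.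
  by apply: c11_affine FJ; rewrite /rho1 addrC subrK.
pose N : R := n%:R; have N0 : 0 <= N by [].
pose L := N * `|D| * `|H 0| + N * K * `|JH 0|.
have L0 : 0 <= L by rewrite addr_ge0 // !mulr_ge0.
pose KQ := (1 + k)%:R * (N * `|Q| * L).
have KQ0 : 0 <= KQ by rewrite !mulr_ge0.
have D0 : 0 <= `|D| by [].
have c'0 : 0 < c' - 1 by lra.
pose e := Num.min (r / 2) (Num.min (2 * (KQ + 1))^-1 ((c' - 1) / (2 * (`|D| + 1)))).
have e0 : 0 < e.
  rewrite !lt_min; apply/and3P; split; first by rewrite divr_gt0.
    by rewrite invr_gt0; lra.
  by rewrite divr_gt0 //; lra.
have er : 2 * e <= r by have : e <= r / 2 by [rewrite ge_min lexx]; lra.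
have eK : KQ * e < 1.
  have : e <= (2 * (KQ + 1))^-1 by rewrite !ge_min lexx orbT.
  rewrite -[X in _ <= X]div1r ler_pdivlMr; last by lra.
  by nra.
have eD : `|D| * (2 * e) <= c' - 1.
  have : e <= (c' - 1) / (2 * (`|D| + 1)) by rewrite !ge_min lexx !orbT.
  rewrite ler_pdivlMr; last by lra.
  by nra.
pose q1 s := q (e + s); pose dq1 s := dq (e + s).
have qd1 : curve11 e D q1 dq1.
  by apply: curve11_shift qd; rewrite gtr0_norm //; lra.
pose rho2 := Num.min e rho1.
have rho20 : 0 < rho2 by rewrite lt_min e0.
have [C' Ch] : exists C', c11 rho2 C' (extend_chart q1 H) (extend_deriv q1 dq1 H JH).
  have HJ2 : c11 rho2 (n%:R * `|W| * C) H JH.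
    by move=> a b ar br; apply: HJ; rewrite ?(le_trans ar) ?(le_trans br) // ge_min lexx orbT.
  have qd2 : curve11 rho2 D q1 dq1.
    by move=> a b ar br; apply: qd1; rewrite ?(le_trans ar) ?(le_trans br) // ge_min lexx.
  exact: c11_extend (ltW rho20) HJ2 qd2.
have [Q' Q'A] : exists Q', Q' *m extend_deriv q1 dq1 H JH 0 = 1%:M.
  apply: (linv_perturb QA).
  rewrite /extend_deriv /A0 !linear0 mxE opp_row_mx add_row_mx.
  apply: le_lt_trans eK.
  have -> : KQ * e = (1 + k)%:R * (N * `|Q| * (L * e)) by rewrite /KQ !mulrA.
  rewrite ler_wpM2l // ler_wpM2l ?mulr_ge0 //.
  have z0 : `|0 : R| <= r by rewrite normr0 ltW.
  have er' : `|e| <= r by rewrite gtr0_norm //; lra.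
  have [_ h1] := qd 0 e z0 er'; have h2 := qLip 0 e z0 er'.
  rewrite subr0 (gtr0_norm e0) dq0 q0 in h1 h2.
  have g1 : `|D| * `|H 0| * N * e <= L * e.
    rewrite ler_pM2r // /L.
    have : 0 <= N * K * `|JH 0| by rewrite !mulr_ge0.
    have -> : `|D| * `|H 0| * N = N * `|D| * `|H 0| by ring.
    lra.
  have g2 : K * `|JH 0| * N * e <= L * e.
    rewrite ler_pM2r // /L.
    have : 0 <= N * `|D| * `|H 0| by rewrite !mulr_ge0.
    have -> : K * `|JH 0| * N = N * K * `|JH 0| by ring.
    lra.
  rewrite /q1 /dq1 addr0; apply: norm_row_mx.
    have -> : W *m F a1 = H 0 by rewrite /H addr0.
    rewrite -mulmxBl; apply: le_trans g1.
    have h1' : `|dq e - - X| <= `|D| * e.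
      by apply: le_trans h1 _; rewrite ler_wpM2r ?ler_norm // ltW.
    apply: le_trans (norm_mulmx_le h1' (lexx _)) _.
    by rewrite le_eqVlt; apply/orP; left; apply/eqP; rewrite /N; ring.
  have -> : W *m J a1 = JH 0 by rewrite /JH addr0.
  rewrite -{2}[JH 0]mul1mx -mulmxBl; apply: le_trans g2.
  apply: le_trans (norm_mulmx_le h2 (lexx _)) _.
  by rewrite le_eqVlt; apply/orP; left; apply/eqP; rewrite /N; ring.
exists (ChartData (extend_chart q1 H) (extend_deriv q1 dq1 H JH) Q' rho2 C').
split => //= b br.
have be : `|usubmx b 0 0| <= e.
  by apply: le_trans (norm_usubmx b) _; apply: le_trans br _; rewrite ge_min lexx.
have brho : `|a1 + dsubmx b| <= rho.
  apply: le_trans (ler_normD _ _) _; rewrite -lerBrDl -/rho1.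
  by apply: le_trans (norm_dsubmx b) _; apply: le_trans br _; rewrite ge_min lexx orbT.
have [Psi Psic Psiy] := Fy _ brho.
have := be; rewrite ler_norml => /andP[be1 be2].
have [|E SE [Eq Ed]] := qS (e + usubmx b 0 0); first by apply/andP; split; lra.
have Ec : small S c' E.
  split => //; apply: le_trans Ed _; apply: le_trans eD.
  apply: le_trans (ler_wpM2r _ (ler_norm _)) _; first lra.
  by rewrite ler_wpM2l //; lra.
exists (Psi *m (P *m E)).
  by apply: smallM => //; apply: smallM.
rewrite /extend_chart /H /q1 -!mulmxA (mulmxA E) Eq mul1mx (mulmxA P) mulmxV //.
by rewrite mul1mx.
Qed.

Lemma chart_dim_le y c k (d : chart_data k) : is_chart y c d -> (k <= n)%N.
Proof.
case: d => F J P rho C [/= _ _ PJ _].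
rewrite -(mxrank1 R k) -PJ; apply: leq_trans (mxrankM_maxl _ _) _.
exact: rank_leq_col.
Qed.

(** A chart with as many parameters as possible cannot be extended, so the
    generators conjugated by small elements are tangent to it.  Each extension
    relaxes the closeness to the identity by a factor [e]; as there are at most
    [n] parameters, [e ^+ n.+1 <= c] suffices. *)
Lemma maximal_chart y c c' : 1 < c -> 1 < c' ->
  exists k (d : chart_data k) c1, [/\ is_chart y c d, 1 < c1 <= c' &
    exists2 r, 0 < r <= ch_rad d &
    forall a P X, `|a| <= r -> small S c1 P -> MM X ->
      exists v, conj_by P X *m ch_map d a = ch_deriv d a *m v].
Proof.
move=> c1 c'1.
have [e e1 eN] := exp_below n.+1 c1.
have [f f1 ff] := exp_below 2 e1.
pose c2 := Num.min f c'.
have c21 : 1 < c2 by rewrite lt_min f1.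
have c2e : c2 * c2 <= e.
  have : c2 <= f by rewrite ge_min lexx.
  move: ff; rewrite expr2; nra.
pose p k := `[< exists d : chart_data k, is_chart y (e ^+ k) d >].
have ex : exists k, p k.
  exists 0%N; apply/asboolP; exists (ChartData (fun=> y) (fun=> 0) 0 1 0); split => //=.
  - by move=> a b _ _; rewrite !mul0r subrr mul0mx subr0 normr0 subrr normr0.
  - by apply/matrixP => -[].
  - by move=> a _; exists 1%:M; rewrite ?mul1mx //; split => //; rewrite expr0 !subrr /opn normr0 mulr0.
have bnd k : p k -> (k <= n)%N by case/asboolP => d; exact: chart_dim_le.
have [k /asboolP[d dk] maxk] := ex_maxnP ex bnd.
have kn := chart_dim_le dk.
exists k, d, c2; split.
- apply: is_chart_le dk; apply: le_trans eN; apply: ler_weXn2l; first exact: ltW.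
  exact: leqW.
- by rewrite c21 ge_min lexx orbT.
have [rho0 FJ PJ _] := dk.
have [r [r0 rrho _ Jr]] := c11_regular rho0 FJ PJ.
exists (r / 2); first by rewrite divr_gt0 //=; lra.
move=> a P X ar Pc MX.
apply: contrapT => noX.
have [P1 P1J] : exists P1, P1 *m ch_deriv d a = 1%:M.
  suff u : ch_linv d *m ch_deriv d a \in unitmx.
    by exists (invmx (ch_linv d *m ch_deriv d a) *m ch_linv d); rewrite -mulmxA mulVmx.
  apply: unitmx_inj => v; rewrite -mulmxA => Av.
  have ar' : `|a| <= r by lra.
  have := Jr a v ar'; rewrite Av subr0 => h; have v0 : 0 <= `|v| by [].
  by apply/eqP; rewrite -normr_le0; lra.
have ar' : `|a| < ch_rad d by lra.
have [d' dd'] := chart_extend dk c21 ar' P1J Pc MX noX.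
have : p k.+1.
  apply/asboolP; exists d'; apply: is_chart_le dd'.
  by rewrite exprS mulrC ler_wpM2r // exprn_ge0 //; lra.
by move/maxk; rewrite ltnn.
Qed.

End MaximalCharts.

(** * Euler's method along a moving chart *)

Section Euler.
Variables (R : realType) (n k : nat) (S : set 'M[R]_n).
Variables (aa G : {vspace 'M[R]_n}).
Hypothesis aaG : (aa <= G)%VS.
Hypothesis Ginv : forall P Y, S P -> Y \in G -> invmx P *m Y *m P \in G.
Variables (r C : R) (F : 'cV[R]_k -> 'cV[R]_n) (J : 'cV[R]_k -> 'M[R]_(n, k)).
Variable (P : 'M[R]_(k, n)).
Hypothesis r0 : 0 < r.
Hypothesis FJ : c11 r C F J.
Hypothesis Freg : forall a b : 'cV[R]_k, `|a| <= r -> `|b| <= r ->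
  `|(b - a) - P *m (F b - F a)| <= 2^-1 * `|b - a|.
Hypothesis Jreg : forall a v : 'cV[R]_k, `|a| <= r ->
  `|v - P *m (J a *m v)| <= 2^-1 * `|v|.
Hypothesis tangent : forall a Y, `|a| <= r -> Y \in G ->
  exists v, Y *m F a = J a *m v.

Lemma path_const_ge0 g D : semigroup_path S aa g D -> 0 <= D.
Proof. by move=> [g0 gP]; have [_ _ + _] := gP 0 0 (lexx _) (lexx _) ler01; exact: le_trans. Qed.

Lemma path_const_le g D D' : D <= D' -> semigroup_path S aa g D -> semigroup_path S aa g D'.
Proof.
move=> DD' [g0 gP]; split => // s t s0 st t1.
have [h1 h2 h3 [X XG [h4 h5]]] := gP s t s0 st t1; split => //.
  exact: le_trans DD'.
exists X => //; split; [apply: le_trans h4 _|apply: le_trans h5 _].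
  by rewrite ler_wpM2r // subr_ge0.
by rewrite ler_wpM2r // sqr_ge0.
Qed.

Lemma path_in g D t : semigroup_path S aa g D -> 0 <= t <= 1 ->
  [/\ S (g t), g t \in unitmx, `|invmx (g t)| <= D & `|g t| <= 1 + 2 * D].
Proof.
move=> gD /andP[t0 t1]; have D0 := path_const_ge0 gD; move: gD => [g0 gP].
have [_ h2 h3 _] := gP t t t0 (lexx _) t1.
have [h1 _ _ [X _ [h4 h5]]] := gP 0 t (lexx _) t0 t1.
rewrite g0 invmx1 mulmx1 in h1; rewrite g0 subr0 mulmx1 in h5; rewrite subr0 in h4.
split => //.
have -> : g t = 1%:M + (X + (g t - 1%:M - X)) by zmx.
apply: le_trans (ler_normD _ _) _; apply: lerD; first exact: norm1_mx_le.
apply: le_trans (ler_normD _ _) _.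
have : D * t ^+ 2 <= D by rewrite ler_piMr // exprn_ile1.
have : D * t <= D by rewrite ler_piMr.
lra.
Qed.

Lemma path_lip g D s t : semigroup_path S aa g D -> 0 <= s -> s <= t -> t <= 1 ->
  `|g t - g s| <= (n%:R * D * (1 + 2 * D) + D) * (t - s).
Proof.
move=> gD s0 st t1; have D0 := path_const_ge0 gD.
have s01 : 0 <= s <= 1 by rewrite s0 (le_trans st).
have [_ _ _ gs] := path_in gD s01.
move: gD => [g0 gP]; have [_ _ _ [X _ [h4 h5]]] := gP s t s0 st t1.
rewrite -(subrK (X *m g s) (g t - g s)) addrC mulrDl.
apply: le_trans (ler_normD _ _) _; apply: lerD.
  by apply: le_trans (norm_mulmx_le h4 gs) _; rewrite le_eqVlt; apply/orP; left; apply/eqP; ring.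
apply: le_trans h5 _; rewrite expr2 mulrA.
have ts : 0 <= t - s by rewrite subr_ge0.
have : D * (t - s) <= D by rewrite ler_piMr //; lra.
by move=> h; rewrite ler_wpM2r.
Qed.

(** Follow [g *m F 0] in the moving chart [h *m F]. In this frame the velocity
    of [g] relative to [h] is [invmx h *m (X - X') *m h], which lies in [G] and
    is thus tangent to the chart: one Euler step in the parameters loses only
    a quadratic error. *)
Lemma euler_step g h D eta : semigroup_path S aa g D -> semigroup_path S aa h D ->
  (forall t, 0 <= t <= 1 -> `|invmx (h t) *m g t *m F 0 - F 0| <= eta) ->
  2 * (n%:R * `|P|) * eta <= r / 4 ->
  exists A B V, [/\ 0 <= A, 0 <= B, 0 < V &
    forall s t a e, 0 <= s -> s <= t -> t <= 1 -> V * (t - s) <= r / 2 ->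
      `|a| <= r -> `|g s *m F 0 - h s *m F a| <= e -> V * e <= r / 4 ->
      exists2 b, `|b| <= r &
        `|g t *m F 0 - h t *m F b| <= (1 + A * (t - s)) * e + B * (t - s) ^+ 2].
Proof.
move=> gD hD gh eta_r; have D0 := path_const_ge0 gD.
have [K K0 [FK FL]] := c11_bounded (ltW r0) FJ.
pose N : R := n%:R; have N0 : 0 <= N by [].
pose Pn := N * `|P|; have Pn0 : 0 <= Pn by rewrite mulr_ge0.
pose H := 1 + 2 * D; have H0 : 0 <= H by rewrite /H; lra.
pose V1 := 2 * Pn * (N * (N * (N * D * (2 * D)) * H) * K).
have V10 : 0 <= V1 by rewrite !mulr_ge0.
pose V2 := 2 * Pn * (N * D); have V20 : 0 <= V2 by rewrite !mulr_ge0.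
pose C' := `|C|; have C'0 : 0 <= C' by exact: normr_ge0.
pose B := N * D * `|F 0| + N * D * (N * H * (k%:R * K * V1)) +
  N * (H + N * D * H) * (C' * V1 ^+ 2) + N * D * K.
have B0 : 0 <= B by rewrite !addr_ge0 // !mulr_ge0 // ?sqr_ge0 // addr_ge0 // !mulr_ge0.
exists (N * D), B, (V1 + V2 + 1); split => //.
- by rewrite mulr_ge0.
- by lra.
move=> s t a e s0 st t1 Vts ar ge Ve.
have e0 : 0 <= e by apply: le_trans ge.
have ts0 : 0 <= t - s by lra. have ts1 : t - s <= 1 by lra.
have s01 : 0 <= s <= 1 by rewrite s0 (le_trans st).
have [Shs uhs ihs hs] := path_in hD s01.
have ar2 : `|a| <= r / 2.
  have z0 : `|0 : 'cV[R]_k| <= r by rewrite normr0 ltW.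
  have := half_lower (Freg z0 ar); rewrite subr0.
  have -> : F a - F 0 = (invmx (h s) *m g s *m F 0 - F 0)
      - invmx (h s) *m (g s *m F 0 - h s *m F a).
    by rewrite mulmxBr !mulmxA mulVmx // mul1mx; zmx.
  rewrite mulmxBr => h1; apply: le_trans h1 _.
  have h2 := norm_mulmx_le (lexx `|P|) (gh s s01).
  have h3 := norm_mulmx_le (lexx `|P|) (norm_mulmx_le ihs ge).
  have h4 : 2 * Pn * (N * D * e) <= r / 4.
    apply: le_trans Ve; rewrite mulrA -/V2 ler_wpM2r //; lra.
  have := ler_normB (P *m (invmx (h s) *m g s *m F 0 - F 0)) (P *m (invmx (h s) *m (g s *m F 0 - h s *m F a))).
  rewrite /Pn /N in h4; lra.
have [_ gP] := gD; have [_ hP] := hD.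
have [_ _ _ [X Xaa [XD gX]]] := gP s t s0 st t1.
have [_ _ _ [X' X'aa [X'D hX']]] := hP s t s0 st t1.
pose Y := invmx (h s) *m (X - X') *m h s.
have YG : Y \in G by apply: Ginv => //; apply: (subvP aaG); rewrite rpredB.
have [v Yv] := tangent ar YG.
have [Fa Ja] := FK a ar.
have XX' : `|X - X'| <= 2 * D * (t - s).
  by apply: le_trans (ler_normB _ _) _; lra.
have vV : `|v| <= V1 * (t - s).
  apply: le_trans (half_lower (Jreg v ar)) _; rewrite -Yv.
  have h1 := norm_mulmx_le (lexx `|P|) (norm_mulmx_le (norm_mulmx_le (norm_mulmx_le ihs XX') hs) Fa).
  have -> : V1 * (t - s) = 2 * (n%:R * `|P| *
    (n%:R * (n%:R * (n%:R * D * (2 * D * (t - s))) * (1 + 2 * D)) * K)).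
    by rewrite /V1 /Pn /N /H; ring.
  by rewrite ler_wpM2l.
have br : `|a + v| <= r.
  apply: le_trans (ler_normD _ _) _.
  have : V1 * (t - s) <= (V1 + V2 + 1) * (t - s) by rewrite ler_wpM2r //; lra.
  lra.
exists (a + v) => //.
have [FT _] := FJ ar br.
have E1 : a + v - a = v by zmx.
rewrite E1 in FT.
have FT' : `|F (a + v) - F a - J a *m v| <= C' * V1 ^+ 2 * (t - s) ^+ 2.
  apply: le_trans FT _; apply: le_trans (ler_norm _) _.
  rewrite normrM normrX normr_id -mulrA ler_wpM2l // -exprMn.
  by rewrite ler_pXn2r // nnegrE // mulr_ge0.
have [Fb _] := FK _ br.
set q1 := g t - g s - X *m g s in gX.
set q2 := h t - h s - X' *m h s in hX'.
set q3 := F (a + v) - F a - J a *m v in FT'.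
have gtE : g t = g s + X *m g s + q1 by rewrite /q1; zmx.
have htE : h t = h s + X' *m h s + q2 by rewrite /q2; zmx.
have Fbe : F (a + v) = F a + J a *m v + q3 by rewrite /q3; zmx.
have hJ : h s *m (J a *m v) = X *m h s *m F a - X' *m h s *m F a.
  by rewrite -Yv /Y !mulmxA mulmxV // mul1mx mulmxBl mulmxBl.
have -> : g t *m F 0 - h t *m F (a + v) =
   (g s *m F 0 - h s *m F a) + (X *m (g s *m F 0 - h s *m F a) + (q1 *m F 0
     - (X' *m (h s *m (J a *m v)) + ((h s + X' *m h s) *m q3 + q2 *m F (a + v))))).
  have -> : h t *m F (a + v) = h s *m F a + (X' *m h s *m F a + (h s *m (J a *m v)
     + (X' *m (h s *m (J a *m v)) + ((h s + X' *m h s) *m q3 + q2 *m F (a + v))))).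
    rewrite htE mulmxDl {1}Fbe !mulmxDr !mulmxDl !mulmxA.
    by zmx.
  have -> : X *m (g s *m F 0 - h s *m F a) = X *m g s *m F 0 - X *m h s *m F a.
    by rewrite mulmxBr !mulmxA.
  by rewrite gtE 2!mulmxDl hJ; zmx.
apply: le_trans (ler_normD _ _) _.
have -> : (1 + N * D * (t - s)) * e + B * (t - s) ^+ 2 =
  e + (N * (D * (t - s)) * e + B * (t - s) ^+ 2) by ring.
apply: lerD => //.
apply: le_trans (ler_normD _ _) _; apply: lerD; first exact: norm_mulmx_le.
apply: le_trans (ler_normB _ _) _.
have b1 := norm_mulmx_le gX (lexx `|F 0|).
have b2 := norm_mulmx_le X'D (norm_mulmx_le hs (norm_mulmx_le Ja vV)).
have hs' : `|h s + X' *m h s| <= H + N * D * H.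
  apply: le_trans (ler_normD _ _) _; apply: lerD => //.
  have X'D' : `|X'| <= D by apply: le_trans X'D _; rewrite ler_piMr.
  exact: norm_mulmx_le.
have b3 := norm_mulmx_le hs' FT'.
have b4 := norm_mulmx_le hX' Fb.
have c1 := ler_normD (X' *m (h s *m (J a *m v))) ((h s + X' *m h s) *m q3 + q2 *m F (a + v)).
have c2 := ler_normD ((h s + X' *m h s) *m q3) (q2 *m F (a + v)).
have -> : B * (t - s) ^+ 2 = n%:R * (D * (t - s) ^+ 2) * `|F 0| +
  (n%:R * (D * (t - s)) * (n%:R * (1 + 2 * D) * (k%:R * K * (V1 * (t - s)))) +
  (n%:R * (H + N * D * H) * (C' * V1 ^+ 2 * (t - s) ^+ 2) +
   n%:R * (D * (t - s) ^+ 2) * K)).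
  by rewrite /B /N /H; ring.
by lra.
Qed.

(** With [m] steps the accumulated error is of order [1 / m].  The bound [eta]
    keeps the parameters away from the boundary of the chart. *)
Lemma euler g h D eta : semigroup_path S aa g D -> semigroup_path S aa h D ->
  (forall t, 0 <= t <= 1 -> `|invmx (h t) *m g t *m F 0 - F 0| <= eta) ->
  2 * (n%:R * `|P|) * eta <= r / 4 ->
  closure [set h 1 *m F a | a in [set a : 'cV[R]_k | `|a| <= r]] (g 1 *m F 0).
Proof.
move=> gD hD gh eta_r.
have [A [B [V [A0 B0 V0 step]]]] := euler_step gD hD gh eta_r.
have D0 := path_const_ge0 gD.
move=> U /nbhs_ballP[eps /= eps0 epsU].
pose M := B * expR A; have M0 : 0 <= M by rewrite mulr_ge0 // expR_ge0.
have [m [m0 mV mM mE]] : exists m : nat, [/\ 0 < m%:R :> R, V * m%:R^-1 <= r / 2,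
    V * (M * m%:R^-1) <= r / 4 & M * m%:R^-1 < eps].
  pose Q := V / (r / 2) + V * M / (r / 4) + M / eps.
  have p1 : 0 <= V / (r / 2) by rewrite !divr_ge0 // ltW.
  have p2 : 0 <= V * M / (r / 4) by rewrite !divr_ge0 // ?mulr_ge0 // ltW.
  have p3 : 0 <= M / eps by rewrite divr_ge0 // ltW.
  have Q0 : 0 <= Q by rewrite /Q !addr_ge0.
  exists (Num.truncn Q).+1.
  have mQ := truncnS_gt Q.
  have m0 : 0 < (Num.truncn Q).+1%:R :> R by rewrite ltr0n.
  split => //.
  - rewrite ler_pdivrMr // [leRHS]mulrC -ler_pdivrMr ?divr_gt0 //; rewrite /Q in mQ; lra.
  - rewrite mulrA ler_pdivrMr // [leRHS]mulrC -ler_pdivrMr ?divr_gt0 //; rewrite /Q in mQ; lra.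
  - rewrite ltr_pdivrMr // [ltRHS]mulrC -ltr_pdivrMr //; rewrite /Q in mQ; lra.
have mi0 : 0 <= m%:R^-1 :> R by rewrite invr_ge0 ltW.
have main i : (i <= m)%N -> exists2 a, `|a| <= r &
    `|g (i%:R / m%:R) *m F 0 - h (i%:R / m%:R) *m F a| <=
      B * m%:R^-1 ^+ 2 * i%:R * expR (A * (i%:R / m%:R)).
  elim: i => [_|i IH im].
    exists 0; first by rewrite normr0 ltW.
    by rewrite mul0r; case: gD hD => [-> _] [-> _]; rewrite subrr normr0 mulr0 mul0r.
  have [a ar ha] := IH (ltnW im).
  set e := B * _ * _ * _ in ha.
  have dt : i.+1%:R / m%:R - i%:R / m%:R = m%:R^-1 :> R.
    by rewrite -mulrBl -natrB // subSnn mul1r.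
  have s0 : 0 <= i%:R / m%:R :> R by rewrite divr_ge0.
  have st : i%:R / m%:R <= i.+1%:R / m%:R :> R by rewrite ler_pM2r ?invr_gt0 // ler_nat.
  have t1 : i.+1%:R / m%:R <= 1 :> R by rewrite ler_pdivrMr // mul1r ler_nat.
  have s1 : i%:R / m%:R <= 1 :> R by exact: le_trans t1.
  have eM : e <= M * m%:R^-1.
    have -> : e = B * m%:R^-1 * (i%:R / m%:R) * expR (A * (i%:R / m%:R)).
      by rewrite /e; ring.
    have -> : M * m%:R^-1 = B * m%:R^-1 * 1 * expR A by rewrite /M; ring.
    apply: ler_pM; rewrite ?expR_ge0 ?mulr_ge0 //.
      by rewrite ler_wpM2l // mulr_ge0.
    by rewrite ler_expR ler_piMr.
  have Ve : V * e <= r / 4 by apply: le_trans mM; rewrite ler_wpM2l // ltW.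
  have := step _ _ a e s0 st t1; rewrite dt => /(_ mV ar ha Ve)[b br hb].
  exists b => //; apply: le_trans hb _.
  have eA : expR (A * (i.+1%:R / m%:R)) = expR (A * (i%:R / m%:R)) * expR (A * m%:R^-1).
    by rewrite -expRD -natr1; congr expR; ring.
  rewrite eA -natr1.
  have x1 : 1 + A * m%:R^-1 <= expR (A * m%:R^-1) by exact: expR_ge1Dx.
  have y1 : 1 <= expR (A * (i%:R / m%:R)) by rewrite -expR0 ler_expR mulr_ge0.
  have Am : 0 <= A * m%:R^-1 by rewrite mulr_ge0.
  rewrite /e; set x := expR (A * m%:R^-1) in x1 *; set y := expR _ in y1 *.
  set b2 := B * m%:R^-1 ^+ 2; have b20 : 0 <= b2 by rewrite mulr_ge0 // sqr_ge0.
  have i0 : 0 <= i%:R :> R by [].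
  have z1 : 0 <= b2 * i%:R * y by rewrite !mulr_ge0 //; lra.
  have xy : 1 <= y * x by nra.
  have := ler_wpM2l z1 x1; have := ler_wpM2l b20 xy.
  nra.
have [a ar ha] := main m (leqnn m).
rewrite divff ?gt_eqF // in ha.
exists (h 1 *m F a); split; first by exists a.
apply: epsU; rewrite -ball_normE /=; apply: le_lt_trans ha _; apply: le_lt_trans mE.
rewrite mulr1 le_eqVlt; apply/orP; left; apply/eqP; rewrite /M expr2.
by field; rewrite gt_eqF.
Qed.

End Euler.

(** * Krener's theorem for a matrix semigroup *)

Section Krener.
Variables (R : realType) (n : nat) (S MM : set 'M[R]_n) (aa : {vspace 'M[R]_n}).

(** Countably many codes, each shared only by paths that are uniformly close when
    they have the same Lipschitz constant: a countable substitute for the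
    separability of the space of paths. *)
Definition path_code (q : nat) (g : R -> 'M[R]_n) : seq 'M[int]_n :=
  [seq \matrix_(i, j) Num.floor (g (l%:R / q%:R) i j * q%:R) | l <- iota 0 q.+1].

Lemma path_code_close q g h D t : (0 < q)%N -> path_code q g = path_code q h ->
  semigroup_path S aa g D -> semigroup_path S aa h D -> 0 <= t <= 1 ->
  `|g t - h t| <= (2 * (n%:R * D * (1 + 2 * D) + D) + 1) / q%:R.
Proof.
move=> q0 gh gD hD /andP[t0 t1]; have D0 := path_const_ge0 gD.
have qp : 0 < q%:R :> R by rewrite ltr0n.
pose i := Num.truncn (t * q%:R).
have tq0 : 0 <= t * q%:R by rewrite mulr_ge0 // ltW.
have /andP[i1 i2] : i%:R <= t * q%:R < i.+1%:R by rewrite truncn_itv.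
have iq : (i < q.+1)%N.
  by rewrite ltnS -(ler_nat R); apply: le_trans i1 _; rewrite ler_piMl // ltW.
pose s : R := i%:R / q%:R.
have s0 : 0 <= s by rewrite divr_ge0.
have st : s <= t by rewrite ler_pdivrMr.
have ts : t - s <= q%:R^-1.
  rewrite lerBlDr -(ler_pM2r qp) mulrDl mulVf ?gt_eqF // /s divfK ?gt_eqF // addrC.
  by rewrite natr1 ltW.
set K := n%:R * D * (1 + 2 * D) + D.
have K0 : 0 <= K by rewrite addr_ge0 // !mulr_ge0 //; lra.
have g1 := path_lip gD s0 st t1; have h1 := path_lip hD s0 st t1.
rewrite -/K in g1 h1.
have Kq : K * (t - s) <= K / q%:R by rewrite ler_wpM2l.
have gs : `|g s - h s| <= q%:R^-1.
  apply: mx_norm_le => [|a b]; first by rewrite invr_ge0 ltW.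
  have := congr1 (fun x : seq 'M[int]_n => nth 0 x i a b) gh.
  rewrite !(nth_map 0%N) ?size_iota // nth_iota // add0n !mxE -/s => fl.
  have f1 := floor_le (g s a b * q%:R); have f2 := floorD1_gt (g s a b * q%:R).
  have f3 := floor_le (h s a b * q%:R); have f4 := floorD1_gt (h s a b * q%:R).
  rewrite -fl in f3 f4; rewrite !intrD in f2 f4.
  rewrite -(ler_pM2r qp) mulVf ?gt_eqF //.
  have : `|(g s a b - h s a b) * q%:R| <= 1.
    by rewrite mulrBl ler_norml; apply/andP; split; lra.
  by rewrite normrM (gtr0_norm qp).
have -> : g t - h t = (g t - g s) + ((g s - h s) - (h t - h s)) by zmx.
apply: le_trans (ler_normD _ _) _.
have := ler_normB (g s - h s) (h t - h s).
have -> : (2 * K + 1) / q%:R = 2 * (K / q%:R) + q%:R^-1 by rewrite mulrDl mulrA mul1r.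
lra.
Qed.

Hypothesis S1 : S 1%:M.
Hypothesis SM : forall P Q, S P -> S Q -> S (P *m Q).
Hypothesis SU : forall P, S P -> P \in unitmx.
Hypothesis Spath : forall P, S P ->
  exists g C, semigroup_path S aa g C /\ g 1 = P.
Hypothesis Scurve : forall X, MM X -> exists q dq r C,
  [/\ 0 < r, curve11 r C q dq, q 0 = 1%:M, dq 0 = - X &
      forall s, 0 <= s <= r ->
        exists2 P, S P & P *m q s = 1%:M /\ opn (P - 1%:M) <= C * s].
Hypothesis aaMM : forall U : {vspace 'M[R]_n},
  (forall X, MM X -> X \in U) -> (aa <= U)%VS.

Definition orbit_of (z : 'cV[R]_n) : set 'cV[R]_n :=
  [set v | exists2 P, S P & v = P *m z].

(** With countably many representatives [h], every path [g] is uniformly close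
    to one of them, so the orbit is covered by countably many transported charts
    [h 1 *m F], of deficient dimension: Baire concludes. *)
Lemma orbit_thin (k : nat) (G : {vspace 'M[R]_n}) (r C : R)
    (F : 'cV[R]_k -> 'cV[R]_n) (J : 'cV[R]_k -> 'M[R]_(n, k)) (P : 'M[R]_(k, n)) :
  (aa <= G)%VS ->
  (forall P Y, S P -> Y \in G -> invmx P *m Y *m P \in G) ->
  0 < r -> c11 r C F J ->
  (forall a b : 'cV[R]_k, `|a| <= r -> `|b| <= r ->
    `|(b - a) - P *m (F b - F a)| <= 2^-1 * `|b - a|) ->
  (forall a v : 'cV[R]_k, `|a| <= r -> `|v - P *m (J a *m v)| <= 2^-1 * `|v|) ->
  (forall a Y, `|a| <= r -> Y \in G -> exists v, Y *m F a = J a *m v) ->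
  (k < n)%N -> (orbit_of (F 0))° = set0.
Proof.
move=> aaG Ginv r0 FJ Freg Jreg tang kn.
have [K K0 [_ FL]] := c11_bounded (ltW r0) FJ.
pose thin (h : R -> 'M[R]_n) :=
  closure [set h 1 *m F a | a in [set a : 'cV[R]_k | `|a| <= r]].
have thin0 h : h 1 \in unitmx -> (thin h)° = set0.
  move=> uh; pose L := n%:R * `|h 1| * (K * 2).
  have L0 : 0 <= n%:R * `|h 1| by rewrite mulr_ge0.
  apply: (@graph_nowhere_dense _ k n (P *m invmx (h 1)) L) => // _ _ [a /= ar <-] [b /= br <-].
  rewrite -mulmxBr -mulmxA mulKmx // /L -[leRHS]mulrA.
  apply: le_trans (norm_mulmx _ _) _; rewrite ler_wpM2l //.
  apply: le_trans (FL _ _ br ar) _; rewrite -mulrA ler_wpM2l //.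
  exact: half_lower (Freg _ _ br ar).
pose Pn := n%:R * `|P|; have Pn0 : 0 <= Pn by rewrite mulr_ge0.
pose eta := r / 4 / (2 * (Pn + 1)).
have eta0 : 0 < eta by rewrite !divr_gt0 //; lra.
have etar : 2 * Pn * eta <= r / 4.
  rewrite /eta mulrA ler_pdivrMr; last lra.
  by rewrite mulrC ler_wpM2l //; lra.
pose q (m : nat) : nat := let D := m%:R in
  (Num.truncn (n%:R * (n%:R * D * (2 * (n%:R * D * (1 + 2 * D) + D) + 1)) * `|F 0| / eta)).+1.
pose code (m : nat) g := (m, path_code (q m) g).
pose ok (c : nat * seq 'M[int]_n) (g : R -> 'M[R]_n) :=
  semigroup_path S aa g c.1%:R /\ code c.1 g = c.
pose W (c : nat * seq 'M[int]_n) : set 'cV[R]_n :=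
  if pselect (exists g, ok c g) is left e then thin (projT1 (cid e)) else set0.
pose U (i : nat) : set 'cV[R]_n :=
  if unpickle i is Some c then ~` W c else setT.
have Ud i : open (U i) /\ dense (U i).
  rewrite /U; case: (unpickle i) => [c|]; last first.
    by split; [exact: openT|move=> O O0 _; rewrite setIT].
  rewrite /W; case: pselect => [e|_]; last first.
    by rewrite setC0; split; [exact: openT|move=> O O0 _; rewrite setIT].
  case: (cid e) => h /= [hp _].
  split; first by apply: closed_openC; exact: closed_closure.
  move=> O [x Ox] Oo; apply: contrapT => OW.
  suff : (thin h)° x.
    rewrite thin0 //; have t11 : 0 <= (1 : R) <= 1 by rewrite ler01 /=.
    by have [] := path_in hp t11.
  have Ot : O `<=` thin h.
    by move=> z Oz; apply: contrapT => zt; apply: OW; exists z.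
  by apply: (filterS Ot); exact: open_nbhs_nbhs.
rewrite -subset0 => v0 v0i.
have [v [vi vU]] := Baire Ud (ex_intro _ v0 v0i) (@open_interior _ _).
have [Q SQ vQ] := interior_subset vi.
have [g [D [gD g1]]] := Spath SQ.
pose m := (Num.truncn D).+1.
have gm : semigroup_path S aa g m%:R.
  by apply: path_const_le gD; apply/ltW; exact: truncnS_gt.
pose c := code m g.
have okg : ok c g by [].
have := vU (pickle c) I; rewrite /U pickleK /W.
case: pselect => [e|]; last by case; exists g.
case: (cid e) => h /= [hm hc] vW; apply: vW.
rewrite vQ -g1; apply: (euler aaG Ginv r0 FJ Freg Jreg tang gm hm _ etar).
move=> t t01.
have {}hc : path_code (q m) h = path_code (q m) g := congr1 snd hc.
have cl := path_code_close (isT : (0 < q m)%N) (esym hc) gm hm t01.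
have [_ uh ih _] := path_in hm t01.
have -> : invmx (h t) *m g t *m F 0 - F 0 = invmx (h t) *m (g t - h t) *m F 0.
  by rewrite mulmxBr mulVmx // mulmxBl mul1mx.
apply: le_trans (norm_mulmx_le (norm_mulmx_le ih cl) (lexx _)) _.
have qm0 : 0 < (q m)%:R :> R by rewrite ltr0n.
set A := 2 * _ + 1.
have -> : n%:R * (n%:R * m%:R * (A / (q m)%:R)) * `|F 0| =
  n%:R * (n%:R * m%:R * A) * `|F 0| / (q m)%:R by ring.
rewrite ler_pdivrMr // [leRHS]mulrC -ler_pdivrMr //.
by apply/ltW; rewrite /q; exact: truncnS_gt.
Qed.

(** Krener's theorem for a matrix semigroup, with no Lie bracket: a maximal
    chart is either of full dimension, and then it covers an open set, or it is
    tangent to the invariant space [conj_span], and then orbits are thin. *)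
Theorem krener (y : 'cV[R]_n) (c : R) : 1 < c ->
  (forall z P, small S c P -> P *m z = y -> (orbit_of z)° !=set0) ->
  exists Q : set 'cV[R]_n, [/\ open Q, Q !=set0 &
    forall z, Q z -> exists2 P, small S c P & P *m z = y].
Proof.
move=> c1 fat.
(* The starting bound 2 is arbitrary; the chart below uses a smaller bound, for
   which the span is the same. *)
have [c0 /andP[c01 _] [stab Ginv]] := conj_span_invariant MM SM SU Spath (ltr1n R 2 : 1 < 2).
have [k [d [c' [dc /andP[c'1 c'c0] [r1 /andP[r10 r1d] tang]]]]] :=
  maximal_chart S1 SM SU Scurve y c1 c01.
case: d dc r1d tang => F J P rho C dc /= r1rho tang.
have [/= rho0 FJ PJ Fy] := dc.
have [kn|nk] := ltnP k n; last first.
  have kn : k = n by apply/eqP; rewrite eqn_leq nk (chart_dim_le dc).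
  subst k.
  have [Q [Qo Q0] QF] := c11_open rho0 FJ PJ.
  exists Q; split => // z /QF[a ar <-]; exact: Fy.
have FJ1 : c11 r1 C F J.
  by move=> a b ar br; apply: FJ; [exact: le_trans r1rho|exact: le_trans r1rho].
have [r [r0 rr1 Freg Jreg]] := c11_regular r10 FJ1 PJ.
have FJr : c11 r C F J.
  by move=> a b ar br; apply: FJ1; [exact: le_trans rr1|exact: le_trans rr1].
have aaG : (aa <= conj_span S MM c0)%VS.
  apply: aaMM => X MX; apply: mem_set_span; exists 1%:M, X; split => //.
    by split => //; rewrite subrr /opn normr0 mulr0 subr_ge0 ltW.
  by rewrite /conj_by mul1mx invmx1 mulmx1.
have tangG a Y : `|a| <= r -> Y \in conj_span S MM c0 -> exists v, Y *m F a = J a *m v.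
  move=> ar; rewrite -(stab c'); last by rewrite c'1.
  pose U := (linfun (mulmxr (F a) : 'M[R]_n -> 'cV[R]_n) @^-1: limg (linfun (mulmx (J a) : 'cV[R]_k -> 'cV[R]_n)))%VS.
  have : (conj_span S MM c' <= U)%VS.
    apply: set_span_min => _ [Q [X [Qc MX ->]]].
    rewrite -memv_preim lfunE /=.
    have [v ->] := tang a Q X (le_trans ar rr1) Qc MX.
    by apply/memv_imgP; exists v; rewrite ?memvf // lfunE.
  move=> /subvP sub /sub; rewrite -memv_preim lfunE /= => /memv_imgP[v _ ->].
  by exists v; rewrite lfunE.
have thin := orbit_thin aaG Ginv r0 FJr Freg Jreg tangG kn.
have z0 : `|0 : 'cV[R]_k| <= rho by rewrite normr0 ltW.
have [Q Qc Qy] := Fy 0 z0.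
by have := fat _ _ Qc Qy; rewrite thin => -[].
Qed.

End Krener.

(** * Integrals of locally bounded functions *)

Section Integrals.
Variable R : realType.
Notation mu := (@lebesgue_measure R).
Implicit Types (f g : R -> R) (a b c : R).

Definition intg f a b : R := Rintegral mu `[a, b] f.

(** The integrands that occur: coefficients are bounded and measurable,
    trajectories continuous. *)
Definition locb f : Prop :=
  measurable_fun setT f /\ forall T, exists K, forall t, `|t| <= T -> `|f t| <= K.

Lemma locb_integrable f a b : locb f -> mu.-integrable `[a, b] (EFin \o f).
Proof.
move=> [mf bf]; apply: measurable_bounded_integrable.
- exact: measurable_itv.
- by rewrite /= lebesgue_measure_itv /=; case: ifP => // _; rewrite ltry.
- exact: measurable_funTS.
have [K fK] := bf (Num.max `|a| `|b|).
exists K; split; first exact: num_real.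
move=> x Kx t /=; rewrite in_itv /= => /andP[ta tb].
apply: le_trans (fK t _) (ltW Kx).
rewrite le_max; apply/orP; case: (leP 0 t) => t0.
  by right; rewrite ger0_norm // (le_trans tb) // ler_norm.
by left; rewrite ltr0_norm // ltr0_norm ?lerN2 //; exact: le_lt_trans t0.
Qed.

Lemma locb_add f g : locb f -> locb g -> locb (fun t => f t + g t).
Proof.
move=> [mf bf] [mg bg]; split; first exact: measurable_funD.
move=> T; have [K fK] := bf T; have [L gL] := bg T.
exists (K + L) => t tT; apply: le_trans (ler_normD _ _) _.
by rewrite lerD ?fK ?gL.
Qed.

Lemma locb_mul f g : locb f -> locb g -> locb (fun t => f t * g t).
Proof.
move=> [mf bf] [mg bg]; split; first exact: measurable_funM.
move=> T; have [K fK] := bf T; have [L gL] := bg T.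
by exists (K * L) => t tT; rewrite normrM ler_pM ?fK ?gL.
Qed.

Lemma locb_cst a : locb (fun=> a).
Proof. by split; [exact: measurable_cst|move=> T; exists `|a|]. Qed.

Lemma locb_sum (I : Type) (s : seq I) (F : I -> R -> R) :
  (forall i, locb (F i)) -> locb (fun t => \sum_(i <- s) F i t).
Proof.
move=> Fl; elim: s => [|i s IH].
  by under eq_fun do rewrite big_nil; exact: locb_cst.
by under eq_fun do rewrite big_cons; exact: locb_add.
Qed.

Lemma locb_continuous f : continuous f -> locb f.
Proof.
move=> cf; split; first exact: continuous_measurable_fun.
move=> T; case: (leP 0 T) => T0; last first.
  by exists 0 => t tT; have := normr_ge0 t; lra.
have cn : {within `[- T, T], continuous (fun x => `|f x|)}.
  apply: continuous_subspaceT => x; apply: continuous_comp; [exact: cf|exact: norm_continuous].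
have TT : - T <= T by lra.
have [c _ cmax] := EVT_max TT cn.
by exists `|f c| => t; rewrite ler_norml => tT; apply: cmax; rewrite in_itv.
Qed.

Lemma locb_shift f c : locb f -> locb (fun t => f (t + c)).
Proof.
move=> [mf bf]; split.
  by apply: measurableT_comp => //; exact: measurable_funD.
move=> T; have [K fK] := bf (T + `|c|); exists K => t tT; apply: fK.
by apply: le_trans (ler_normD _ _) _; rewrite lerD2r.
Qed.

Lemma intg_add f a b c : locb f -> a <= b -> b <= c ->
  intg f a c = intg f a b + intg f b c.
Proof.
move=> fl ab bc; rewrite /intg.
have := @Rintegral_itvB R f (BLeft a) (BRight c) b (locb_integrable _ _ fl).
rewrite !bnd_simp => /(_ ab bc) h.
apply/eqP; rewrite addrC -subr_eq h; apply/eqP.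
rewrite Rintegral_itv_obnd_cbnd //.
by apply: integrableS (locb_integrable b c fl) => //; apply: subset_itvr; rewrite bnd_simp.
Qed.

Lemma intgD f g a b : locb f -> locb g ->
  intg (fun t => f t + g t) a b = intg f a b + intg g a b.
Proof. by move=> fl gl; rewrite /intg RintegralD //; apply: locb_integrable. Qed.

Lemma intgZ f k a b : locb f -> intg (fun t => k * f t) a b = k * intg f a b.
Proof. by move=> fl; rewrite /intg RintegralZl //; apply: locb_integrable. Qed.

Lemma intg_sum (I : Type) (s : seq I) (F : I -> R -> R) a b :
  (forall i, locb (F i)) ->
  intg (fun t => \sum_(i <- s) F i t) a b = \sum_(i <- s) intg (F i) a b.
Proof.
move=> Fl; elim: s => [|i s IH].
  under [X in intg X]eq_fun do rewrite big_nil.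
  by rewrite big_nil /intg Rintegral_cst // mul0r.
under [X in intg X]eq_fun do rewrite big_cons.
by rewrite big_cons intgD ?IH //; exact: locb_sum.
Qed.

Lemma intg_cst k a b : a <= b -> intg (fun=> k) a b = k * (b - a).
Proof.
move=> ab; rewrite /intg Rintegral_cst //; congr (_ * _).
rewrite /= lebesgue_measure_itv /= lte_fin; case: ltP => [//|ba].
by have -> : b = a; [apply/eqP; rewrite eq_le ba ab|rewrite subrr].
Qed.

Lemma intg_le f g a b : locb f -> locb g ->
  (forall t, a <= t <= b -> f t <= g t) -> intg f a b <= intg g a b.
Proof.
move=> fl gl fg; apply: le_Rintegral; [exact: measurable_itv|exact: locb_integrable|exact: locb_integrable|].
by move=> t /=; rewrite in_itv; exact: fg.
Qed.

Lemma intg_norm_le f g a b : locb f -> locb g ->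
  (forall t, a <= t <= b -> `|f t| <= g t) -> `|intg f a b| <= intg g a b.
Proof.
move=> fl gl fg; rewrite ler_norml; apply/andP; split.
  have -> : - intg g a b = intg (fun t => -1 * g t) a b by rewrite intgZ // mulN1r.
  apply: intg_le => //; first by apply: locb_mul => //; exact: locb_cst.
  by move=> t /fg; rewrite ler_norml mulN1r => /andP[].
by apply: intg_le => // t /fg; rewrite ler_norml => /andP[].
Qed.

Lemma intg_ae f g a b : measurable_fun setT f -> measurable_fun setT g ->
  {ae mu, forall t, a <= t <= b -> f t = g t} -> intg f a b = intg g a b.
Proof.
move=> mf mg fg; rewrite /intg /Rintegral; congr fine.
apply: ae_eq_integral => //; [exact/measurable_EFinP/measurable_funTS|exact/measurable_EFinP/measurable_funTS|].
by apply: (@filterS _ _ (ae_filter_ringOfSetsType mu)) fg => t /= h; rewrite in_itv /= => /h ->.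
Qed.

Lemma intg_shift f c a b : locb f ->
  intg (fun t => f (t + c)) a b = intg f (a + c) (b + c).
Proof.
move=> fl; rewrite /intg /Rintegral; congr fine.
pose phi (t : R) : measurableTypeR R := t + c.
have mphi : measurable_fun setT (phi : measurableTypeR R -> measurableTypeR R).
  exact: measurable_funD.
have pre : phi @^-1` `[a + c, b + c] = `[a, b]%classic.
  by apply/seteqP; split => t; rewrite /phi /= !in_itv /= !lerD2r.
have [mf _] := fl.
have -> : (\int[mu]_(x in `[(a + c)%R, (b + c)%R]) (f x)%:E =
    \int[pushforward mu phi]_(x in `[(a + c)%R, (b + c)%R]) (f x)%:E)%E.
  apply: eq_measure_integral => A mA _.
  apply: lebesgue_measure_unique => // _ [[x y]] _ <-.
  rewrite /= /pushforward.
  have -> : phi @^-1` `]x, y] = `]x - c, y - c]%classic.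
    by apply/seteqP; split => t; rewrite /phi /= !in_itv /= ltrBlDr lerBrDr.
  rewrite !lebesgue_measure_itv /= !lte_fin ltrD2r; case: ifP => // _.
  by rewrite -!EFinB; congr EFin; ring.
have mEf : measurable_fun setT (EFin \o f : measurableTypeR R -> \bar R).
  exact/measurable_EFinP.
have int : mu.-integrable (phi @^-1` `[a + c, b + c]) ((EFin \o f) \o phi).
  by rewrite pre; exact: (locb_integrable a b (locb_shift c fl)).
have E := integral_pushforward mphi mEf int (measurable_itv _).
by rewrite pre in E; exact: esym E.
Qed.

Lemma intg_expR k a b : a <= b ->
  intg (fun t => k * expR (k * t)) a b = expR (k * b) - expR (k * a).
Proof.
rewrite le_eqVlt => /predU1P[->|ab].
  by rewrite subrr /intg set_itv1 Rintegral_set1.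
have cE : continuous (fun t : R => expR (k * t)).
  move=> x; apply: continuous_comp; last exact: continuous_expR.
  by apply: continuousM; [exact: cvg_cst|exact: cvg_id].
have dE (x : R) : is_derive x (1 : R) (fun t : R => expR (k * t)) (k * expR (k * x)).
  have -> : k * expR (k * x) = expR (k * x) * k by rewrite mulrC.
  apply: is_derive1_comp.
  by apply: is_derive_eq; rewrite -[RHS]mulr1.
rewrite /intg /Rintegral (@continuous_FTC2 _ _ (fun t => expR (k * t))) //.
- apply: continuous_subspaceT => x.
  by apply: cvgMl_tmp; exact: cE.
- split.
  + by move=> x _; have := dE x.
  + by apply: cvg_at_right_filter; exact: cE.
  + by apply: cvg_at_left_filter; exact: cE.
- by move=> x _; rewrite derive1E; apply: derive_val.
Qed.

End Integrals.

(** * Linear differential equations with bounded coefficients *)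

Section LinearSystems.
Variable R : realType.

Lemma geometric_limit (V : completeNormedModType R) (x : nat -> V) (K : R) :
  (forall m, `|x m.+1 - x m| <= K * (1 / 2) ^+ m) ->
  exists l, forall m, `|l - x m| <= 2 * K * (1 / 2) ^+ m.
Proof.
move=> xK.
have tail m k : `|x (m + k)%N - x m| <= 2 * K * (1 / 2) ^+ m * (1 - (1 / 2) ^+ k).
  elim: k => [|k IH]; first by rewrite addn0 subrr normr0 expr0 subrr mulr0.
  have -> : x (m + k.+1)%N - x m = (x (m + k).+1 - x (m + k)%N) + (x (m + k)%N - x m).
    by rewrite addnS addrA subrK.
  apply: le_trans (ler_normD _ _) _; apply: le_trans (lerD (xK _) IH) _.
  by rewrite exprD exprS le_eqVlt; apply/orP; left; apply/eqP; field.
have K0 : 0 <= K by have := le_trans (normr_ge0 _) (xK 0%N); rewrite expr0 mulr1.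
have h0 (m : nat) : 0 <= (1 / 2 : R) ^+ m by rewrite exprn_ge0.
have tail' m k : (m <= k)%N -> `|x k - x m| <= 2 * K * (1 / 2) ^+ m.
  move=> mk; rewrite -(subnKC mk); apply: le_trans (tail m _) _.
  rewrite ler_piMr // ?mulr_ge0 //; have := h0 (k - m)%N; lra.
have cx : cvg (x @ \oo).
  apply/cauchy_cvgP/cauchyP => e e0.
  have hc : (fun m : nat => 2 * K * (1 / 2) ^+ m) @ \oo --> 2 * K * 0.
    by apply: cvgMl_tmp; apply: cvg_expr; rewrite ger0_norm //; lra.
  rewrite mulr0 in hc.
  have /cvgrPdist_lt/(_ e e0) := hc.
  move=> [N _ /(_ N (leqnn N))]; rewrite /= sub0r normrN ger0_norm ?mulr_ge0 // => Ne.
  exists (x N); exists N => // m /= Nm; rewrite -ball_normE /= distrC.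
  exact: le_lt_trans (tail' N m Nm) Ne.
exists (lim (x @ \oo)) => m.
have : `|x k - x m| @[k --> \oo] --> `|lim (x @ \oo) - x m|.
  by apply: cvg_norm; apply: cvgB => //; exact: cvg_cst.
move=> /cvg_lim <- //; apply: limr_le.
  by apply: is_cvg_norm; apply: is_cvgB => //; exact: is_cvg_cst.
by exists m => // k /= mk; exact: tail'.
Qed.

Lemma le_geometric (x y K : R) : (forall m, x <= y + K * (1 / 2) ^+ m) -> x <= y.
Proof.
move=> h; apply/ler_addgt0Pr => e e0.
have hc : (fun m : nat => `|K| * (1 / 2) ^+ m) @ \oo --> `|K| * 0.
  by apply: cvgMl_tmp; apply: cvg_expr; rewrite ger0_norm //; lra.
rewrite mulr0 in hc; have /cvgrPdist_lt/(_ e e0) := hc.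
move=> [N _ /(_ N (leqnn N))]; rewrite /= sub0r normrN => Ne.
apply: le_trans (h N) _; rewrite lerD2l; apply: le_trans (ler_norm _) _.
rewrite normrM; rewrite normrM normr_id in Ne; exact: ltW.
Qed.

Definition locbm (n p : nat) (F : R -> 'M[R]_(n, p)) : Prop :=
  forall i j, locb (fun t => F t i j).

Definition mxint (n p : nat) (F : R -> 'M[R]_(n, p)) (a b : R) : 'M[R]_(n, p) :=
  \matrix_(i, j) intg (fun t => F t i j) a b.

Lemma locbm_mul (n p q : nat) (F : R -> 'M[R]_(n, p)) (G : R -> 'M[R]_(p, q)) :
  locbm F -> locbm G -> locbm (fun t => F t *m G t).
Proof.
move=> Fl Gl i j; under eq_fun do rewrite mxE.
by apply: locb_sum => k; apply: locb_mul.
Qed.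

Lemma locbm_cst (n p : nat) (C : 'M[R]_(n, p)) : locbm (fun=> C).
Proof. by move=> i j; exact: locb_cst. Qed.

Lemma locbm_continuous (n p : nat) (F : R -> 'M[R]_(n, p)) : continuous F -> locbm F.
Proof.
move=> cF i j; apply: locb_continuous => t.
by apply: (@continuous_comp _ _ _ F (fun A : 'M[R]_(n, p) => A i j)); [exact: cF|exact: coord_continuous].
Qed.

Lemma locbm_sub (n p : nat) (F G : R -> 'M[R]_(n, p)) : locbm F -> locbm G ->
  locbm (fun t => F t - G t).
Proof.
move=> Fl Gl i j; under eq_fun do rewrite !mxE -mulN1r.
by apply: locb_add => //; apply: locb_mul => //; exact: locb_cst.
Qed.

Lemma locbm_shift (n p : nat) (F : R -> 'M[R]_(n, p)) c : locbm F ->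
  locbm (fun t => F (t + c)).
Proof. by move=> Fl i j; exact: (locb_shift c (Fl i j)). Qed.

Lemma mxint_add (n p : nat) (F : R -> 'M[R]_(n, p)) a b c : locbm F ->
  a <= b -> b <= c -> mxint F a c = mxint F a b + mxint F b c.
Proof. by move=> Fl ab bc; apply/matrixP => i j; rewrite !mxE; exact: intg_add. Qed.

Lemma mxintB (n p : nat) (F G : R -> 'M[R]_(n, p)) a b : locbm F -> locbm G ->
  mxint (fun t => F t - G t) a b = mxint F a b - mxint G a b.
Proof.
move=> Fl Gl; apply/matrixP => i j; rewrite !mxE.
under [X in intg X]eq_fun do rewrite !mxE -mulN1r.
rewrite intgD ?intgZ ?mulN1r //; apply: locb_mul => //; exact: locb_cst.
Qed.

Lemma mxint_mulr (n p q : nat) (F : R -> 'M[R]_(n, p)) (C : 'M[R]_(p, q)) a b :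
  locbm F -> mxint (fun t => F t *m C) a b = mxint F a b *m C.
Proof.
move=> Fl; apply/matrixP => i j; rewrite !mxE.
under [X in intg X]eq_fun do rewrite mxE.
rewrite intg_sum => [|k]; last by apply: locb_mul => //; exact: locb_cst.
apply: eq_bigr => k _; rewrite mxE mulrC -intgZ //.
by congr intg; apply/funext => t; rewrite mulrC.
Qed.

Lemma mxint_shift (n p : nat) (F : R -> 'M[R]_(n, p)) c a b : locbm F ->
  mxint (fun t => F (t + c)) a b = mxint F (a + c) (b + c).
Proof. by move=> Fl; apply/matrixP => i j; rewrite !mxE; exact: (intg_shift c a b (Fl i j)). Qed.

Lemma mxint_norm_le (n p : nat) (F : R -> 'M[R]_(n, p)) g a b : locbm F -> locb g ->
  a <= b -> (forall t, a <= t <= b -> `|F t| <= g t) -> `|mxint F a b| <= intg g a b.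
Proof.
move=> Fl gl ab Fg; apply: mx_norm_le => [|i j].
  rewrite -[X in X <= _](_ : intg (fun=> 0) a b = 0); last by rewrite intg_cst // mul0r.
  by apply: intg_le => // [|t /Fg]; [exact: locb_cst|exact: le_trans].
rewrite mxE; apply: intg_norm_le => // t /Fg; apply: le_trans.
exact: entry_le_norm.
Qed.

Lemma mxint_bound (n p : nat) (F : R -> 'M[R]_(n, p)) K a b : locbm F ->
  a <= b -> (forall t, a <= t <= b -> `|F t| <= K) -> `|mxint F a b| <= K * (b - a).
Proof.
move=> Fl ab FK; rewrite -intg_cst //.
by apply: mxint_norm_le => //; exact: locb_cst.
Qed.

Lemma lip_continuous (n p : nat) (X : R -> 'M[R]_(n, p)) :
  (forall T, exists K, forall s t, - T <= s -> s <= t -> t <= T ->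
     `|X t - X s| <= K * (t - s)) -> continuous X.
Proof.
move=> lipX t; have [K XK] := lipX (`|t| + 1).
have K0 : 0 < `|K| + 1 by have := normr_ge0 K; lra.
apply/cvgrPdist_lt => e e0; near=> s.
have st : `|t - s| < 1 by near: s; apply: cvgr_dist_lt.
have st' : `|t - s| < e / (`|K| + 1).
  by near: s; apply: cvgr_dist_lt => //; rewrite divr_gt0.
have main (a b : R) : - (`|t| + 1) <= a -> a <= b -> b <= `|t| + 1 ->
    `|b - a| < e / (`|K| + 1) -> `|X b - X a| < e.
  move=> ha ab hb; rewrite ltr_pdivlMr // => h.
  apply: le_lt_trans (XK a b ha ab hb) _; apply: le_lt_trans h.
  have ba : 0 <= b - a by lra.
  rewrite (ger0_norm ba) mulrC ler_wpM2l //; have := ler_norm K; lra.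
have t1 := ler_norm t; have t2 := ler_norm (- t); rewrite normrN in t2.
move: st; rewrite ltr_norml => /andP[s1 s2].
case: (leP s t) => ts; first by apply: main => //; lra.
by rewrite distrC; apply: main; rewrite 1?distrC //; lra.
Unshelve. all: by end_near.
Qed.

Section System.
Variables (n : nat) (M : R -> 'M[R]_n) (L : R).
Hypothesis Mloc : locbm M.
Hypothesis ML : forall t, `|M t| <= L.

Definition lin_sol (p : nat) (a b : R) (X : R -> 'M[R]_(n, p)) : Prop :=
  continuous X /\ forall s t, a <= s -> s <= t -> t <= b ->
    X t - X s = mxint (fun r => M r *m X r) s t.

Lemma sys_bound_ge0 : 0 <= L.
Proof. exact: le_trans (ML 0). Qed.

Lemma lin_sol_incr p a b (X : R -> 'M[R]_(n, p)) K s t : lin_sol a b X ->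
  a <= s -> s <= t -> t <= b -> (forall r, s <= r <= t -> `|X r| <= K) ->
  `|X t - X s| <= n%:R * L * K * (t - s).
Proof.
move=> [cX iX] as_ st tb XK; rewrite iX //.
apply: mxint_bound => //; first by apply: locbm_mul => //; exact: locbm_continuous.
by move=> r rst; apply: norm_mulmx_le => //; exact: XK.
Qed.

Lemma lin_solB p a b (X Y : R -> 'M[R]_(n, p)) : lin_sol a b X -> lin_sol a b Y ->
  lin_sol a b (fun t => X t - Y t).
Proof.
move=> [cX iX] [cY iY]; split; first by move=> t; apply: cvgB; [exact: cX|exact: cY].
move=> s t as_ st tb.
have -> : X t - Y t - (X s - Y s) = (X t - X s) - (Y t - Y s) by zmx.
rewrite iX // iY // -mxintB; try by apply: locbm_mul => //; exact: locbm_continuous.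
by congr mxint; apply/funext => r; rewrite mulmxBr.
Qed.

Lemma mulmx_continuous (p q : nat) (X : R -> 'M[R]_(n, p)) (C : 'M[R]_(p, q)) :
  continuous X -> continuous (fun t => X t *m C).
Proof.
move=> cX t; have cX' := cX t.
have K0 : 0 < p%:R * `|C| + 1 by rewrite ltr_wpDl // mulr_ge0.
apply/cvgrPdist_lt => e e0; near=> s.
rewrite -mulmxBl; apply: le_lt_trans (norm_mulmx _ _) _.
have h : `|X t - X s| < e / (p%:R * `|C| + 1).
  by near: s; move/cvgrPdist_lt: cX'; apply; rewrite divr_gt0.
rewrite ltr_pdivlMr // in h; apply: le_lt_trans h.
have -> : p%:R * `|X t - X s| * `|C| = `|X t - X s| * (p%:R * `|C|) by ring.
by rewrite ler_wpM2l // lerDl.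
Unshelve. all: by end_near.
Qed.

Lemma lin_sol_mulr p q a b (X : R -> 'M[R]_(n, p)) (C : 'M[R]_(p, q)) :
  lin_sol a b X -> lin_sol a b (fun t => X t *m C).
Proof.
move=> [cX iX]; split; first exact: mulmx_continuous.
move=> s t as_ st tb; rewrite -mulmxBl iX // -mxint_mulr; last first.
  by apply: locbm_mul => //; exact: locbm_continuous.
by congr mxint; apply/funext => r; rewrite mulmxA.
Qed.

(** A solution at most doubles on an interval of length [1 / (2 n L)], in either
    direction of time: compare with its maximum over the interval. *)
Lemma lin_sol_double p a b (X : R -> 'M[R]_(n, p)) s t : lin_sol a b X ->
  a <= s <= b -> a <= t <= b -> n%:R * L * `|t - s| <= 1 / 2 ->
  `|X t| <= 2 * `|X s|.
Proof.
move=> sX /andP[as_ sb] /andP[at_ tb] hts.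
have L0 := sys_bound_ge0.
have nL0 : 0 <= n%:R * L by rewrite mulr_ge0.
pose u := Num.min s t; pose v := Num.max s t.
have uv : u <= v by rewrite /u /v; case: (leP s t) => //; exact: ltW.
have uvE : v - u = `|t - s|.
  rewrite /u /v; case: (leP s t) => st; first by rewrite ger0_norm // subr_ge0.
  by rewrite ltr0_norm ?opprB // subr_lt0.
have au : a <= u by rewrite le_min as_. have vb : v <= b by rewrite ge_max sb.
have [cX _] := sX.
have cn : {within `[u, v], continuous (fun x => `|X x|)}.
  apply: continuous_subspaceT => x; apply: continuous_comp; [exact: cX|exact: norm_continuous].
have [c] := EVT_max uv cn; rewrite in_itv /= => /andP[uc cv] cmax.
have cK r : u <= r -> r <= v -> `|X r| <= `|X c|.
  by move=> ur rv; apply: cmax; rewrite in_itv /= ur.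
have us : u <= s by rewrite ge_min lexx. have sv : s <= v by rewrite le_max lexx.
have ut : u <= t by rewrite ge_min lexx orbT. have tv : t <= v by rewrite le_max lexx orbT.
have half : `|X c - X s| <= 1 / 2 * `|X c|.
  apply: (@le_trans _ _ (n%:R * L * `|X c| * (v - u))); last first.
    by rewrite uvE mulrAC ler_wpM2r.
  have nLX : 0 <= n%:R * L * `|X c| by rewrite mulr_ge0.
  case: (leP s c) => sc.
    apply: (@le_trans _ _ (n%:R * L * `|X c| * (c - s))); last by rewrite ler_wpM2l //; lra.
    apply: (lin_sol_incr sX) => //; first exact: le_trans vb.
    by move=> r /andP[? ?]; apply: cK; lra.
  rewrite distrC.
  apply: (@le_trans _ _ (n%:R * L * `|X c| * (s - c))); last by rewrite ler_wpM2l //; lra.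
  apply: (lin_sol_incr sX) => //; [exact: le_trans uc|exact: ltW|].
  by move=> r /andP[? ?]; apply: cK; lra.
have := ler_normD (X c - X s) (X s); rewrite subrK.
by have := cK t ut tv; lra.
Qed.

(** The solution at most doubles on each of [N.+1] equal intervals. *)
Lemma lin_sol_growth p a b (X : R -> 'M[R]_(n, p)) s t N : lin_sol a b X ->
  a <= s <= b -> a <= t <= b -> n%:R * L * (b - a) <= N.+1%:R / 2 ->
  `|X t| <= 2 ^+ N.+1 * `|X s|.
Proof.
move=> sX sab tab hN.
have N0 : 0 < N.+1%:R :> R by rewrite ltr0n.
have L0 := sys_bound_ge0.
have nL0 : 0 <= n%:R * L by rewrite mulr_ge0.
pose x i := s + i%:R / N.+1%:R * (t - s).
have xab i : (i <= N.+1)%N -> a <= x i <= b.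
  move=> iN; have i0 : 0 <= i%:R / N.+1%:R :> R by rewrite divr_ge0.
  have i1 : i%:R / N.+1%:R <= 1 :> R by rewrite ler_pdivrMr // mul1r ler_nat.
  move: sab tab => /andP[s1 s2] /andP[t1 t2].
  rewrite /x; set c := i%:R / _ in i0 i1 *.
  have h1 : 0 <= (1 - c) * (s - a) by rewrite mulr_ge0 // subr_ge0.
  have h2 : 0 <= c * (t - a) by rewrite mulr_ge0 // subr_ge0.
  have h3 : 0 <= (1 - c) * (b - s) by rewrite mulr_ge0 // subr_ge0.
  have h4 : 0 <= c * (b - t) by rewrite mulr_ge0 // subr_ge0.
  by apply/andP; split; lra.
suff H i : (i <= N.+1)%N -> `|X (x i)| <= 2 ^+ i * `|X s|.
  have := H N.+1 (leqnn _); rewrite /x divff ?gt_eqF // mul1r.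
  by have -> : s + (t - s) = t by ring.
elim: i => [_|i IH iN]; first by rewrite /x mul0r mul0r addr0 expr0 mul1r.
rewrite exprS -mulrA; apply: (@le_trans _ _ (2 * `|X (x i)|)); last first.
  by rewrite ler_wpM2l // IH // ltnW.
apply: (lin_sol_double sX); [exact: xab (ltnW iN)|exact: xab|].
have -> : x i.+1 - x i = (t - s) / N.+1%:R.
  by rewrite /x -[i.+1%:R]natr1; ring.
rewrite normrM (gtr0_norm (_ : 0 < N.+1%:R^-1)) ?invr_gt0 // mulrA ler_pdivrMr //.
apply: le_trans (_ : n%:R * L * (b - a) <= _); last by apply: le_trans hN _; rewrite div1r mulrC.
rewrite ler_wpM2l // ler_norml; move: sab tab => /andP[s1 s2] /andP[t1 t2].
by apply/andP; split; lra.
Qed.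

Lemma growth_steps (c : R) : exists N, n%:R * L * c <= N.+1%:R / 2.
Proof.
exists (Num.truncn (n%:R * L * c * 2)); rewrite ler_pdivlMr //.
by apply/ltW; exact: truncnS_gt.
Qed.

Lemma lin_sol_uniq p a b (X Y : R -> 'M[R]_(n, p)) s t : lin_sol a b X ->
  lin_sol a b Y -> a <= s <= b -> a <= t <= b -> X s = Y s -> X t = Y t.
Proof.
move=> sX sY sab tab XYs; have [N hN] := growth_steps (b - a).
have := lin_sol_growth (lin_solB sX sY) sab tab hN.
by rewrite XYs subrr normr0 mulr0 normr_le0 subr_eq0 => /eqP.
Qed.

(** Picard iteration; the weight [expR (2 * W * |t|)] makes it contract by half
    on the whole line at once. *)
Let J (F : R -> 'M[R]_n) (t : R) : 'M[R]_n :=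
  if 0 <= t then mxint F 0 t else - mxint F t 0.

Lemma primitive_diff F a b : locbm F -> a <= b -> J F b - J F a = mxint F a b.
Proof.
move=> Fl ab; rewrite /J; case: (leP 0 a) => a0.
  rewrite (le_trans a0 ab) (mxint_add Fl a0 ab); zmx.
case: (leP 0 b) => b0.
  by rewrite (mxint_add Fl (ltW a0) b0); zmx.
by rewrite (mxint_add Fl ab (ltW b0)); zmx.
Qed.

Lemma lin_sol_exists : exists X : R -> 'M[R]_n, X 0 = 1%:M /\
  forall a b, lin_sol a b X.
Proof.
have L0 := sys_bound_ge0.
pose W := n%:R * L; have W0 : 0 <= W by rewrite mulr_ge0.
pose E (t : R) := expR (2 * W * `|t|).
have E0 t : 0 <= E t by exact: expR_ge0.
have E1 t : 1 <= E t by rewrite -expR0 ler_expR !mulr_ge0.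
have Emono (s t : R) : `|s| <= `|t| -> E s <= E t.
  by move=> st; rewrite ler_expR ler_wpM2l // mulr_ge0.
have cexp k : continuous (fun t : R => expR (k * t)).
  by move=> x; apply: continuous_comp; [apply: cvgMl_tmp; exact: cvg_id|exact: continuous_expR].
have JE F K t : locbm F -> 0 <= K -> (forall s, `|F s| <= K * E s) ->
    `|J (fun s => M s *m F s) t| <= 2^-1 * K * E t.
  move=> Fl K0 FK.
  have MFl : locbm (fun s => M s *m F s) by exact: locbm_mul.
  have MF s : `|M s *m F s| <= W * K * E s.
    by rewrite -[W * K * E s]mulrA; exact: norm_mulmx_le.
  rewrite /J; case: (leP 0 t) => t0.
    have gl : locb (fun s => 2^-1 * K * (2 * W * expR (2 * W * s))).
      apply: locb_mul; first exact: locb_cst.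
      by apply: locb_mul; [exact: locb_cst|apply: locb_continuous; exact: cexp].
    apply: le_trans (mxint_norm_le MFl gl t0 _) _.
      move=> s /andP[s0 _]; apply: le_trans (MF s) _.
      by rewrite /E ger0_norm // le_eqVlt; apply/orP; left; apply/eqP; field.
    rewrite intgZ; last by apply: locb_mul; [exact: locb_cst|apply: locb_continuous; exact: cexp].
    rewrite intg_expR // mulr0 expR0 ler_wpM2l ?mulr_ge0 ?invr_ge0 // /E ger0_norm //.
    by rewrite lerBlDr lerDl.
  rewrite normrN.
  have gl : locb (fun s => - 2^-1 * K * (- (2 * W) * expR (- (2 * W) * s))).
    apply: locb_mul; first exact: locb_cst.
    by apply: locb_mul; [exact: locb_cst|apply: locb_continuous; exact: cexp].
  apply: le_trans (mxint_norm_le MFl gl (ltW t0) _) _.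
    move=> s /andP[_ s0]; apply: le_trans (MF s) _.
    rewrite /E ler0_norm // (_ : 2 * W * - s = - (2 * W) * s); last by ring.
    by rewrite le_eqVlt; apply/orP; left; apply/eqP; field.
  rewrite intgZ; last by apply: locb_mul; [exact: locb_cst|apply: locb_continuous; exact: cexp].
  rewrite intg_expR ?(ltW t0) // mulr0 expR0 /E (ltr0_norm t0) mulrN -mulNr.
  have -> : - 2^-1 * K * (1 - expR (- (2 * W) * t)) = 2^-1 * K * (expR (- (2 * W) * t) - 1).
    by ring.
  by rewrite ler_wpM2l ?mulr_ge0 ?invr_ge0 // lerBlDr lerDl.
pose X := fix X (m : nat) : R -> 'M[R]_n :=
  if m is m'.+1 then fun t => 1%:M + J (fun s => M s *m X m' s) t else fun=> 0.
have Xc m : locbm (X m).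
  elim: m => [|m IH] /=; first exact: locbm_cst.
  apply: locbm_continuous; apply: lip_continuous => T.
  have MXl : locbm (fun s => M s *m X m s) by exact: locbm_mul.
  have [K XK] : exists K, forall t, `|t| <= T -> `|M t *m X m t| <= K.
    pose f t := \sum_(i < n) \sum_(j < n) `|(M t *m X m t) i j|.
    have fl : locb f.
      apply: locb_sum => i; apply: locb_sum => j; have [h1 h2] := MXl i j; split.
        by apply: measurableT_comp => //; exact: normr_measurable.
      by move=> T'; have [K hK] := h2 T'; exists K => t tT; rewrite normr_id; exact: hK.
    have [K fK] := fl.2 T; exists K => t tT; apply: le_trans (fK t tT).
    apply: le_trans (ler_norm _).
    apply: mx_norm_le => [|i j]; first by apply: sumr_ge0 => i _; exact: sumr_ge0.
    rewrite /f (bigD1 i) //= (bigD1 j) //= -addrA lerDl addr_ge0 //.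
      exact: sumr_ge0.
    by apply: sumr_ge0 => ? _; exact: sumr_ge0.
  exists K => s t Ts st tT.
  have -> : forall a b : 'M[R]_n, 1%:M + a - (1%:M + b) = a - b by move=> a b; zmx.
  rewrite primitive_diff //; apply: mxint_bound => // r /andP[sr rt].
  by apply: XK; rewrite ler_norml; apply/andP; split; lra.
have XD m t : `|X m.+1 t - X m t| <= E t * (1 / 2) ^+ m.
  elim: m t => [|m IH] t.
    rewrite /= subr0 expr0 mulr1.
    have -> : J (fun s => M s *m 0) t = 0.
      have z0 a b : mxint (fun s => M s *m (0 : 'M[R]_n)) a b = 0.
        apply/matrixP => i j; rewrite !mxE.
        under [Z in intg Z]eq_fun do rewrite mulmx0 mxE.
        by rewrite /intg Rintegral_cst // mul0r.
      by rewrite /J !z0 oppr0; case: ifP.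
    by rewrite addr0; apply: le_trans (norm1_mx_le _ _) _.
  have -> : X m.+2 t - X m.+1 t = J (fun s => M s *m (X m.+1 s - X m s)) t.
    have -> : X m.+2 t - X m.+1 t =
        J (fun s => M s *m X m.+1 s) t - J (fun s => M s *m X m s) t.
      by rewrite /=; move: (J _ t) (J _ t) => a b; zmx.
    have e : (fun s => M s *m (X m.+1 s - X m s)) =
             (fun s => M s *m X m.+1 s - M s *m X m s).
      by apply/funext => s; rewrite mulmxBr.
    by rewrite e /J; case: ifP => _; rewrite mxintB; try exact: locbm_mul; zmx.
  apply: le_trans (JE _ ((1 / 2) ^+ m) t (locbm_sub (Xc _) (Xc _)) _ _) _.
  - by rewrite exprn_ge0.
  - by move=> s; rewrite mulrC; exact: IH.
  by rewrite exprS le_eqVlt; apply/orP; left; apply/eqP; field.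
have lim t := geometric_limit (fun m => XD m t).
pose P t := projT1 (cid (lim t)).
have PX t m : `|P t - X m t| <= 2 * E t * (1 / 2) ^+ m by rewrite /P; case: cid => l /=.
have PE t : `|P t| <= 2 * E t.
  by have := PX t 0%N; rewrite /= subr0 expr0 mulr1.
have XE m t : `|X m t| <= 4 * E t.
  have := PX t m; have := PE t => h1 h2.
  have -> : X m t = P t - (P t - X m t) by zmx.
  apply: le_trans (ler_normB _ _) _.
  have : (1 / 2) ^+ m <= 1 :> R by rewrite exprn_ile1 //; lra.
  have : 0 <= (1 / 2) ^+ m :> R by rewrite exprn_ge0.
  have := E0 t; nra.
have Xstep m a b : a <= b -> X m.+1 b - X m.+1 a = mxint (fun s => M s *m X m s) a b.
  move=> ab; rewrite -primitive_diff //; last exact: locbm_mul.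
  by rewrite /=; move: (J _ b) (J _ a) => u v; zmx.
have cP : continuous P.
  apply: lip_continuous => T; exists (W * (4 * E T)) => s t Ts st tT.
  have ET r : s <= r <= t -> E r <= E T.
    move=> /andP[sr rt]; apply: Emono; rewrite (ger0_norm (_ : 0 <= T)); last by lra.
    by rewrite ler_norml; apply/andP; split; lra.
  apply: (@le_geometric _ _ (2 * E T + 2 * E T)) => m.
  have -> : P t - P s = (X m.+1 t - X m.+1 s) + ((P t - X m.+1 t) - (P s - X m.+1 s)) by zmx.
  apply: le_trans (ler_normD _ _) _; apply: lerD.
    rewrite Xstep //; apply: mxint_bound => //; first exact: locbm_mul.
    move=> r rst; apply: norm_mulmx_le => //; apply: le_trans (XE m r) _.
    by rewrite ler_wpM2l // ET.
  apply: le_trans (ler_normB _ _) _; rewrite mulrDl.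
  have h r : s <= r <= t -> `|P r - X m.+1 r| <= 2 * E T * (1 / 2) ^+ m.
    move=> rst; apply: le_trans (PX r m.+1) _.
    have := ET r rst; have : 0 <= (1 / 2) ^+ m :> R by rewrite exprn_ge0.
    rewrite exprS; have := E0 r; nra.
  by apply: lerD; apply: h; rewrite lexx ?st.
exists P; split.
  apply/eqP; rewrite -subr_eq0 -normr_le0; apply: (@le_geometric _ _ (2 * E 0)) => m.
  rewrite add0r; have := PX 0 m.+1.
  have -> : X m.+1 0 = 1%:M.
    rewrite /= /J lexx; have -> : mxint (fun s => M s *m X m s) 0 0 = 0.
      by apply/matrixP => i j; rewrite !mxE /intg set_itv1 Rintegral_set1.
    by rewrite addr0.
  move=> h; apply: le_trans h _.
  rewrite exprS; have := E0 0; have : 0 <= (1 / 2) ^+ m :> R by rewrite exprn_ge0.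
  nra.
move=> a b; split => // s t _ st _.
apply/eqP; rewrite -subr_eq0 -normr_le0.
pose T := Num.max `|s| `|t|.
have ET r : s <= r <= t -> E r <= E T.
  move=> /andP[sr rt]; apply: Emono.
  rewrite (ger0_norm (_ : 0 <= T)); last by rewrite le_max normr_ge0.
  rewrite le_max; apply/orP; case: (leP 0 r) => r0.
    by right; rewrite ger0_norm // (le_trans rt) // ler_norm.
  by left; rewrite ltr0_norm // ltr0_norm ?lerN2 //; exact: le_lt_trans r0.
apply: (@le_geometric _ _ (4 * E T + W * (2 * E T) * (t - s))) => m; rewrite add0r.
have hm : 0 <= (1 / 2) ^+ m :> R by rewrite exprn_ge0.
have -> : P t - P s - mxint (fun r => M r *m P r) s t =
  ((P t - X m.+1 t) - (P s - X m.+1 s)) - mxint (fun r => M r *m (P r - X m r)) s t.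
  have -> : mxint (fun r => M r *m (P r - X m r)) s t =
      mxint (fun r => M r *m P r) s t - (X m.+1 t - X m.+1 s).
    rewrite Xstep // -mxintB; try by apply: locbm_mul => //; exact: locbm_continuous.
    by congr mxint; apply/funext => r; rewrite mulmxBr.
  by zmx.
apply: le_trans (ler_normB _ _) _; rewrite mulrDl; apply: lerD.
  apply: le_trans (ler_normB _ _) _.
  have h r : s <= r <= t -> `|P r - X m.+1 r| <= 2 * E T * (1 / 2) ^+ m.
    move=> rst; apply: le_trans (PX r m.+1) _.
    have := ET r rst; rewrite exprS; have := E0 r; nra.
  have -> : 4 * E T * (1 / 2) ^+ m = 2 * E T * (1 / 2) ^+ m + 2 * E T * (1 / 2) ^+ m by ring.
  by apply: lerD; apply: h; rewrite lexx ?st.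
have -> : W * (2 * E T) * (t - s) * (1 / 2) ^+ m = W * (2 * E T * (1 / 2) ^+ m) * (t - s) by ring.
apply: mxint_bound => //.
  by apply: locbm_mul => //; apply: locbm_sub => //; exact: locbm_continuous.
move=> r rst; apply: norm_mulmx_le => //; apply: le_trans (PX r m) _.
by rewrite ler_wpM2r // ler_wpM2l // ET.
Qed.

End System.
End LinearSystems.

(** * Fundamental matrices *)

Section Fundamental.
Variables (R : realType) (n : nat).

Lemma mxint_ae p (F G : R -> 'M[R]_(n, p)) a b : locbm F -> locbm G ->
  {ae @lebesgue_measure R, forall t, a <= t <= b -> F t = G t} ->
  mxint F a b = mxint G a b.
Proof.
move=> Fl Gl FG; apply/matrixP => i j; rewrite !mxE.
apply: intg_ae; [exact: (Fl i j).1|exact: (Gl i j).1|].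
by apply: (@filterS _ _ (ae_filter_ringOfSetsType _)) FG => t h /h ->.
Qed.

Definition fundamental (M X : R -> 'M[R]_n) : Prop :=
  X 0 = 1%:M /\ forall a b, lin_sol M a b X.

Lemma lin_sol_shift (M : R -> 'M[R]_n) p a b (X : R -> 'M[R]_(n, p)) c :
  locbm M -> lin_sol M a b X ->
  lin_sol (fun t => M (t + c)) (a - c) (b - c) (fun t => X (t + c)).
Proof.
move=> Ml [cX iX]; split.
  move=> t; apply: (@continuous_comp _ _ _ (fun s : R => s + c) X); last exact: cX.
  by apply: cvgD; [exact: cvg_id|exact: cvg_cst].
move=> s t as_ st tb; rewrite iX ?lerD2r //; [|lra|lra].
by rewrite -mxint_shift //; apply: locbm_mul => //; exact: locbm_continuous.
Qed.

Lemma lin_sol_ae (M M' : R -> 'M[R]_n) p a b (X : R -> 'M[R]_(n, p)) :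
  locbm M -> locbm M' ->
  {ae @lebesgue_measure R, forall t, a <= t <= b -> M t = M' t} ->
  lin_sol M a b X -> lin_sol M' a b X.
Proof.
move=> Ml M'l MM' [cX iX]; split=> // s t as_ st tb; rewrite iX //.
have Xl := locbm_continuous cX.
apply: mxint_ae; [exact: locbm_mul|exact: locbm_mul|].
apply: (@filterS _ _ (ae_filter_ringOfSetsType _)) MM' => r h /andP[sr rt].
by rewrite h //; apply/andP; split; lra.
Qed.

Section Bounded.
Variables (M X : R -> 'M[R]_n) (L : R).
Hypothesis Ml : locbm M.
Hypothesis ML : forall t, `|M t| <= L.
Hypothesis FX : fundamental M X.

Lemma zero_sol p a b : lin_sol M a b (fun=> 0 : 'M[R]_(n, p)).
Proof.
split=> [|s t _ st _]; first by move=> t; exact: cvg_cst.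
rewrite subrr; apply/matrixP => i j; rewrite !mxE.
under [X in intg X]eq_fun do rewrite mulmx0 mxE.
by rewrite intg_cst // mul0r.
Qed.

Lemma fundamental_flow p T (Y : R -> 'M[R]_(n, p)) t : lin_sol M 0 T Y ->
  0 <= t <= T -> Y t = X t *m Y 0.
Proof.
move=> sY tT; have [X0 sX] := FX.
have z0 : 0 <= (0 : R) <= T by move: tT => /andP[t0 tT]; rewrite lexx (le_trans t0).
apply: (lin_sol_uniq Ml ML sY (lin_sol_mulr Ml (Y 0) (sX 0 T)) z0 tT).
by rewrite X0 mul1mx.
Qed.

Lemma fundamental_flowT p (Y : R -> 'M[R]_(n, p)) t : (forall a b, lin_sol M a b Y) ->
  Y t = X t *m Y 0.
Proof.
move=> sY; have [X0 sX] := FX.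
have h s : `|s| <= `|t| -> - `|t| <= s <= `|t| by rewrite ler_norml.
apply: (lin_sol_uniq Ml ML (sY _ _) (lin_sol_mulr Ml (Y 0) (sX _ _)) (h 0 _) (h t _)).
- by rewrite normr0.
- by [].
- by rewrite X0 mul1mx.
Qed.

Lemma fundamental_unit t : X t \in unitmx.
Proof.
have [X0 sX] := FX; apply: unitmx_inj => v Xv.
have h s : `|s| <= `|t| -> - `|t| <= s <= `|t| by rewrite ler_norml.
have := lin_sol_uniq Ml ML (lin_sol_mulr Ml v (sX _ _)) (zero_sol 1 _ _)
  (h t (lexx _)) (h 0 _) Xv.
by rewrite X0 mul1mx; apply; rewrite normr0.
Qed.

Lemma fundamental_shift c : fundamental (fun t => M (t + c))
  (fun t => X (t + c) *m invmx (X c)).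
Proof.
have [X0 sX] := FX; split; first by rewrite add0r mulmxV // fundamental_unit.
move=> a b; apply: lin_sol_mulr; first exact: locbm_shift.
have := lin_sol_shift c Ml (sX (a + c) (b + c)); by rewrite !addrK.
Qed.

(** On a bounded interval growth is controlled in both directions of time, whence
    the bound on the inverse; the second-order estimate is the integral equation
    applied twice. *)
Lemma fundamental_incr T : 0 <= T -> exists C, forall s t,
  - T <= s -> s <= t -> t <= T ->
  [/\ `|invmx (X s)| <= C, `|X s| <= C, `|mxint M s t| <= C * (t - s),
      `|X t - X s| <= C * (t - s) &
      `|X t - X s - mxint M s t *m X s| <= C * (t - s) ^+ 2].
Proof.
move=> T0; have [X0 sX] := FX.
have L0 : 0 <= L by exact: le_trans (ML 0).
have [N hN] := growth_steps n L (T - - T).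
pose K : R := 2 ^+ N.+1; have K0 : 0 <= K by rewrite exprn_ge0.
pose D := n%:R * L * K; have D0 : 0 <= D by rewrite !mulr_ge0.
have z0 : - T <= 0 <= T by apply/andP; split; lra.
have XK s : - T <= s <= T -> `|X s| <= K.
  move=> sT; apply: le_trans (lin_sol_growth Ml ML (sX _ _) z0 sT hN) _.
  by rewrite X0 -[leRHS]mulr1 ler_wpM2l // norm1_mx_le.
have XD s t : - T <= s -> s <= t -> t <= T -> `|X t - X s| <= D * (t - s).
  move=> Ts st tT; apply: (lin_sol_incr Ml ML (sX _ _) Ts st tT) => r /andP[sr rt].
  by apply: XK; apply/andP; split; lra.
have XI s : - T <= s <= T -> `|invmx (X s)| <= K.
  move=> sT.
  have := lin_sol_growth Ml ML (lin_sol_mulr Ml (invmx (X s)) (sX _ _)) sT z0 hN.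
  rewrite X0 mul1mx mulmxV ?fundamental_unit // => h; apply: le_trans h _.
  by rewrite -[leRHS]mulr1 ler_wpM2l // norm1_mx_le.
exists (K + L + D + n%:R * L * D) => s t Ts st tT.
have nLD : 0 <= n%:R * L * D by rewrite !mulr_ge0.
have sT : - T <= s <= T by apply/andP; split; lra.
have ts0 : 0 <= t - s by lra.
split.
- by apply: le_trans (XI s sT) _; lra.
- by apply: le_trans (XK s sT) _; lra.
- apply: le_trans (mxint_bound Ml st (fun r _ => ML r)) _; rewrite ler_wpM2r //; lra.
- by apply: le_trans (XD s t Ts st tT) _; rewrite ler_wpM2r //; lra.
have [cX iX] := sX (- T) T.
have Xl := locbm_continuous cX.
have -> : X t - X s - mxint M s t *m X s = mxint (fun r => M r *m (X r - X s)) s t.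
  have -> : (fun r => M r *m (X r - X s)) = (fun r => M r *m X r - M r *m X s).
    by apply/funext => r; rewrite mulmxBr.
  rewrite mxintB; [|exact: locbm_mul|by apply: locbm_mul => //; exact: locbm_cst].
  by rewrite mxint_mulr // -iX.
apply: (@le_trans _ _ (n%:R * L * (D * (t - s)) * (t - s))).
  apply: mxint_bound => //.
    by apply: locbm_mul => //; apply: locbm_sub => //; exact: locbm_cst.
  move=> r /andP[sr rt]; apply: norm_mulmx_le => //.
  apply: le_trans (XD s r Ts sr _) _; first lra.
  by rewrite ler_wpM2l //; lra.
have -> : n%:R * L * (D * (t - s)) * (t - s) = n%:R * L * D * (t - s) ^+ 2 by ring.
by rewrite ler_wpM2r ?sqr_ge0 //; lra.
Qed.

End Bounded.
End Fundamental.

(** * Transition matrices of the control system *)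

Section ControlSystem.
Variables (R : realType) (n m : nat) (A : 'M[R]_n) (B : 'I_m -> 'M[R]_n).
Variable Omega : set 'cV[R]_m.

(** A representative in the class of an admissible control that is bounded and
    takes its values in [Omega] everywhere, not only almost everywhere. *)
Definition nice (u : R -> 'cV[R]_m) : Prop :=
  [/\ forall i, measurable_fun setT (fun t => u t i 0),
      exists K, forall t, `|u t| <= K & forall t, Omega (u t)].

Definition sysmx (u : R -> 'cV[R]_m) (t : R) : 'M[R]_n := bilinear_mx A B (u t).

Lemma sysmxE u t i j : sysmx u t i j = A i j + \sum_(k < m) u t k 0 * B k i j.
Proof. by rewrite !mxE summxE; congr (_ + _); apply: eq_bigr => k _; rewrite mxE. Qed.

Lemma nice_locb u : nice u -> locbm (sysmx u).
Proof.
move=> [mu [K uK] _] i j; under eq_fun do rewrite sysmxE.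
apply: locb_add; first exact: locb_cst.
apply: locb_sum => k; apply: locb_mul; last exact: locb_cst.
split=> // T; exists K => t _; exact: le_trans (entry_le_norm _ _ _) (uK t).
Qed.

Lemma nice_bounded u : nice u -> exists L, forall t, `|sysmx u t| <= L.
Proof.
move=> [_ [K uK] _]; have K0 : 0 <= K by exact: le_trans (uK 0).
exists (`|A| + \sum_(k < m) K * `|B k|) => t.
apply: le_trans (ler_normD _ _) _; rewrite lerD2l.
apply: le_trans (ler_norm_sum _ _ _) _; apply: ler_sum => k _.
rewrite normrZ ler_wpM2r //; exact: le_trans (entry_le_norm _ _ _) (uK t).
Qed.

Lemma nice_cst w : Omega w -> nice (fun=> w).
Proof. by move=> Ow; split => //; exists `|w|. Qed.

Lemma nice_shift u c : nice u -> nice (fun t => u (t + c)).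
Proof.
move=> [mu [K uK] Ou]; split => //; last by exists K.
by move=> i; apply: (measurableT_comp (mu i)); exact: measurable_funD.
Qed.

Definition concat_control (T : R) (u v : R -> 'cV[R]_m) (t : R) : 'cV[R]_m :=
  if t <= T then u t else v (t - T).

Lemma nice_concat T u v : nice u -> nice v -> nice (concat_control T u v).
Proof.
move=> [mu [K uK] Ou] [mv [K' vK] Ov]; split.
- move=> i; rewrite /concat_control.
  under eq_fun do rewrite (fun_if (fun w : 'cV[R]_m => w i 0)).
  apply: measurable_fun_ifT => //.
  + exact: measurable_fun_ler.
  + by apply: (measurableT_comp (mv i)); exact: measurable_funB.
- exists (Num.max K K') => t; rewrite /concat_control; case: ifP => _.
    by rewrite le_max uK.
  by rewrite le_max vK orbT.
- by move=> t; rewrite /concat_control; case: ifP.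
Qed.

Lemma nice_admissible u : nice u -> admissible Omega u.
Proof.
move=> [mu [K uK] Ou]; split; last exact: aeW.
move=> i; apply/andP; split; first by rewrite inE; exact: mu.
rewrite inE /= /finite_norm unlock /Lnorm; case: ifP => // _.
apply: (@le_lt_trans _ _ K%:E); last exact: ltry.
apply/ess_supP; apply: aeW => t /=; rewrite lee_fin.
exact: le_trans (entry_le_norm _ _ _) (uK t).
Qed.

Lemma lebesgue_setT_gt0 : (0 < @lebesgue_measure R setT)%E.
Proof.
apply: (@lt_le_trans _ _ (@lebesgue_measure R `[0, 1])).
  by rewrite lebesgue_measure_itv /= lte_fin ltr01 -EFinB subr0 lte_fin.
by apply: le_measure; rewrite ?inE.
Qed.

(** Redefine the control on a null set, giving it there its value at a good time. *)
Lemma admissible_nice u : admissible Omega u ->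
  exists2 v, nice v & {ae @lebesgue_measure R, forall t, u t = v t}.
Proof.
move=> [uL uO].
have um i : measurable_fun setT (fun t => u t i 0).
  by have /andP[] := uL i; rewrite inE.
have uB i : exists K, {ae @lebesgue_measure R, forall t, `|u t i 0| <= K}.
  have /andP[_] := uL i; rewrite inE /= /finite_norm unlock /Lnorm lebesgue_setT_gt0.
  have -> : abse \o (EFin \o (fun t => u t i 0)) = EFin \o (fun t => `|u t i 0|) by [].
  by move=> /ess_supr_bounded[K hK]; exists K.
have [K KB] := choice uB.
pose good t := Omega (u t) /\ forall i, `|u t i 0| <= K i.
have gae : {ae @lebesgue_measure R, forall t, good t}.
  have F := ae_filter_ringOfSetsType (@lebesgue_measure R).
  apply: filterI => //.
  exact: (@filter_forall _ _ (fun i t => `|u t i 0| <= K i) _ F KB).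
have [Z [mZ Z0 Zg]] := gae.
have [t0 Zt0] : exists t0, ~ Z t0.
  apply: contrapT => h; have ZT : Z = setT.
    by apply/seteqP; split => // t _; apply: contrapT => Zt; apply: h; exists t.
  by have := lebesgue_setT_gt0; rewrite -ZT Z0 ltxx.
have gZ t : ~ Z t -> good t by move=> Zt; apply: contrapT => h; apply: Zt; exact: Zg.
exists (fun t => if t \in Z then u t0 else u t).
  have gv t : good (if t \in Z then t0 else t).
    by case: ifPn => [_|]; [exact: gZ|rewrite notin_setE; exact: gZ].
  split.
  - move=> i; under eq_fun do rewrite (fun_if (fun w : 'cV[R]_m => w i 0)).
    apply: measurable_fun_ifT => //.
    apply: (measurable_fun_bool true); rewrite setTI.
    have -> : (fun t => t \in Z) @^-1` [set true] = Z; last exact: mZ.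
    by apply/seteqP; split => t; [exact: set_mem|exact: mem_set].
  - exists (\sum_i `|K i|) => t; apply: mx_norm_le => [|i j]; first exact: sumr_ge0.
    rewrite ord1 -(fun_if u); apply: le_trans ((gv t).2 i) _.
    rewrite (bigD1 i) //=; apply: le_trans (ler_norm _) _; rewrite lerDl.
    exact: sumr_ge0.
  - by move=> t; rewrite -(fun_if u); exact: (gv t).1.
exists Z; split => // t /= h; apply: contrapT => Zt; apply: h.
by rewrite ifN // notin_setE.
Qed.

(** Solutions do not see null sets, so a regular representative has the same ones. *)
Lemma bilinear_solP u v x p : admissible Omega u -> nice v ->
  {ae @lebesgue_measure R, forall t, u t = v t} ->
  bilinear_sol A B u x p <-> p 0 = x /\ forall a b, lin_sol (sysmx v) a b p.
Proof.
move=> [uL _] nv uv.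
have um i : measurable_fun setT (fun t => u t i 0).
  by have /andP[] := uL i; rewrite inE.
have vl := nice_locb nv.
have key a b i : continuous p ->
    Rintegral (@lebesgue_measure R) `[a, b] (fun t => (bilinear_mx A B (u t) *m p t) i 0)
    = mxint (fun t => sysmx v t *m p t) a b i 0.
  move=> cp; rewrite mxE; apply: (@intg_ae _ (fun t => (sysmx u t *m p t) i 0)).
  - under eq_fun do rewrite mxE; apply: measurable_sum => k.
    apply: measurable_funM; last by have [] := locbm_continuous cp k 0.
    under eq_fun do rewrite sysmxE; apply: measurable_funD => //.
    by apply: measurable_sum => l; apply: measurable_funM.
  - by have [] := locbm_mul vl (locbm_continuous cp) i 0.
  - apply: (@filterS _ _ (ae_filter_ringOfSetsType _)) uv => t uvt _.
    by rewrite /sysmx uvt.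
split=> [[cp p0 ip]|[p0 sp]].
  split=> // a b; split => // s t _ st _; apply/matrixP => i j.
  by rewrite ord1 !mxE; have := ip s t i st; rewrite key // !mxE.
have [cp _] := sp 0 0.
split => // a b i ab; rewrite key //.
have [_ ip] := sp a b; by rewrite -(ip a b) ?lexx // !mxE.
Qed.

Definition trans : set 'M[R]_n :=
  [set P | exists u X T, [/\ nice u, 0 <= T, fundamental (sysmx u) X & P = X T]].

Lemma nice_fundamental u : nice u -> exists X, fundamental (sysmx u) X.
Proof.
move=> nu; have [L uL] := nice_bounded nu.
have [X [X0 sX]] := lin_sol_exists (nice_locb nu) uL.
by exists X.
Qed.

Lemma trans_unit P : trans P -> P \in unitmx.
Proof.
move=> [u [X [T [nu _ FX ->]]]]; have [L uL] := nice_bounded nu.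
exact: fundamental_unit (nice_locb nu) uL FX T.
Qed.

Lemma trans_segment u X s t : nice u -> fundamental (sysmx u) X -> s <= t ->
  trans (X t *m invmx (X s)).
Proof.
move=> nu FX st; have [L uL] := nice_bounded nu.
exists (fun r => u (r + s)), (fun r => X (r + s) *m invmx (X s)), (t - s).
split; [exact: nice_shift|by rewrite subr_ge0| |by rewrite subrK].
exact: fundamental_shift (nice_locb nu) uL FX s.
Qed.

(** Concatenation of controls; the switching time itself is a null set. *)
Lemma transM P Q : trans P -> trans Q -> trans (P *m Q).
Proof.
move=> [u2 [X2 [T2 [nu2 T20 FX2 ->]]]] [u1 [X1 [T1 [nu1 T10 FX1 ->]]]].
have nu := nice_concat T1 nu1 nu2; set u := concat_control T1 u1 u2 in nu.
have [X FX] := nice_fundamental nu; have [X0 sX] := FX.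
exists u, X, (T2 + T1); split; [by []|exact: addr_ge0|by []|].
have [L1 uL1] := nice_bounded nu1; have [L2 uL2] := nice_bounded nu2.
have ul := nice_locb nu; have ul1 := nice_locb nu1; have ul2 := nice_locb nu2.
have X1E : X T1 = X1 T1.
  have s1 : lin_sol (sysmx u1) 0 T1 X.
    apply: lin_sol_ae (sX 0 T1) => //; apply: aeW => t /andP[_ tT].
    by rewrite /sysmx /u /concat_control tT.
  have := fundamental_flow ul1 uL1 FX1 s1; rewrite X0 => h.
  by rewrite (h T1) ?mulmx1 // T10 lexx.
have s2 : lin_sol (sysmx u2) 0 T2 (fun t => X (t + T1)).
  have := lin_sol_shift T1 ul (sX T1 (T2 + T1)); rewrite subrr addrK.
  apply: lin_sol_ae => //; first exact: locbm_shift.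
  exists [set 0]; split; [exact: measurable_set1|exact: lebesgue_measure_set1|].
  move=> t /= h; apply: contrapT => /eqP t0; apply: h => /andP[t1 t2].
  rewrite /sysmx /u /concat_control addrK ifF //.
  by apply/negbTE; rewrite -ltNge ltrDr lt_neqAle eq_sym t0.
have := fundamental_flow ul2 uL2 FX2 s2 (_ : 0 <= T2 <= T2).
rewrite add0r X1E => -> //; by rewrite T20 lexx.
Qed.

Lemma trans1 w : Omega w -> trans 1%:M.
Proof.
move=> Ow; have nw := nice_cst Ow; have [X FX] := nice_fundamental nw.
by exists (fun=> w), X, 0; split => //; case: FX => ->.
Qed.

Lemma sol_trans u x p t : admissible Omega u -> bilinear_sol A B u x p -> 0 <= t ->
  exists2 P, trans P & p t = P *m x.
Proof.
move=> au sp t0; have [v nv uv] := admissible_nice au.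
have [p0 lp] := (bilinear_solP x p au nv uv).1 sp.
have [X FX] := nice_fundamental nv; have [L vL] := nice_bounded nv.
exists (X t); first by exists v, X, t.
by rewrite (fundamental_flowT (nice_locb nv) vL FX t lp) p0.
Qed.

Lemma sol_neq0 u x p t : admissible Omega u -> bilinear_sol A B u x p -> x != 0 ->
  p t != 0.
Proof.
move=> au sp x0; have [v nv uv] := admissible_nice au.
have [p0 lp] := (bilinear_solP x p au nv uv).1 sp.
have [X FX] := nice_fundamental nv; have [L vL] := nice_bounded nv.
rewrite (fundamental_flowT (nice_locb nv) vL FX t lp) p0.
have uX := fundamental_unit (nice_locb nv) vL FX t.
by apply: contra_neq x0 => h; rewrite -[x](mulKmx uX) h mulmx0.
Qed.

Lemma sol_scale u x p c : admissible Omega u -> bilinear_sol A B u x p ->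
  bilinear_sol A B u (c *: x) (fun t => c *: p t).
Proof.
move=> au sp; have [v nv uv] := admissible_nice au.
have [p0 lp] := (bilinear_solP x p au nv uv).1 sp.
apply: (bilinear_solP _ _ au nv uv).2; split; first by rewrite p0.
move=> a b; have := lin_sol_mulr (nice_locb nv) c%:M (lp a b).
by congr lin_sol; apply/funext => t; rewrite mul_mx_scalar.
Qed.

Lemma trans_sol P x : trans P -> exists u p t,
  [/\ admissible Omega u, bilinear_sol A B u x p, 0 <= t & p t = P *m x].
Proof.
move=> [u [X [T [nu T0 FX ->]]]].
exists u, (fun t => X t *m x), T; split => //; first exact: nice_admissible.
have au := nice_admissible nu.
apply: (bilinear_solP _ _ au nu _).2; first exact: aeW.
have [X0 sX] := FX; split; first by rewrite X0 mul1mx.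
by move=> a b; apply: lin_sol_mulr => //; exact: nice_locb.
Qed.

End ControlSystem.

(** * Krener's theorem for the control system *)

Section Accessibility.
Variables (R : realType) (n m : nat) (A : 'M[R]_n) (B : 'I_m -> 'M[R]_n).
Variable Omega : set 'cV[R]_m.
Variable w0 : 'cV[R]_m.
Hypothesis Ow0 : Omega w0.
Notation trans := (trans A B Omega).
Notation sysmx := (sysmx A B).

(** Transition matrices up to a positive factor, so that statements about the
    projected system become statements about a matrix semigroup. *)
Definition scaled_trans : set 'M[R]_n :=
  [set P | exists g Q, [/\ 0 < g, trans Q & P = g *: Q]].

(** The identity generates the dilations. *)
Definition generators : set 'M[R]_n :=
  [set X | X = 1%:M \/ exists2 w, Omega w & X = bilinear_mx A B w].

Lemma scaled_trans_of P : trans P -> scaled_trans P.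
Proof. by move=> tP; exists 1, P; rewrite scale1r. Qed.

Lemma scaled_trans1 : scaled_trans 1%:M.
Proof. exact/scaled_trans_of/(trans1 A B Ow0). Qed.

Lemma scaled_transM P Q : scaled_trans P -> scaled_trans Q -> scaled_trans (P *m Q).
Proof.
move=> [g [P' [g0 tP ->]]] [h [Q' [h0 tQ ->]]].
exists (g * h), (P' *m Q'); split; [exact: mulr_gt0|exact: transM|].
by rewrite -scalemxAl -scalemxAr scalerA.
Qed.

Lemma scaled_trans_unit P : scaled_trans P -> P \in unitmx.
Proof.
move=> [g [Q [g0 /trans_unit uQ ->]]].
by rewrite unitmxZ // unitfE gt_eqF.
Qed.

Lemma mxint_lin (f : 'End('M[R]_n)) (F : R -> 'M[R]_n) a b : locbm F ->
  f (mxint F a b) = mxint (fun t => f (F t)) a b.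
Proof.
move=> Fl; apply/matrixP => k l.
have fE (X : 'M[R]_n) : f X k l = \sum_i \sum_j f (delta_mx i j) k l * X i j.
  rewrite {1}[X]matrix_sum_delta linear_sum summxE; apply: eq_bigr => i _.
  rewrite linear_sum summxE; apply: eq_bigr => j _.
  by rewrite linearZ mxE mulrC.
rewrite fE mxE; under [X in intg X]eq_fun do rewrite fE.
have h i j : locb (fun t => f (delta_mx i j) k l * F t i j).
  by apply: locb_mul => //; exact: locb_cst.
rewrite intg_sum => [|i]; last exact: locb_sum.
apply: eq_bigr => i _; rewrite intg_sum //; apply: eq_bigr => j _.
by rewrite mxE intgZ.
Qed.

Lemma mxint_in (U : {vspace 'M[R]_n}) (F : R -> 'M[R]_n) a b : locbm F ->
  (forall t, F t \in U) -> mxint F a b \in U.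
Proof.
move=> Fl FU.
have -> : mxint F a b = projv U (mxint F a b); last exact: memv_proj.
by rewrite mxint_lin //; congr mxint; apply/funext => t; rewrite projv_id.
Qed.

(** Rescaling linearly in time suffices: the logarithmic derivative of the
    factor is bounded below, since the factor stays away from zero. *)
Lemma scaled_trans_path P : scaled_trans P -> exists g C,
  semigroup_path scaled_trans (set_span generators) g C /\ g 1 = P.
Proof.
move=> [gam [Q [gam0 [u [X [T [nu T0 FX ->]]]] ->]]].
have [L uL] := nice_bounded A B nu; have ul := nice_locb A B nu.
have [C CX] := fundamental_incr ul uL FX T0.
pose c t : R := 1 + (gam - 1) * t.
pose cm := Num.min 1 gam; have cm0 : 0 < cm by rewrite lt_min ltr01.
have cmc t : 0 <= t -> t <= 1 -> cm <= c t.
  move=> t0 t1; rewrite /c.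
  have : (1 - t) * cm <= (1 - t) * 1 by rewrite ler_wpM2l ?subr_ge0 // ge_min lexx.
  have : t * cm <= t * gam by rewrite ler_wpM2l // ge_min lexx orbT.
  lra.
have c0 t : 0 <= t -> t <= 1 -> 0 < c t by move=> t0 t1; exact: lt_le_trans (cmc t t0 t1).
have c1 t : 0 <= t -> t <= 1 -> c t <= 1 + gam.
  by move=> t0 t1; rewrite /c; have := mulr_ge0 (ltW gam0) (_ : 0 <= 1 - t); rewrite subr_ge0 => /(_ t1); lra.
pose g t := c t *: X (t * T).
have [X0 _] := FX.
have C0 : 0 <= C.
  have [h _ _ _ _] : [/\ `|invmx (X 0)| <= C, `|X 0| <= C, `|mxint (sysmx u) 0 0| <= C * (0 - 0),
      `|X 0 - X 0| <= C * (0 - 0) &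
      `|X 0 - X 0 - mxint (sysmx u) 0 0 *m X 0| <= C * (0 - 0) ^+ 2].
    by apply: CX; rewrite ?oppr_le0.
  exact: le_trans h.
have cmi : 0 <= cm^-1 by rewrite invr_ge0 ltW.
pose e := `|gam - 1|; have e0 : 0 <= e by exact: normr_ge0.
pose K := cm^-1 * C + (e / cm + C * T) + ((1 + gam) * C * T ^+ 2 + e * (C * T)).
have K1 : 0 <= cm^-1 * C by rewrite mulr_ge0.
have K2 : 0 <= e / cm + C * T by rewrite addr_ge0 // mulr_ge0.
have K3 : 0 <= (1 + gam) * C * T ^+ 2 + e * (C * T).
  by rewrite addr_ge0 // !mulr_ge0 ?sqr_ge0 //; lra.
exists g, K; split; last by rewrite /g /c mulr1 addrC subrK mul1r.
split; first by rewrite /g /c mulr0 addr0 mul0r X0 scale1r.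
move=> s t s0 st t1; have s1 := le_trans st t1; have t0 := le_trans s0 st.
have sT : s * T <= t * T by rewrite ler_wpM2r.
have tT : t * T <= T by rewrite ler_piMl.
have sT0 : - T <= s * T by apply: (@le_trans _ _ 0); rewrite ?oppr_le0 // mulr_ge0.
have [h1 h2 h3 h4 h5] := CX _ _ sT0 sT tT.
have csu : c s \is a GRing.unit by rewrite unitfE gt_eqF // c0.
have uX := fundamental_unit ul uL FX (s * T).
have gsu : g s \in unitmx by rewrite unitmxZ.
have gi : invmx (g s) = (c s)^-1 *: invmx (X (s * T)) by rewrite invmxZ.
have ts0 : 0 <= t - s by rewrite subr_ge0.
have ci : (c s)^-1 <= cm^-1 by rewrite lef_pV2 ?posrE // ?cmc // c0.
have ci0 : 0 <= (c s)^-1 by rewrite invr_ge0 ltW // c0.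
split.
- exists (c t / c s), (X (t * T) *m invmx (X (s * T))); split.
  + by rewrite divr_gt0 // c0.
  + exact: trans_segment nu FX sT.
  + by rewrite gi /g -scalemxAl -scalemxAr scalerA.
- by [].
- rewrite gi normrZ ger0_norm //; apply: (@le_trans _ _ (cm^-1 * C)); last by rewrite /K; lra.
  by apply: ler_pM.
pose Y := mxint (sysmx u) (s * T) (t * T).
pose d := (gam - 1) * (t - s).
have d1 : `|d| <= e * (t - s) by rewrite /d normrM (ger0_norm ts0).
exists ((d / c s)%:M + Y).
  apply: rpredD.
    by rewrite -scalemx1; apply/memvZ/mem_set_span; left.
  apply: mxint_in => // r; apply: mem_set_span; right.
  by have [_ _ Ou] := nu; exists (u r).
have E : C * (t * T - s * T) = C * T * (t - s) by ring.
rewrite E in h3 h4.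
split.
  apply: (@le_trans _ _ ((e / cm + C * T) * (t - s))); last by rewrite ler_wpM2r // /K; lra.
  rewrite mulrDl; apply: le_trans (ler_normD _ _) _; apply: lerD => //.
  rewrite -scalemx1 normrZ; apply: (@le_trans _ _ (`|d / c s| * 1)).
    by rewrite ler_wpM2l // norm1_mx_le.
  rewrite mulr1 normrM (ger0_norm ci0) mulrAC.
  by apply: ler_pM.
have gE : g t - g s - ((d / c s)%:M + Y) *m g s =
    c s *: (X (t * T) - X (s * T) - Y *m X (s * T)) + d *: (X (t * T) - X (s * T)).
  have -> : g t = c s *: X (t * T) + d *: X (t * T).
    by rewrite -scalerDl /g; congr (_ *: _); rewrite /c /d; ring.
  rewrite mulmxDl mul_scalar_mx /g scalerA divfK; last by rewrite gt_eqF // c0.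
  rewrite -scalemxAr !scalerBr; zmx.
rewrite gE; apply: (@le_trans _ _ (((1 + gam) * C * T ^+ 2 + e * (C * T)) * (t - s) ^+ 2)); last first.
  by rewrite ler_wpM2r ?sqr_ge0 // /K; lra.
rewrite mulrDl; apply: le_trans (ler_normD _ _) _; apply: lerD; rewrite normrZ.
  have -> : (1 + gam) * C * T ^+ 2 * (t - s) ^+ 2 = (1 + gam) * (C * (t * T - s * T) ^+ 2) by ring.
  by apply: ler_pM => //; rewrite gtr0_norm ?c0 // c1.
have -> : e * (C * T) * (t - s) ^+ 2 = (e * (t - s)) * (C * T * (t - s)) by ring.
by apply: ler_pM.
Qed.

(** The inverse of the flow of a constant control, resp. of the dilations. *)
Lemma generator_curve G : generators G -> exists q dq r C,
  [/\ 0 < r, curve11 r C q dq, q 0 = 1%:M, dq 0 = - G &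
      forall s, 0 <= s <= r ->
        exists2 P, scaled_trans P & P *m q s = 1%:M /\ opn (P - 1%:M) <= C * s].
Proof.
move=> [->|[w Ow ->]].
  exists (fun s => (1 - s)%:M), (fun=> - 1%:M), (1 / 2), (n%:R * 2); split.
  - lra.
  - move=> s t _ _; split; last by rewrite subrr normr0 mulr_ge0.
    have -> : (1 - t)%:M - (1 - s)%:M - (t - s) *: - 1%:M = 0 :> 'M[R]_n.
      by apply/matrixP => i j; rewrite !mxE; case: (i == j); rewrite ?mulr1n ?mulr0n; ring.
    by rewrite normr0 mulr_ge0 // ?sqr_ge0 // mulr_ge0.
  - by rewrite subr0.
  - by [].
  move=> s /andP[s0 s1]; have p : 0 < 1 - s by lra.
  exists ((1 - s)^-1)%:M.
    by exists (1 - s)^-1, 1%:M; rewrite invr_gt0 scalemx1; split => //; exact: trans1 Ow0.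
  split; first by rewrite -scalar_mxM mulVf // gt_eqF.
  rewrite -raddfB /= /opn -scalemx1 normrZ -mulrA ler_wpM2l //.
  apply: (@le_trans _ _ (`|(1 - s)^-1 - 1| * 1)); first by rewrite ler_wpM2l // norm1_mx_le.
  have -> : (1 - s)^-1 - 1 = s / (1 - s) by field; rewrite gt_eqF.
  rewrite mulr1 ger0_norm ?divr_ge0 ?(ltW p) // ler_pdivrMr //; nra.
have nw := nice_cst Ow; have [X FX] := nice_fundamental A B nw.
have [L uL] := nice_bounded A B nw; have ul := nice_locb A B nw.
have [C CX] := fundamental_incr ul uL FX ler01.
pose Aw := bilinear_mx A B w.
have MI a b : a <= b -> mxint (sysmx (fun=> w)) a b = (b - a) *: Aw.
  by move=> ab; apply/matrixP => i j; rewrite mxE intg_cst // [RHS]mxE mulrC.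
have [X0 sX] := FX.
have C0 : 0 <= C.
  have [h _ _ _ _] := CX 0 0 (lerN10 R) (lexx _) ler01; exact: le_trans h.
have nAC : 0 <= n%:R * `|Aw| * C by rewrite !mulr_ge0.
exists (fun s => X (- s)), (fun s => - (Aw *m X (- s))), 1,
  (C + n%:R * `|Aw| * C + n%:R * C); split.
- by [].
- have nC : 0 <= n%:R * C by rewrite mulr_ge0.
  have lip s t : `|s| <= 1 -> `|t| <= 1 -> `|X (- t) - X (- s)| <= C * `|t - s|.
    rewrite !ler_norml => /andP[s1 s2] /andP[t1 t2].
    case: (leP s t) => st.
      have [|||_ _ _ h _] := CX (- t) (- s); try lra.
      have -> : `|t - s| = - s - - t by rewrite ger0_norm ?subr_ge0 // opprK addrC.
      by rewrite distrC.
    have [|||_ _ _ h _] := CX (- s) (- t); try lra.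
    by have -> : `|t - s| = - t - - s by rewrite ltr0_norm ?subr_lt0 // opprB opprK addrC.
  move=> s t sr tr; have lst := lip s t sr tr; split; last first.
    have -> : - (Aw *m X (- t)) - - (Aw *m X (- s)) = - (Aw *m (X (- t) - X (- s))).
      by rewrite mulmxBr; zmx.
    rewrite normrN; apply: le_trans (norm_mulmx_le (lexx _) lst) _.
    by rewrite mulrA ler_wpM2r //; lra.
  have sq : 0 <= (t - s) ^+ 2 by rewrite sqr_ge0.
  move: sr tr; rewrite !ler_norml => /andP[s1 s2] /andP[t1 t2].
  case: (leP t s) => ts.
    have [|||_ _ _ _] := CX (- s) (- t); try lra.
    rewrite MI; last lra.
    have -> : - t - - s = - (t - s) by ring.
    rewrite sqrrN scaleNr mulNmx opprK -scalemxAl scalerN opprK => h.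
    by apply: le_trans h _; rewrite ler_wpM2r //; lra.
  have [|||_ _ _ _] := CX (- t) (- s); try lra.
  rewrite MI; last lra.
  have E1 : - s - - t = t - s by ring.
  rewrite E1 -scalemxAl => h.
  have -> : X (- t) - X (- s) - (t - s) *: - (Aw *m X (- s)) =
     (t - s) *: (Aw *m (X (- s) - X (- t)))
     - (X (- s) - X (- t) - (t - s) *: (Aw *m X (- t))).
    by rewrite mulmxBr scalerN scalerBr; zmx.
  apply: le_trans (ler_normB _ _) _.
  have ts0 : 0 <= t - s by lra.
  have -> : (C + n%:R * `|Aw| * C + n%:R * C) * (t - s) ^+ 2 =
    (t - s) * (n%:R * `|Aw| * (C * (t - s))) + C * (t - s) ^+ 2 + n%:R * C * (t - s) ^+ 2 by ring.
  rewrite -[X in X <= _]addr0; apply: lerD; last by rewrite mulr_ge0.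
  apply: lerD => //; rewrite normrZ (ger0_norm ts0) ler_wpM2l //.
  apply: norm_mulmx_le => //; rewrite distrC -(ger0_norm ts0); apply: lip; rewrite ler_norml; apply/andP; split; lra.
- by rewrite oppr0 X0.
- by rewrite oppr0 X0 mulmx1.
move=> s /andP[s0 s1]; exists (X s).
  by apply: scaled_trans_of; exists (fun=> w), X, s.
split.
  have := fundamental_flowT ul uL FX s (_ : forall a b, lin_sol (sysmx (fun=> w)) a b (fun t => X (t + - s))).
  rewrite subrr X0 add0r => -> //.
  move=> a b; have := lin_sol_shift (- s) ul (sX (a + - s) (b + - s)).
  by rewrite !addrK.
have [|||_ _ _ h _] := CX 0 s; try lra.
rewrite /opn -X0; apply: (@le_trans _ _ (n%:R * (C * (s - 0)))); first by rewrite ler_wpM2l.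
by rewrite subr0 mulrA ler_wpM2r //; lra.
Qed.

Theorem trans_krener (y : 'cV[R]_n) (c : R) : 1 < c ->
  (forall z P, small scaled_trans c P -> P *m z = y ->
     (orbit_of scaled_trans z)° !=set0) ->
  exists Q : set 'cV[R]_n, [/\ open Q, Q !=set0 &
    forall z, Q z -> exists2 P, small scaled_trans c P & P *m z = y].
Proof.
apply: (@krener R n scaled_trans generators (set_span generators)).
- exact: scaled_trans1.
- exact: scaled_transM.
- exact: scaled_trans_unit.
- exact: scaled_trans_path.
- exact: generator_curve.
- by move=> U; exact: set_span_min.
Qed.

End Accessibility.

(** * Dense combinations *)

Section Growth.
Variable R : realType.

(** For large [k] the interval from [k%:R * a0] to [k%:R * a1] is longer than [b],
    hence contains a multiple of [b] in its interior. *)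
Lemma small_combination (a0 a1 b e : R) : 0 <= a0 -> a0 < a1 -> 0 < b -> 0 < e ->
  exists a (k l : nat), a0 < a < a1 /\ 0 < k%:R * a - l%:R * b < e.
Proof.
move=> a00 a01 b0 e0.
pose k := (Num.truncn (b / (a1 - a0))).+1.
have k0 : 0 < k%:R :> R by rewrite ltr0n.
have kb : b < k%:R * (a1 - a0).
  by rewrite -ltr_pdivrMr ?subr_gt0 //; exact: truncnS_gt.
pose l := (Num.truncn (k%:R * a0 / b)).+1.
have q0 : 0 <= k%:R * a0 / b by rewrite divr_ge0 ?mulr_ge0 // ltW.
have l1 : k%:R * a0 < l%:R * b by rewrite -ltr_pdivrMr //; exact: truncnS_gt.
have l2 : l%:R * b <= k%:R * a0 + b.
  have : (Num.truncn (k%:R * a0 / b))%:R <= k%:R * a0 / b by rewrite truncn_le.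
  by rewrite ler_pdivlMr // /l -natr1; lra.
pose h := Num.min (e / 2) ((k%:R * a1 - l%:R * b) / 2).
have h0 : 0 < h by rewrite lt_min !divr_gt0 //; lra.
have he : h <= e / 2 by rewrite ge_min lexx.
have h1 : h <= (k%:R * a1 - l%:R * b) / 2 by rewrite ge_min lexx orbT.
exists ((l%:R * b + h) / k%:R), k, l; split.
  by rewrite ltr_pdivlMr // ltr_pdivrMr //; apply/andP; split; lra.
rewrite mulrC divfK ?gt_eqF //; apply/andP; split; lra.
Qed.

(** Multiples of the small combination progress upwards by less than [e]; a large
    multiple of [b] gives the start, below [c]. *)
Lemma combination_dense (a b e c : R) (k l : nat) : 0 < b ->
  0 < k%:R * a - l%:R * b < e ->
  exists k' l' : nat, `|k'%:R * a - l'%:R * b - c| <= e.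
Proof.
move=> b0 /andP[t0 te]; set t := _ - _ in t0 te.
pose L := (Num.truncn (`|c| / b)).+1.
have Lc : 0 <= c + L%:R * b.
  have : `|c| < L%:R * b by rewrite -ltr_pdivrMr //; exact: truncnS_gt.
  have := ler_norm (- c); rewrite normrN; lra.
pose j := Num.truncn ((c + L%:R * b) / t).
have q0 : 0 <= (c + L%:R * b) / t by rewrite divr_ge0 // ltW.
have j1 : j%:R * t <= c + L%:R * b by rewrite -ler_pdivlMr // truncn_le.
have j2 : c + L%:R * b < j.+1%:R * t by rewrite -ltr_pdivrMr // truncnS_gt.
exists (j * k)%N, (j * l + L)%N.
have -> : (j * k)%:R * a - (j * l + L)%:R * b - c = j%:R * t - (c + L%:R * b).
  by rewrite /t natrD !natrM; ring.
rewrite -natr1 in j2; rewrite ler_norml; apply/andP; split; lra.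
Qed.

End Growth.

(** * The unit sphere *)

Section Sphere.
Variables (R : realType) (n : nat).
Implicit Types (x v : 'cV[R]_n) (s t : @unit_sphere R n).

Lemma enorm_ge0 x : 0 <= enorm x. Proof. exact: sqrtr_ge0. Qed.

Lemma enorm_eq0 x : (enorm x == 0) = (x == 0).
Proof.
apply/eqP/eqP => [/eqP|->]; last first.
  by rewrite /enorm big1 ?sqrtr0 // => i _; rewrite mxE expr0n.
rewrite sqrtr_eq0 => h; apply/matrixP => i j; rewrite ord1 [RHS]mxE.
apply/eqP; rewrite -sqrf_eq0 eq_le sqr_ge0 andbT; apply: le_trans h.
by rewrite (bigD1 i) //= lerDl sumr_ge0 // => k _; rewrite sqr_ge0.
Qed.

Lemma enorm_gt0 x : (0 < enorm x) = (x != 0).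
Proof. by rewrite lt_def enorm_ge0 andbT enorm_eq0. Qed.

Lemma enormZ (c : R) x : enorm (c *: x) = `|c| * enorm x.
Proof.
rewrite /enorm -sqrtr_sqr -sqrtrM ?sqr_ge0 // mulr_sumr; congr Num.sqrt.
by apply: eq_bigr => i _; rewrite mxE exprMn.
Qed.

Lemma enorm_continuous : continuous (@enorm R n).
Proof.
move=> x; apply: (@continuous_comp _ _ _ (fun y : 'cV[R]_n => \sum_(i < n) y i 0 ^+ 2) Num.sqrt);
  last exact: sqrt_continuous.
have h (r : seq 'I_n) : continuous (fun y : 'cV[R]_n => \sum_(i <- r) y i 0 ^+ 2).
  elim: r => [|i r IH] y.
    have -> : (fun y : 'cV[R]_n => \sum_(i <- [::]) y i 0 ^+ 2) = (fun=> 0).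
      by apply/funext => z; rewrite big_nil.
    exact: cst_continuous.
  have -> : (fun y : 'cV[R]_n => \sum_(l <- i :: r) y l 0 ^+ 2) =
      (fun y => y i 0 ^+ 2 + \sum_(l <- r) y l 0 ^+ 2).
    by apply/funext => z; rewrite big_cons.
  have ci : (fun z : 'cV[R]_n => z i 0 ^+ 2) z @[z --> y] --> y i 0 ^+ 2.
    apply: (@continuous_comp _ _ _ (fun z : 'cV[R]_n => z i 0) (fun z : R => z ^+ 2)).
      exact: coord_continuous.
    exact: exprn_continuous.
  exact: (cvgD ci (IH y)).
exact: h.
Qed.

Definition nrm x : 'cV[R]_n := (enorm x)^-1 *: x.

Lemma nrm_near x e : x != 0 -> 0 < e -> exists2 d, 0 < d &
  forall y, `|x - y| < d -> y != 0 /\ `|nrm x - nrm y| < e.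
Proof.
move=> x0 e0.
have xn0 : enorm x != 0 by rewrite enorm_eq0.
have ce : enorm y @[y --> nbhs x] --> enorm x := @enorm_continuous x.
have c1 : {for x, continuous nrm}.
  exact: (cvgZ (cvgV xn0 ce) (@cvg_id _ (nbhs x))).
have h1 : \forall y \near x, enorm y != 0 by exact: (@cvgr_neq0 _ _ _ (nbhs x) _ (@enorm R n) _ ce xn0).
have h2 : \forall y \near x, `|nrm x - nrm y| < e by move/cvgrPdist_lt: c1; exact.
have h3 : nbhs x [set y | enorm y != 0 /\ `|nrm x - nrm y| < e].
  exact: filterI h1 h2.
have [d /= d0 dP] := (nbhs_ballP x _).1 h3.
exists d => // y xy; have [] := dP y; first by rewrite -ball_normE.
by rewrite /= enorm_eq0.
Qed.

Lemma sphere_enorm s : enorm (\val s) = 1.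
Proof. exact: (set_valP s). Qed.

Lemma sphere_neq0 s : \val s != 0.
Proof. by rewrite -enorm_eq0 sphere_enorm oner_neq0. Qed.

Lemma enorm_nrm x : x = enorm x *: nrm x.
Proof.
have [->|x0] := eqVneq x 0; first by rewrite /nrm !scaler0.
by rewrite /nrm scalerA mulfV ?scale1r // enorm_eq0.
Qed.

Lemma nrmZ_gt0 g x : 0 < g -> nrm (g *: x) = nrm x.
Proof.
move=> g0; rewrite /nrm enormZ gtr0_norm // invfM scalerA.
by rewrite mulrAC mulVf ?mul1r // gt_eqF.
Qed.

Lemma nrm_sphere s : nrm (\val s) = \val s.
Proof. by rewrite /nrm sphere_enorm invr1 scale1r. Qed.

Lemma nrmZ g s : 0 < g -> nrm (g *: \val s) = \val s.
Proof. by move=> g0; rewrite nrmZ_gt0 // nrm_sphere. Qed.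

Lemma sphere_mk x : x != 0 -> exists s, \val s = nrm x.
Proof.
move=> x0; have h : unit_sphere (nrm x).
  by rewrite /unit_sphere /= enormZ ger0_norm ?invr_ge0 ?enorm_ge0 // mulVf // enorm_eq0.
by exists (exist _ (nrm x) (mem_set h)).
Qed.

Lemma sphere_nbhsP s (E : set (@unit_sphere R n)) : nbhs s E <->
  exists2 e, 0 < e & forall t, `|\val s - \val t| < e -> E t.
Proof.
split=> [/nbhs_ballP[e /= e0 eE]|[e e0 eE]].
  exists e => // t st; apply: eE; rewrite -initial_ballE /=.
  by rewrite -ball_normE.
apply/nbhs_ballP; exists e => // t; rewrite -initial_ballE /= -ball_normE /= => st.
exact: eE.
Qed.

End Sphere.

(** * From the sphere to the cone *)

Section ProjectedSystem.
Variables (R : realType) (n m : nat) (A : 'M[R]_n) (B : 'I_m -> 'M[R]_n).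
Variable Omega : set 'cV[R]_m.
Notation U := (admissible Omega).
Notation trans := (trans A B Omega).
Notation ssol := (sphere_sol A B).
Notation sol := (bilinear_sol A B).

Implicit Types s : @unit_sphere R n.

Definition gain s g s' := 0 < g /\ exists2 P, trans P & P *m \val s = g *: \val s'.

Lemma sphere_reach_gain T s s' : reach_le U ssol T s s' -> exists g, gain s g s'.
Proof.
move=> [t [u [p [/andP[t0 _] au [q sq qp] pt]]]].
have q0 := sol_neq0 t au sq (sphere_neq0 s).
have [P tP Pq] := sol_trans au sq t0.
exists (enorm (q t)); split; first by rewrite enorm_gt0.
by exists P => //; rewrite -Pq -pt qp -/(nrm _) -enorm_nrm.
Qed.

Lemma gain_comp s1 s2 s3 g1 g2 : gain s1 g1 s2 -> gain s2 g2 s3 ->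
  gain s1 (g2 * g1) s3.
Proof.
move=> [g10 [P1 tP1 E1]] [g20 [P2 tP2 E2]]; split; first exact: mulr_gt0.
exists (P2 *m P1); first exact: transM.
by rewrite -mulmxA E1 -scalemxAr E2 scalerA mulrC.
Qed.

Lemma gain_loop w s g k : Omega w -> gain s g s -> gain s (g ^+ k) s.
Proof.
move=> Ow gs; elim: k => [|k IH]; last by rewrite exprS; exact: gain_comp gs.
by rewrite expr0; split => //; exists 1%:M; rewrite ?mul1mx ?scale1r //; exact: trans1 Ow.
Qed.

Lemma sol_gain u s p t g s' : U u -> sol u (\val s) p -> 0 <= t -> 0 < g ->
  p t = g *: \val s' -> gain s g s'.
Proof.
by move=> au sp t0 g0 pt; have [P tP pP] := sol_trans au sp t0; split => //; exists P; rewrite -?pP.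
Qed.

Lemma reach_trans x P : trans P -> reach U sol x (P *m x).
Proof.
move=> tP; have [u [p [t [au sp t0 pt]]]] := trans_sol x tP.
exists (t + 1); first by rewrite /= ltr_wpDl.
by exists t, u, p; rewrite t0 lerDl ler01.
Qed.

Lemma sphere_sol_ex u s p : U u -> sol u (\val s) p ->
  exists2 q, ssol u s q & forall t, \val (q t) = nrm (p t).
Proof.
move=> au sp.
have [q qp] := choice (fun t => sphere_mk (sol_neq0 t au sp (sphere_neq0 s))).
by exists q => //; exists p.
Qed.

Lemma admissible_omega u : U u -> exists w, Omega w.
Proof. by move=> /admissible_nice[v [_ _ Ov] _]; exists (v 0). Qed.

Variable D : set (@unit_sphere R n).
Hypothesis D_viable : viable U ssol D.
Hypothesis D_approx : approx_controllable U ssol D.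
Hypothesis D_accessible : forall s, D° s -> locally_accessible U ssol s.

(** Near [y], the points steered to the ray of [y] contain an open set [Q]
    that projects into [D]; any [s] in [D] reaches [Q], hence the ray itself and
    not only its neighbourhoods. *)
Lemma exact_control s y : D s -> D° y ->
  exists g, gain s g y.
Proof.
move=> Ds Dy.
have [u [_ [au _ _]]] := D_viable Ds; have [w Ow] := admissible_omega au.
have y0 := sphere_neq0 y.
have Dyo : nbhs y D° by apply: open_nbhs_nbhs; split => //; exact: open_interior.
have [e e0 eD] := (sphere_nbhsP y D°).1 Dyo.
have [d d0 dy] := nrm_near y0 e0.
pose N := `|\val y|; have N0 : 0 < N by rewrite normr_gt0.
pose c := 1 + Num.min (1 / 2) (d / (2 * (N + 1))).
have c1 : 1 < c by rewrite ltrDl lt_min; apply/andP; split; [lra|rewrite divr_gt0 //; lra].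
have c2 : c - 1 <= 1 / 2 by rewrite /c addrC addKr ge_min lexx.
have c3 : (c - 1) * (2 * N) < d.
  have h : c - 1 <= d / (2 * (N + 1)) by rewrite /c addrC addKr ge_min lexx orbT.
  rewrite ler_pdivlMr in h; last by lra.
  have : 0 < c - 1 by lra.
  nra.
have near z P : small (scaled_trans A B Omega) c P -> P *m z = \val y ->
    exists2 sz, D° sz & z != 0 /\ \val sz = nrm z.
  move=> [_ Pc] Pz.
  have zy : `|\val y - z| <= (c - 1) * `|z|.
    rewrite -Pz -{2}[z]mul1mx -mulmxBl; apply: le_trans (opn_mulv _ _) _.
    by rewrite ler_wpM2r.
  have zN : `|z| <= 2 * N.
    have := ler_normB (\val y) (\val y - z); rewrite opprB addrC subrK -/N.
    have := ler_wpM2r (normr_ge0 z) c2; lra.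
  have [z0 zn] : z != 0 /\ `|nrm (\val y) - nrm z| < e.
    apply: dy; apply: le_lt_trans c3; apply: le_trans zy _.
    by rewrite ler_wpM2l //; lra.
  have [sz szE] := sphere_mk z0; exists sz => //.
  by apply: eD; rewrite szE -[X in X - _]nrm_sphere.
have fat z P : small (scaled_trans A B Omega) c P -> P *m z = \val y ->
    (orbit_of (scaled_trans A B Omega) z)° !=set0.
  move=> Pc Pz; have [sz Dsz [z0 szE]] := near z P Pc Pz.
  have [[s1 s1i] _] := D_accessible Dsz ltr01.
  have [e1 e10 e1r] := (sphere_nbhsP s1 _).1 s1i.
  have [d1 d10 dn] := nrm_near (sphere_neq0 s1) e10.
  exists (\val s1); apply/nbhs_ballP; exists d1 => // v; rewrite -ball_normE /= => sv.
  have [v0 vn] := dn v sv.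
  have [sv' svE] := sphere_mk v0.
  have [g [g0 [P' tP PE]]] : exists g, gain sz g sv'.
    apply: (@sphere_reach_gain 1); apply: e1r; rewrite svE.
    by rewrite nrm_sphere in vn.
  exists ((enorm v / (g * enorm z)) *: P').
    exists (enorm v / (g * enorm z)), P'; split => //.
    by rewrite divr_gt0 // ?mulr_gt0 ?enorm_gt0.
  rewrite -scalemxAl [X in P' *m X]enorm_nrm -szE -scalemxAr PE svE.
  rewrite [LHS]enorm_nrm; move: (nrm v) => r; rewrite !scalerA; congr (_ *: _).
  by field; rewrite gt_eqF ?enorm_gt0 //= gt_eqF.
have [Q [Qo [q Qq] Qy]] := trans_krener Ow c1 fat.
have [P Pc Pq] := Qy q Qq.
have [sq Dsq [q0 sqE]] := near q P Pc Pq.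
have [s' [[T _ [t [v [p [tT av sp pt]]]]] Qs']] :
    (reach U ssol s `&` [set s' | Q (enorm q *: \val s')]) !=set0.
  apply: (D_approx Ds (interior_subset Dsq)).
  have : nbhs q Q by apply: open_nbhs_nbhs; split.
  move=> /nbhs_ballP[r /= r0 rQ]; apply/sphere_nbhsP.
  have eq0 : 0 < enorm q by rewrite enorm_gt0.
  exists (r / enorm q); first by rewrite divr_gt0.
  move=> t st /=; apply: rQ; rewrite -ball_normE /= {1}(enorm_nrm q) -sqE -scalerBr normrZ.
  by rewrite gtr0_norm // mulrC -ltr_pdivlMr.
have [g [g0 [P1 tP1 P1E]]] : exists g, gain s g s'.
  by apply: (@sphere_reach_gain T); exists t, v, p.
have [_ [[g2 [P2 [g20 tP2 ->]]] _] P2E] := Qy _ Qs'.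
exists (g / (g2 * enorm q)); split; first by rewrite divr_gt0 // mulr_gt0 // enorm_gt0.
exists (P2 *m P1); first exact: transM.
rewrite -mulmxA P1E -P2E -scalemxAl -!scalemxAr !scalerA; congr (_ *: _).
have q1 : enorm q != 0 by rewrite enorm_eq0.
have g21 : g2 != 0 by rewrite gt_eqF.
by rewrite -mulrA divfK ?mulf_neq0.
Qed.

Lemma cone_interior : D° !=set0 -> (cone D)° !=set0.
Proof.
move=> [y Dy]; have [e e0 eD] := (sphere_nbhsP y D).1 Dy.
have [d d0 dy] := nrm_near (sphere_neq0 y) e0.
exists (\val y); apply/nbhs_ballP; exists d => // v; rewrite -ball_normE /= => yv.
have [v0 vn] := dy v yv; have [s sE] := sphere_mk v0.
exists (enorm v), s; split; [by rewrite enorm_gt0| |by rewrite sE -enorm_nrm].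
by apply: eD; rewrite sE -[X in X - _]nrm_sphere.
Qed.

Lemma cone_viable : viable U sol (cone D).
Proof.
move=> _ [a [s [a0 Ds ->]]]; have [u [q [au [p sp qp] qD]]] := D_viable Ds.
exists u, (fun t => a *: p t); split; [by []|exact: sol_scale au sp|].
move=> t t0; exists (a * enorm (p t)), (q t); split; last 1 first.
- by rewrite qp -scalerA -/(nrm _) -enorm_nrm.
- by rewrite mulr_gt0 // enorm_gt0 (sol_neq0 t au sp (sphere_neq0 s)).
- exact: qD.
Qed.

Section Growth.
Variables a0 d0 am : R.
Hypotheses (a01 : 1 < a0) (d00 : 0 < d0) (am01 : 0 < am < 1).
Hypothesis D_growth : forall ap, a0 < ap < a0 + d0 ->
  exists sp sm, [/\ D° sp, D° sm, gain sp ap sp & gain sm am sm].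

(** A point of [D] is steered to [sp], circles there, goes to [sm], circles
    there, and leaves for a neighbourhood of [s'].  The radius changes by a fixed
    factor, the legs of the trip, times [ap ^+ k * am ^+ l]; the logarithms of
    these products can be made as dense as wanted because [ap] is free in an
    interval. *)
Lemma cone_approx : approx_controllable U sol (cone D).
Proof.
move=> _ [a [s [a_gt0 Ds ->]]] _ [b [s' [b_gt0 Ds' ->]]] N /nbhs_ballP[e /= e0 eN].
have [u [_ [au _ _]]] := D_viable Ds; have [w Ow] := admissible_omega au.
pose v := \val s'; have vN : 0 <= `|v| by [].
pose e1 := Num.min 1 (e / (2 * b)).
have e10 : 0 < e1 by rewrite lt_min ltr01 divr_gt0 // mulr_gt0.
have e11 : e1 <= 1 by rewrite ge_min lexx.
have e1b : b * e1 <= e / 2.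
  have : e1 <= e / (2 * b) by rewrite ge_min lexx orbT.
  by rewrite ler_pdivlMr ?mulr_gt0 //; lra.
pose e2 := e / (2 * (`|v| + 1)); have e20 : 0 < e2 by rewrite divr_gt0 //; lra.
have e2v : e2 * (`|v| + 1) = e / 2 by rewrite /e2; field; lra.
have [h h0 hexp] : exists2 h, 0 < h & forall z, `|ln b - z| < h -> `|b - expR z| < e2.
  have /cvgrPdist_lt/(_ _ e20)/nbhs_ballP[h /= h0 hP] := @continuous_expR R (ln b).
  exists h => // z bz; have := hP z; rewrite -ball_normE /= lnK //; exact.
have la0 : 0 <= ln a0 by rewrite ltW // ln_gt0.
have p0 : 0 < a0 := lt_trans ltr01 a01; have p1 : 0 < a0 + d0 := addr_gt0 p0 d00.
have la1 : ln a0 < ln (a0 + d0) by rewrite ltr_ln ?ltrDl // posrE.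
have lam : 0 < - ln am by rewrite oppr_gt0 ln_lt0.
have h20 : 0 < h / 2 by lra.
have [ap [k [l [/andP[ap1 ap2] kl]]]] := small_combination la0 la1 lam h20.
have apI : a0 < expR ap < a0 + d0.
  by apply/andP; split; [rewrite -[ltLHS](lnK p0)|rewrite -[ltRHS](lnK p1)]; rewrite ltr_expR.
have [sp [sm [Dsp Dsm gp gm]]] := D_growth apI.
have [g1 G1] := exact_control Ds Dsp.
have [g2 G2] := exact_control (interior_subset Dsp) Dsm.
have [s'' [[T _ r3] s's'']] : (reach U ssol sm `&` [set t | `|v - \val t| < e1]) !=set0.
  by apply: (D_approx (interior_subset Dsm) Ds'); apply/sphere_nbhsP; exists e1.
have [g3 G3] := sphere_reach_gain r3.
have [g10 _] := G1; have [g20 _] := G2; have [g30 _] := G3.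
have [k' [l' kl']] := combination_dense (ln b - ln (a * g1 * g2 * g3)) lam kl.
have [g_gt0 [P tP PE]] := gain_comp (gain_comp (gain_comp (gain_comp G1
  (gain_loop k' Ow gp)) G2) (gain_loop l' Ow gm)) G3.
set g := g3 * _ in g_gt0 PE.
exists (P *m (a *: \val s)); split; first exact: reach_trans.
have gb : `|b - a * g| < e2.
  pose z := ln (a * g1 * g2 * g3) + (k'%:R * ap - l'%:R * - ln am).
  have -> : a * g = expR z.
    have q0 : 0 < a * g1 * g2 * g3 by rewrite !mulr_gt0.
    have q1 : 0 < am by case/andP: am01.
    by rewrite /z mulrN opprK !expRD !expRM_natl (lnK q0) (lnK q1) /g; ring.
  by apply: hexp; rewrite distrC /z; move: kl'; rewrite ler_norml ltr_norml; lra.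
apply: eN; rewrite -ball_normE /= -scalemxAr PE scalerA.
have vv : `|v - \val s''| < e1 := s's''.
rewrite -/v; move: (\val s'') vv => v'' vv''.
have -> : b *: v - (a * g) *: v'' = b *: (v - v'') + (b - a * g) *: v''.
  by rewrite scalerBr scalerBl addrA subrK.
apply: le_lt_trans (ler_normD _ _) _; rewrite !normrZ (gtr0_norm b_gt0).
have v1 : `|v''| <= `|v| + 1.
  by have := ler_normB v (v - v''); rewrite opprB addrC subrK; lra.
have t1 : b * `|v - v''| < b * e1 by rewrite ltr_pM2l.
have t2 : `|b - a * g| * `|v''| <= e2 * (`|v| + 1) by apply: ler_pM => //; exact: ltW.
lra.
Qed.

End Growth.

(** The directions met by a larger set [D'] form a set with the first two
    properties of a control set of the projected system. *)
Lemma cone_maximal (D' : set 'cV[R]_n) : D !=set0 ->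
  (forall E, D `<=` E -> viable U ssol E -> approx_controllable U ssol E -> E = D) ->
  cone D `<=` D' -> viable U sol D' -> approx_controllable U sol D' -> D' = cone D.
Proof.
move=> [s0 Ds0] Dmax DD' vD' aD'.
have D's0 : D' (\val s0) by apply: DD'; exists 1, s0; rewrite scale1r.
(* The orbit of the origin is the origin, which is not dense near [s0]. *)
have D'n0 x : D' x -> x != 0.
  move=> D'x; apply/eqP => x0.
  have N0 : nbhs (\val s0) [set y : 'cV[R]_n | y != 0].
    apply/nbhs_ballP; exists `|\val s0|; first by rewrite /= normr_gt0 sphere_neq0.
    move=> y; rewrite -ball_normE /= => yn; apply/eqP => y0.
    by move: yn; rewrite y0 subr0 ltxx.
  have [y [[T _ [t [u [p [/andP[t0 _] au sp <-]]]]] /=]] := aD' x D'x _ D's0 _ N0.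
  by have [P _ ->] := sol_trans au sp t0; rewrite x0 mulmx0 eqxx.
pose E := [set s : @unit_sphere R n | exists2 a, 0 < a & D' (a *: \val s)].
have nE x s : D' x -> \val s = nrm x -> E s.
  move=> D'x sE; exists (enorm x); first by rewrite enorm_gt0 D'n0.
  by rewrite sE -enorm_nrm.
have ED : E = D.
  apply: Dmax.
  - by move=> s Ds; exists 1 => //; apply: DD'; exists 1, s.
  - move=> s [a a0 D's]; have [u [p [au sp pD']]] := vD' _ D's.
    have sp1 : sol u (\val s) (fun t => a^-1 *: p t).
      by have := sol_scale a^-1 au sp; rewrite scalerA mulVf ?scale1r // gt_eqF.
    have [q sq qp] := sphere_sol_ex au sp1.
    exists u, q; split => // t t0; apply: (nE _ _ (pD' t t0)).
    by rewrite qp nrmZ_gt0 ?invr_gt0.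
  - move=> s [a a0 D's] s' [a' a'0 D's'] N /sphere_nbhsP[e e0 eN].
    have x0 := D'n0 _ D's'; have [d d0 dN] := nrm_near x0 e0.
    have [|y [[T T0 [t [u [p [tT au sp <-]]]]] /= yd]] :=
        aD' _ D's _ D's' [set y | `|a' *: \val s' - y| < d].
      by apply/nbhs_ballP; exists d => // y; rewrite -ball_normE.
    have [_ yn] := dN _ yd; rewrite nrmZ // in yn.
    have sp1 : sol u (\val s) (fun t => a^-1 *: p t).
      by have := sol_scale a^-1 au sp; rewrite scalerA mulVf ?scale1r // gt_eqF.
    have [q sq qp] := sphere_sol_ex au sp1.
    exists (q t); split; first by exists T => //; exists t, u, q.
    by apply: eN; rewrite qp nrmZ_gt0 ?invr_gt0.
apply/seteqP; split=> // x D'x; have x0 := D'n0 x D'x.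
have [s sE] := sphere_mk x0.
exists (enorm x), s; split; [by rewrite enorm_gt0| |by rewrite sE -enorm_nrm].
by rewrite -ED; exact: nE sE.
Qed.

End ProjectedSystem.

Theorem theorem3p2 (R : realType) (n m : nat)
  (A : 'M[R]_n) (B : 'I_m -> 'M[R]_n) (Omega : set 'cV[R]_m)
  (D : set (@unit_sphere R n))
  (D_control_set : control_set (admissible Omega) (sphere_sol A B) D)
  (D_interior : D° !=set0)
  (D_accessible : forall s, D° s ->
     locally_accessible (admissible Omega) (sphere_sol A B) s)
  (D_growth : exists alpha0 delta0 alpham : R,
     [/\ 1 < alpha0, 0 < delta0, 0 < alpham < 1 &
      forall alphap : R, alpha0 < alphap < alpha0 + delta0 ->
      exists sp sm, [/\ D° sp, D° sm &
      exists up um, [/\ admissible Omega up, admissible Omega um &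
      exists sigmap sigmam : R, [/\ 0 < sigmap, 0 < sigmam,
        exists2 p, bilinear_sol A B up (\val sp) p &
          p sigmap = alphap *: \val sp &
        exists2 p, bilinear_sol A B um (\val sm) p &
          p sigmam = alpham *: \val sm]]]]) :
  control_set (admissible Omega) (bilinear_sol A B) (cone D) /\
  (cone D)° !=set0.
Proof.
have [D0 D_viable D_approx D_maximal] := D_control_set.
have [a0 [d0 [am [a01 d00 am01 growth]]]] := D_growth.
split; last exact: cone_interior.
split.
- have [s Ds] := D0; exists (\val s); exists 1, s; split; [exact: ltr01|by []|by rewrite scale1r].
- exact: cone_viable.
- apply: (cone_approx D_viable D_approx D_accessible a01 d00 am01) => ap apI.
  have [sp [sm [Dsp Dsm [up [um [aup aum [tp [tm [tp0 tm0 [p sp1 pp] [q sq qq]]]]]]]]]] :=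
    growth ap apI.
  have ap0 : 0 < ap by case/andP: apI => h _; exact: lt_trans (lt_trans ltr01 a01) h.
  have am0 : 0 < am by case/andP: am01.
  exists sp, sm; split=> //; [exact: (sol_gain aup sp1 (ltW tp0) ap0 pp)|].
  exact: (sol_gain aum sq (ltW tm0) am0 qq).
- by move=> D'; exact: cone_maximal D0 D_maximal.
Qed.
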